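(* Let $\mathcal V=V[h^{-1},h]$ be a vertex operator algebra with a formal parameter, $\mathcal F$ the associated rescaled complex of light modes with BRST differential $Q$, and $\mu_0,n_0$ the leading coefficients in $h$ of the Lian–Zuckerman operations $\mu,n$ on $\mathcal F$. Then $(\mathcal F;Q,\mu_0,n_0)$ is an $A_\infty$-algebra in which all operations $\mu_k$ with $k\ge4$ vanish; that is, $Q,\mu_0,n_0$ generate an $A_{(3)}$-algebra.
   Context: **VOA with a formal parameter.** $V=\bigoplus_{n\ge 0}V^n$ is a graded complex vector space, $\mathcal V^n=V^n[h^{-1},h]$, and $\mathcal V=\bigoplus_{n\ge0}\mathcal V^n$ carries a VOA structure whose space of conformal weight $n$ is $\mathcal V^n$. A state $A$ has vertex operator $A(z)=\sum_n A_nz^{-n-1}$; the Virasoro field is $L(z)=\sum_n L_nz^{-n-2}$. Assumed: (i) all modes $A_n$ commute with $\mathbb C[h,h^{-1}]$; (ii) $A_nB\in hV[h]$ for $A,B\in V$, $n\ge0$; (iii) $L_{-1}V\subset V$; (iv) $L_1A\in hV$ for $A\in V^1$. $V[h]$ is a vertex algebra (closed under all products). **Ghosts and BRST operator.** $\Lambda$ is the Fock module of $\{b_n,c_m\}=\delta_{n+m,0}$ with vacuum $\mathbf 1$, $c_k\mathbf 1=0$ for $k\ge2$, $b_k\mathbf 1=0$ for $k\ge-1$; $b(z)=\sum b_mz^{-m-2}$, $c(z)=\sum c_nz^{-n+1}$ (weights $2$ and $-1$). The ghost number $|a|$ counts $c$ with $+1$ and $b$ with $-1$. On $\mathcal V\otimes\Lambda$: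 $Q=\mathrm{Res}_z\big(c(z)L(z)+{:}c\,\partial c\,b{:}(z)+\tfrac32\partial^2c(z)\big)$. **The complex $\mathcal F$.** Writing states via their operators, $\mathcal F_0=V^0$, $\mathcal F_1=cV^1\oplus h\,\partial c\,V^0$, $\mathcal F_2=h\,c\,\partial c\,V^1\oplus h\,c\,\partial^2c\,V^0$, $\mathcal F_3=h^2c\,\partial c\,\partial^2c\,V^0$, graded by ghost number, with differential $Q$. **Operations.** $\mu(a_1,a_2)=\mathrm{Res}_z\frac{a_1(z)a_2}{z}$ and $n(a_1,a_2,a_3)=\sum_{i\ge0}\frac1{i+1}\mathrm{Res}_z\mathrm{Res}_w\,w^iz^{-i-1}(b_{-1}a_1)(z)a_2(w)a_3+(-1)^{|a_1||a_2|}\sum_{i\ge0}\frac1{i+1}\mathrm{Res}_w\mathrm{Res}_z\,z^iw^{-i-1}(b_{-1}a_2)(w)a_1(z)a_3$. These map $\mathcal F_i\otimes\mathcal F_j\to\mathcal F_{i+j}[h]$ and $\mathcal F_i\otimes\mathcal F_j\otimes\mathcal F_k\to\mathcal F_{i+j+k-1}[h]$, and $\mu=\mu_0+O(h)$, $n=n_0+O(h)$ on $\mathcal F$. **$A_{(3)}$-algebra.** An $A_\infty$-algebra whose operations $\mu_k$ vanish for $k>3$. With $\mu_1=Q$, $\mu_2=\mu$, $\mu_3=n$ (degrees $1,0,-1$) the relations are: - $Q^2=0$; - $Q\mu(a_1,a_2)=\mu(Qa_1,a_2)+(-1)^{|a_1|}\mu(a_1,Qa_2)$; - $Qn(a_1,a_2,a_3)+n(Qa_1,a_2,a_3)+(-1)^{|a_1|}n(a_1,Qa_2,a_3)+(-1)^{|a_1|+|a_2|}n(a_1,a_2,Qa_3)=\mu(\mu(a_1,a_2),a_3)-\mu(a_1,\mu(a_2,a_3))$;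 - $(-1)^{|a_1|}\mu(a_1,n(a_2,a_3,a_4))+\mu(n(a_1,a_2,a_3),a_4)=n(\mu(a_1,a_2),a_3,a_4)-n(a_1,\mu(a_2,a_3),a_4)+n(a_1,a_2,\mu(a_3,a_4))$; - $n(n(a_1,a_2,a_3),a_4,a_5)+(-1)^{|a_1|}n(a_1,n(a_2,a_3,a_4),a_5)+(-1)^{|a_1|+|a_2|}n(a_1,a_2,n(a_3,a_4,a_5))=0$. *)

(* Defs.v *)
From HB Require Import structures.
Set Warnings "-notation-overridden,-notation-incompatible-prefix,-ambiguous-paths".
From mathcomp Require Import all_boot all_order all_algebra.
From mathcomp Require Import finmap.
From mathcomp Require Import boolp classical_sets functions cardinality fsbigop.
From mathcomp Require Import reals.
From mathcomp Require Import complex.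

Set Warnings "-redundant-canonical-projection,-projection-no-head-constant".
Set Implicit Arguments.
Unset Strict Implicit.
Unset Printing Implicit Defensive.
Import Order.TTheory GRing.Theory Num.Theory.
Local Open Scope classical_set_scope.
Local Open Scope ring_scope.

Section FiniteSupport.
Variables (K : fieldType) (I : Type) (M : lmodType K).

Definition fin_supported : {pred (I -> M)} :=
  fun f => `[< finite_set [set i | f i <> 0] >].

Lemma fin_supportedP (f : I -> M) :
  reflect (finite_set [set i | f i <> 0]) (f \in fin_supported).
Proof. exact: asboolP. Qed.

Lemma fin_supported_submod : submod_closed fin_supported.
Proof.
split.
  by apply/fin_supportedP; apply: (sub_finite_set _ (@finite_set0 I)) => i /=.
move=> a f g /fin_supportedP ff /fin_supportedP fg; apply/fin_supportedP.
apply: (sub_finite_set _ (_ : finite_set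
  ([set i | f i <> 0] `|` [set i | g i <> 0]))); last by rewrite finite_setU.
move=> i /= H.
have [f0|/eqP fn0] := eqVneq (f i) 0; last by left.
by right => g0; apply: H; rewrite /GRing.add /GRing.scale /= f0 g0 scaler0 addr0.
Qed.

HB.instance Definition _ :=
  GRing.isSubmodClosed.Build K (I -> M) fin_supported fin_supported_submod.

(* [dsum I M] is the direct sum of copies of M indexed by I *)
Record dsum := DSum { dsum_val :> I -> M; _ : dsum_val \in fin_supported }.

HB.instance Definition _ := [isSub for dsum_val].
HB.instance Definition _ := [Choice of dsum by <:].
HB.instance Definition _ := [SubChoice_isSubLmodule of dsum by <:].

(* the value is 0 when f has infinite support *)
Definition mkdsum (f : I -> M) : dsum := insubd (0 : dsum) f.

Lemma mkdsumE (f : I -> M) :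
  finite_set [set i | f i <> 0] -> mkdsum f = f :> (I -> M).
Proof. by move=> /fin_supportedP ff; rewrite -[LHS]/(val _) val_insubd ff. Qed.

Lemma dsum_fin (x : dsum) : finite_set [set i | x i <> 0].
Proof. by apply/fin_supportedP; exact: (valP x). Qed.

Lemma dsumP (x y : dsum) : (forall i, x i = y i) -> x = y.
Proof. by move=> xy; apply/val_inj/funext. Qed.

Lemma dsumD (x y : dsum) i : (x + y) i = x i + y i.
Proof. by []. Qed.

Lemma dsumZ (a : K) (x : dsum) i : (a *: x) i = a *: x i.
Proof. by []. Qed.

Lemma dsum0 i : (0 : dsum) i = 0.
Proof. by []. Qed.

End FiniteSupport.

Section DsumMaps.
Variables (K : fieldType) (I : choiceType) (M : lmodType K).

Definition dsingle (i : I) (m : M) : dsum I M :=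
  mkdsum (fun j => if j == i then m else 0).

Lemma dsingleE i m j : dsingle i m j = if j == i then m else 0.
Proof.
rewrite mkdsumE//; apply: (sub_finite_set _ (finite_set1 i)) => k /=.
by case: eqP.
Qed.

Definition dmap (g : M -> M) (x : dsum I M) : dsum I M :=
  mkdsum (fun i => g (x i)).

Lemma dmapE (g : M -> M) x i : g 0 = 0 -> dmap g x i = g (x i).
Proof.
move=> g0; rewrite mkdsumE//; apply: (sub_finite_set _ (dsum_fin x)) => k /=.
by apply: contra_not => ->.
Qed.

(* Reindexing along an injection r, with scalars s that may vanish *)
Lemma dsum_reindexE (r : I -> I) (s : I -> K) (x : dsum I M) :
  injective r ->
  mkdsum (fun i => s i *: x (r i)) = (fun i => s i *: x (r i)) :> (I -> M).
Proof.
move=> rI; rewrite mkdsumE//.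
apply: (sub_finite_set (B := r @^-1` [set i | x i <> 0])) => [i /=|].
  by apply: contra_not => ->; rewrite scaler0.
by apply: finite_preimage; [move=> ? ? _ _; exact: rI|exact: dsum_fin].
Qed.

End DsumMaps.

(* V[h^-1, h]: the value of f at k is the coefficient of h^k *)
Notation laurent V := (dsum int V).

Section Laurent.
Variables (K : fieldType) (V : lmodType K).

Definition hmono (k : int) (v : V) : laurent V := dsingle k v.

Definition hshift (k : int) (f : laurent V) : laurent V :=
  mkdsum (fun i => 1 *: f (i - k)).

Lemma hshiftE k f i : hshift k f i = f (i - k).
Proof.
by rewrite /hshift (dsum_reindexE (fun=> 1) f (addIr (- k))) scale1r.
Qed.

(* The subspaces V, V[h], h V[h], h V and S[h^-1, h] of V[h^-1, h] *)
Definition constL : set (laurent V) := [set f | forall k, k != 0 -> f k = 0].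
Definition polyL : set (laurent V) := [set f | forall k, k < 0 -> f k = 0].
Definition hpolyL : set (laurent V) := [set f | forall k, k <= 0 -> f k = 0].
Definition hconstL : set (laurent V) := [set f | forall k, k != 1 -> f k = 0].
Definition laurent_in (S : set V) : set (laurent V) := [set f | forall k, S (f k)].

End Laurent.

Section VOA.
Variable K : fieldType.

Definition subspace (U : lmodType K) (S : set U) : Prop :=
  S 0 /\ forall (a : K) x y, S x -> S y -> S (a *: x + y).

Definition is_graded (U : lmodType K) (G : nat -> set U) : Prop :=
  [/\ forall n, subspace (G n),
      forall x, exists N, exists2 f : nat -> U,
        forall n, G n (f n) & x = \sum_(n < N) f n &
      forall N (f : nat -> U), (forall n, G n (f n)) ->
        \sum_(n < N) f n = 0 -> forall n, (n < N)%N -> f n = 0].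

Definition binz (m : int) (j : nat) : K :=
  (\prod_(i < j) (m - i%:Z)%:~R) / (j`!)%:R.

(* The weight spaces need not be finite-dimensional. [vmode A n B] is A_n B
   for A(z) = \sum_n A_n z^(-n-1), and [vborcherds] is the Jacobi identity in
   components; its sums over nat are finite by [vtrunc]. *)
Record voa (U : lmodType K) (wt : nat -> set U) : Type := VOA {
  vmode : U -> int -> U -> U;
  vvac : U;
  vconf : U;
  vcharge : K;
  vgraded : is_graded wt;
  vlinl : forall (a : K) A A' n B,
    vmode (a *: A + A') n B = a *: vmode A n B + vmode A' n B;
  vlinr : forall (a : K) A n B B',
    vmode A n (a *: B + B') = a *: vmode A n B + vmode A n B';
  vtrunc : forall A B, exists N : int, forall n, N <= n -> vmode A n B = 0;
  vvac_wt : wt 0%N vvac;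
  vvacl : forall n B, vmode vvac n B = if n == -1 then B else 0;
  vvacr : forall A n, 0 <= n -> vmode A n vvac = 0;
  vcreate : forall A, vmode A (-1) vvac = A;
  vborcherds : forall A B C (m n k : int),
    \sum_(j \in [set: nat])
      binz m j *: vmode (vmode A (n + j%:Z) B) (m + k - j%:Z) C =
    \sum_(j \in [set: nat]) ((-1) ^+ j * binz n j) *:
      (vmode A (m + n - j%:Z) (vmode B (k + j%:Z) C)
       - (-1) ^ n *: vmode B (n + k - j%:Z) (vmode A (m + j%:Z) C));
  vconf_wt : wt 2%N vconf;
  vvirasoro : forall (m n : int) B,
    vmode vconf (m + 1) (vmode vconf (n + 1) B)
    - vmode vconf (n + 1) (vmode vconf (m + 1) B) =
    (m - n)%:~R *: vmode vconf (m + n + 1) B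
    + (if m + n == 0 then ((m ^+ 3 - m)%:~R / 12%:R * vcharge) *: B else 0);
  vderiv : forall A n B,
    vmode (vmode vconf 0 A) n B = - n%:~R *: vmode A (n - 1) B;
  vweight : forall p A, wt p A -> vmode vconf 1 A = p%:R *: A
}.

Definition virasoro (U : lmodType K) (wt : nat -> set U) (T : voa wt)
  (n : int) : U -> U := vmode T (vconf T) (n + 1).

(* The conditions making a VOA structure on V[h^-1, h], with V^n[h^-1, h] in
   weight n, a VOA with a formal parameter *)
Record formal_parameter (V : lmodType K) (Vgr : nat -> set V)
    (T : voa (fun n => laurent_in (Vgr n))) : Prop := FormalParameter {
  fp_comm : forall A n k B, vmode T A n (hshift k B) = hshift k (vmode T A n B);
  fp_vac : polyL (vvac T);
  fp_closed : forall A n B, polyL A -> polyL B -> polyL (vmode T A n B);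
  fp_small : forall A n B, constL A -> constL B -> 0 <= n ->
    hpolyL (vmode T A n B);
  fp_Lm1 : forall A, constL A -> constL (virasoro T (-1) A);
  fp_L1 : forall v, Vgr 1%N v -> hconstL (virasoro T 1 (hmono 0 v))
}.

End VOA.

(* [fock M] is the tensor product of M with the Fock module Lambda. The basis
   of Lambda is indexed by finite sets D of integers, where j in D stands for
   the creation operator a_j := c_j if j <= 1, a_j := b_(-j) if j >= 2:
   the basis vector e_D is a_(j1) a_(j2) ... 1, with j1 < j2 < ... listing D. *)
Notation fock M := (dsum {fset int} M).

Section Fock.
Variables (K : fieldType) (M : lmodType K).

Definition toggle (m : int) (D : {fset int}) : {fset int} :=
  if m \in D then (D `\ m)%fset else (m |` D)%fset.

Definition below (m : int) (D : {fset int}) : nat :=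
  #|` [fset j in D | (j < m)%R]%fset|.

(* c_m and b_m add or remove the element m, resp. -m, of D *)
Definition gc (m : int) (w : fock M) : fock M :=
  mkdsum (fun D : {fset int} =>
    (if (m \in D) == (m <= 1) then (-1) ^+ below m D else 0)
      *: w (toggle m D)).

Definition gb (m : int) (w : fock M) : fock M :=
  mkdsum (fun D : {fset int} =>
    (if (- m \in D) == (1 < - m) then (-1) ^+ below (- m) D else 0)
      *: w (toggle (- m) D)).

(* A (x) 1 *)
Definition gvac (A : M) : fock M := dsingle fset0 A.

(* The operator (partial^k c)_(-1) = k! c_(1-k); applied to A (x) 1 it gives the
   state written (partial^k c) A *)
Definition dgc (k : nat) (w : fock M) : fock M := (k`!)%:R *: gc (1 - k%:Z) w.

(* [par p w] is the part of w of ghost number = p mod 2 *)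
Definition par (p : bool) (w : fock M) : fock M :=
  mkdsum (fun D : {fset int} =>
    (if odd (#|` D|) == p then 1 else 0 : K) *: w D).

(* a_j 1 = (partial^i a / i!) with i = gord j and a = c or b, whose modes
   a_(n) in the convention a(z) = \sum_n a_(n) z^(-n-1) are c_(n) = c_(n+2) and
   b_(n) = b_(n-1) *)
Definition gord (j : int) : nat := if j <= 1 then `|1 - j|%N else `|j - 2|%N.

Definition gmode (j n : int) : fock M -> fock M :=
  if j <= 1 then gc (n + 2) else gb (n - 1).

(* [gfield s n] is the mode (n) of the field of the state a_(j1) a_(j2) ... 1,
   s = [:: j1; j2; ...], which is the normally ordered product
   :(partial^i1 a/i1!)(z) (partial^i2 a/i2!)(z) ...: *)
Fixpoint gfield (s : seq int) (n : int) (w : fock M) {struct s} : fock M :=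
  if s is j :: s' then
    let i := gord j in
    \sum_(t \in [set: nat]) ('C(i + t, t))%:R *:
      (gmode j (- (i + t).+1%:Z) (gfield s' (n + t%:Z) w)
       + (-1) ^+ (i + size s') *:
           gfield s' (n - (i + t).+1%:Z) (gmode j t%:Z w))
  else if n == -1 then w else 0.

Lemma toggleK m : involutive (toggle m).
Proof.
move=> D; rewrite {2}/toggle; case: ifPn => mD; rewrite /toggle !inE eqxx /=.
  by rewrite fsetD1K.
by rewrite fsetU1K.
Qed.

Lemma gcE m w D : gc m w D =
  (if (m \in D) == (m <= 1) then (-1) ^+ below m D else 0) *: w (toggle m D).
Proof. by rewrite /gc dsum_reindexE//; exact: (inv_inj (@toggleK m)). Qed.

Lemma gbE m w D : gb m w D =
  (if (- m \in D) == (1 < - m) then (-1) ^+ below (- m) D else 0)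
    *: w (toggle (- m) D).
Proof. by rewrite /gb dsum_reindexE//; exact: (inv_inj (@toggleK (- m))). Qed.

Lemma parE p w D : par p w D = if odd #|` D| == p then w D else 0.
Proof.
rewrite /par (@dsum_reindexE _ _ _ id)//.
by case: ifP; rewrite ?scale1r ?scale0r.
Qed.

Lemma gc_vac m A : 2 <= m -> gc m (gvac A) = 0.
Proof.
move=> m2; apply: dsumP => D; rewrite gcE dsingleE /toggle.
have -> : (m <= 1) = false by apply/negbTE; rewrite -ltNge; exact: lt_le_trans m2.
case: ifPn => [mD|mD]; rewrite ?scale0r//.
rewrite eqbF_neg in mD; rewrite (negbTE mD).
by case: eqP => [/fsetP /(_ m)|]; rewrite ?scaler0// !inE eqxx.
Qed.

Lemma gb_vac m A : -1 <= m -> gb m (gvac A) = 0.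
Proof.
move=> m1; apply: dsumP => D; rewrite gbE dsingleE /toggle.
have -> : (1 < - m) = false by apply/negbTE; rewrite -leNgt lerNl.
case: ifPn => [mD|mD]; rewrite ?scale0r//.
rewrite eqbF_neg in mD; rewrite (negbTE mD).
by case: eqP => [/fsetP /(_ (- m))|]; rewrite ?scaler0// !inE eqxx.
Qed.

Lemma below_toggle m p D :
  below m (toggle p D) =
    if p < m then (if p \in D then (below m D).-1 else (below m D).+1)
    else below m D.
Proof.
rewrite /below /toggle; case: ifPn => pD; case: ifPn => pm.
- rewrite [in RHS](cardfsD1 p) !inE/= pD pm add1n /=; congr (#|` _|).
  by apply/fsetP => j; rewrite !inE /=; case: eqP => //= ->.
- congr (#|` _|); apply/fsetP => j; rewrite !inE /=.
  by case: eqP => //= ->; rewrite (negbTE pm) andbF.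
- rewrite [LHS](cardfsD1 p) !inE/= eqxx pm add1n /=; congr (#|` _|.+1).
  by apply/fsetP => j; rewrite !inE /=; case: eqP => //= ->; rewrite (negbTE pD).
- congr (#|` _|); apply/fsetP => j; rewrite !inE /=.
  by case: eqP => //= ->; rewrite (negbTE pm) andbF.
Qed.

Lemma mem_toggle m p D : (m \in toggle p D) = (m \in D) (+) (m == p).
Proof.
rewrite /toggle; case: ifPn => pD; rewrite !inE; case: eqP => [->|_] /=.
- by rewrite pD.
- by rewrite addbF.
- by rewrite (negbTE pD).
- by rewrite addbF.
Qed.

Lemma toggleC m p D : toggle m (toggle p D) = toggle p (toggle m D).
Proof. by apply/fsetP => j; rewrite !mem_toggle -!addbA [X in _ (+) X]addbC. Qed.

Lemma signr_below_toggle m p D :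
  (-1) ^+ below m (toggle p D) =
    (if p < m then - (-1) ^+ below m D else (-1) ^+ below m D) :> K.
Proof.
rewrite below_toggle; case: ifP => // pm; case: ifP => pD; last first.
  by rewrite exprS mulN1r.
have : (0 < below m D)%N.
  by rewrite cardfs_gt0; apply/fset0Pn; exists p; rewrite !inE /= pD.
by case: (below m D) => // n _; rewrite /= exprS mulN1r opprK.
Qed.

Lemma gb_gc n m w :
  gb n (gc m w) + gc m (gb n w) = if n + m == 0 then w else 0.
Proof.
apply: dsumP => D.
rewrite dsumD !gcE !gbE !gcE !mem_toggle !scalerA !signr_below_toggle.
rewrite [toggle m (toggle _ D)]toggleC.
have [nm|nm] := eqVneq (- n) m.
  rewrite -nm addrN !eqxx toggleK ltxx !addbT -scalerDl ltNge.
  by case: (- n \in D); case: (- n <= 1) => /=;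
    rewrite ?mulr0 ?mul0r ?addr0 ?add0r -?expr2 ?sqrr_sign ?scale1r.
have -> : (n + m == 0) = false by rewrite addrC addr_eq0 eq_sym (negbTE nm).
rewrite !addbF -scalerDl dsum0.
set x := (_ + _ : K); suff -> : x = 0 by rewrite scale0r.
rewrite {}/x; case: (_ == (1 < _)); case: (_ == (m <= 1));
  rewrite ?mul0r ?mulr0 ?addr0//.
by case: ltgtP nm => // _ _; rewrite ?mulNr ?mulrN mulrC ?addNr ?subrr.
Qed.

End Fock.

Section Light.
Variables (K : fieldType) (U : lmodType K) (wt : nat -> set U) (T : voa wt).

(* (A (x) e_D)_(n) = \sum_k A_k (x) (e_D)_(n-k-1), extended linearly *)
Definition tmode (x : fock U) (n : int) (y : fock U) : fock U :=
  \sum_(D \in [set: {fset int}]) \sum_(k \in [set: int])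
    dmap (vmode T (x D) k) (gfield (sort <=%R (enum_fset D)) (n - k - 1) y).

(* c L + :c (partial c) b: + 3/2 partial^2 c *)
Definition brst_current : fock U :=
  dgc 0 (gvac (vconf T)) + dgc 0 (dgc 1 (gb (-2) (gvac (vvac T))))
  + (3%:R / 2%:R : K) *: dgc 2 (gvac (vvac T)).

Definition brst (w : fock U) : fock U := tmode brst_current 0 w.

Definition lz_mu (a1 a2 : fock U) : fock U := tmode a1 (-1) a2.

(* Res_w w^i and Res_z z^(-i-1) extract the modes (i) and (-i-1) *)
Definition lz_n1 (a1 a2 a3 : fock U) : fock U :=
  \sum_(i \in [set: nat]) (i.+1%:R)^-1 *:
    tmode (gb (-1) a1) (- i.+1%:Z) (tmode a2 i%:Z a3).

(* The sum over p, q extends the sign (-1)^(|a1||a2|) bilinearly to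
   inhomogeneous a1, a2 *)
Definition lz_n (a1 a2 a3 : fock U) : fock U :=
  lz_n1 a1 a2 a3
  + \sum_(p : bool) \sum_(q : bool)
      (-1) ^+ (p && q) *: lz_n1 (par q a2) (par p a1) a3.

End Light.

Section LightModes.
Variables (K : fieldType) (V : lmodType K) (Vgr : nat -> set V).
Notation W := (fock (laurent V)).

Definition hact (k : int) (w : W) : W := dmap (hshift k) w.

(* h^k v (x) 1 *)
Definition hst (k : int) (v : V) : W := gvac (hmono k v).

Definition light (i : int) : set W :=
  match i with
  | Posz 0 => [set x | exists2 u, Vgr 0%N u & x = hst 0 u]
  | Posz 1 => [set x | exists A u, [/\ Vgr 1%N A, Vgr 0%N u &
      x = dgc 0 (hst 0 A) + dgc 1 (hst 1 u)]]
  | Posz 2 => [set x | exists A u, [/\ Vgr 1%N A, Vgr 0%N u &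
      x = dgc 0 (dgc 1 (hst 1 A)) + dgc 0 (dgc 2 (hst 1 u))]]
  | Posz 3 => [set x | exists2 u, Vgr 0%N u &
      x = dgc 0 (dgc 1 (dgc 2 (hst 2 u)))]
  | _ => [set 0]
  end.

Definition light_total : set W :=
  [set x | exists2 f : nat -> W, forall i : nat, light i (f i) &
                                 x = \sum_(i < 4) f i].

(* x is the element f_0 + h f_1 + h^2 f_2 + ... of S[h], and y = f_0 *)
Definition leading (S : set W) (x y : W) : Prop :=
  S y /\ exists N, exists2 f : nat -> W, forall j, S (f j) &
    x = y + \sum_(j < N) hact j.+1%:Z (f j).

(* 0 if x is not in light_total[h] *)
Definition lead (x : W) : W := xget 0 [set y | leading light_total x y].

Variable T : voa (fun n => laurent_in (Vgr n)).

Definition lz_mu0 (a1 a2 : W) : W := lead (lz_mu T a1 a2).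
Definition lz_n0 (a1 a2 a3 : W) : W := lead (lz_n T a1 a2 a3).

End LightModes.

Section A3.
Variables (K : fieldType) (W : lmodType K) (F : int -> set W).

Record A3_algebra (Q : W -> W) (mu : W -> W -> W) (n : W -> W -> W -> W) : Prop
  := A3Algebra {
  a3_sub : forall i, subspace (F i);
  a3_Qdeg : forall i x, F i x -> F (i + 1) (Q x);
  a3_mudeg : forall i j x y, F i x -> F j y -> F (i + j) (mu x y);
  a3_ndeg : forall i j k x y z, F i x -> F j y -> F k z ->
    F (i + j + k - 1) (n x y z);
  a3_Qlin : forall i (a : K) x x', F i x -> F i x' ->
    Q (a *: x + x') = a *: Q x + Q x';
  a3_mulinl : forall i j (a : K) x x' y, F i x -> F i x' -> F j y ->
    mu (a *: x + x') y = a *: mu x y + mu x' y;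
  a3_mulinr : forall i j (a : K) x y y', F i x -> F j y -> F j y' ->
    mu x (a *: y + y') = a *: mu x y + mu x y';
  a3_nlin1 : forall i j k (a : K) x x' y z, F i x -> F i x' -> F j y -> F k z ->
    n (a *: x + x') y z = a *: n x y z + n x' y z;
  a3_nlin2 : forall i j k (a : K) x y y' z, F i x -> F j y -> F j y' -> F k z ->
    n x (a *: y + y') z = a *: n x y z + n x y' z;
  a3_nlin3 : forall i j k (a : K) x y z z', F i x -> F j y -> F k z -> F k z' ->
    n x y (a *: z + z') = a *: n x y z + n x y z';
  a3_rel1 : forall i1 a1, F i1 a1 -> Q (Q a1) = 0;
  a3_rel2 : forall i1 i2 a1 a2, F i1 a1 -> F i2 a2 ->
    Q (mu a1 a2) = mu (Q a1) a2 + (-1) ^ i1 *: mu a1 (Q a2);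
  a3_rel3 : forall i1 i2 i3 a1 a2 a3, F i1 a1 -> F i2 a2 -> F i3 a3 ->
    Q (n a1 a2 a3) + n (Q a1) a2 a3 + (-1) ^ i1 *: n a1 (Q a2) a3
      + (-1) ^ (i1 + i2) *: n a1 a2 (Q a3) =
    mu (mu a1 a2) a3 - mu a1 (mu a2 a3);
  a3_rel4 : forall i1 i2 i3 i4 a1 a2 a3 a4,
    F i1 a1 -> F i2 a2 -> F i3 a3 -> F i4 a4 ->
    (-1) ^ i1 *: mu a1 (n a2 a3 a4) + mu (n a1 a2 a3) a4 =
    n (mu a1 a2) a3 a4 - n a1 (mu a2 a3) a4 + n a1 a2 (mu a3 a4);
  a3_rel5 : forall i1 i2 i3 i4 i5 a1 a2 a3 a4 a5,
    F i1 a1 -> F i2 a2 -> F i3 a3 -> F i4 a4 -> F i5 a5 ->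
    n (n a1 a2 a3) a4 a5 + (-1) ^ i1 *: n a1 (n a2 a3 a4) a5
      + (-1) ^ (i1 + i2) *: n a1 a2 (n a3 a4 a5) = 0
}.

End A3.

(* Main.v *)
(* On states of weight 0 the ghosts only enter through c_1, c_0 and c_(-1), so
   such a state is a sextuple of elements of V^0[h^-1, h] and V^1[h^-1, h], and
   Q, mu, n become explicit combinations of the modes A_(-1) B, A_0 B, A_1 B and
   of L_(-1), L_1.  The modes A_n with n >= 0 and L_1 are divisible by h; keeping
   the leading coefficient of each, the Borcherds identities lose their terms of
   higher order in h, and V^0, V^1 become a Courant algebroid with a divergence
   operator.  In the complex, a ghost word with d factors c_0, c_(-1) carries h^d,
   which is the power that makes every term of Q, mu_0 and n_0 a leading
   coefficient.  The A_(3) relations then follow from the Courant axioms; the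
   quintic one is trivial, as n_0 vanishes when an argument is a value of n_0. *)

Require Import Defs.
From HB Require Import structures.
From mathcomp Require Import all_boot all_order all_algebra.
From mathcomp Require Import finmap zify ring.
From mathcomp Require Import boolp classical_sets functions cardinality fsbigop.
From mathcomp Require Import reals complex.
Set Implicit Arguments.
Unset Strict Implicit.
Unset Printing Implicit Defensive.
Import Order.TTheory GRing.Theory Num.Theory.
Local Open Scope classical_set_scope.
Local Open Scope ring_scope.


(** The leading coefficient of $A_nB$ depends only on those of $A$ and $B$, so it can be computed
    through composites: an identity between symbols is obtained from an exact Borcherds identity by
    finding, with [leads], the order and the leading coefficient of both sides. This requires the
    modes to be $h$-linear in the left argument too, while the hypothesis concerns the right one;
    skew-symmetry carries it over.

    The other obstacle is that [lead] is a choice, so that uniqueness has to be shown: in $\mathcal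
    F$ the ghost word determines the power of $h$, and the part of an element of $\mathcal F[h]$
    that lies in $\mathcal F$ can be read off word by word.

    The formulas for $Q$, $\mu$, $n$ are therefore exact, over $V[h^{-1},h]$, before any power of
    $h$ is dropped; conformal weight makes them finite. The operator $Q$ needs no truncation,
    because $L_{-1}$ keeps the power of $h$ and $L_1$ raises it by exactly one on $V^1$. *)

Inductive zterm :=
  | ZAtom of nat | Z0 | ZAdd of zterm & zterm | ZOpp of zterm
  | ZMuln of zterm & nat.

Fixpoint zcoef (e : zterm) (i : nat) : int :=
  match e with
  | ZAtom j => (i == j)%:Z
  | Z0 => 0
  | ZAdd e1 e2 => zcoef e1 i + zcoef e2 i
  | ZOpp e1 => - zcoef e1 i
  | ZMuln e1 n => zcoef e1 i * n%:Z
  end.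

Fixpoint zeval (M : zmodType) (s : seq M) (e : zterm) : M :=
  match e with
  | ZAtom j => s`_j
  | Z0 => 0
  | ZAdd e1 e2 => zeval s e1 + zeval s e2
  | ZOpp e1 => - zeval s e1
  | ZMuln e1 n => zeval s e1 *+ n
  end.

(** Normal form of a term: in an abelian group it is a combination of the atoms with integer
    coefficients, so an equation reduces to comparing integers. *)
Lemma zevalE (M : zmodType) (s : seq M) e :
  zeval s e = \sum_(i < size s) s`_i *~ zcoef e i.
Proof.
elim: e => [j||e1 h1 e2 h2|e1 h1|e1 h1 n] /=.
- have [js|js] := ltnP j (size s).
    rewrite (bigD1 (Ordinal js)) //= eqxx mulr1z big1 ?addr0 // => i ij.
    suff -> : (val i == j) = false by rewrite mulr0z.
    by apply/negbTE; apply: contraNneq ij => ij; apply/eqP/val_inj.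
  rewrite nth_default // big1 // => i _.
  by rewrite (ltn_eqF (leq_trans (ltn_ord i) js)) mulr0z.
- by rewrite big1 // => i _; rewrite mulr0z.
- by rewrite h1 h2 -big_split /=; apply: eq_bigr => i _; rewrite mulrzDr.
- by rewrite h1 -sumrN; apply: eq_bigr => i _; rewrite mulrNz.
- by rewrite h1 -sumrMnl; apply: eq_bigr => i _; rewrite mulrzA.
Qed.

Lemma zeval_eq (M : zmodType) (s : seq M) e1 e2 :
  all (fun i => zcoef e1 i == zcoef e2 i) (iota 0 (size s)) ->
  zeval s e1 = zeval s e2.
Proof.
move=> /allP h; rewrite !zevalE; apply: eq_bigr => i _.
by rewrite (eqP (h i _)) // mem_iota ltn_ord.
Qed.

(* [zmodule] decides equations between integral linear combinations in a
   zmodType. Atoms are compared up to unification, since the same structure may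
   be reached along several canonical paths. *)
Ltac zmem x s :=
  lazymatch s with
  | nil => constr:(false)
  | ?y :: ?s' => match constr:(Set) with
                 | _ => let _ := match constr:(Set) with _ => unify x y end in
                        constr:(true)
                 | _ => zmem x s'
                 end
  end.
Ltac zindex x s :=
  lazymatch s with
  | ?y :: ?s' => match constr:(Set) with
                 | _ => let _ := match constr:(Set) with _ => unify x y end in
                        constr:(O)
                 | _ => let n := zindex x s' in constr:(S n)
                 end
  end.
Ltac zatoms t s :=
  lazymatch t with
  | 0%R => s
  | GRing.add ?a ?b => let s1 := zatoms a s in zatoms b s1
  | GRing.opp ?a => zatoms a s
  | GRing.natmul ?a _ => zatoms a s
  | _ => lazymatch zmem t s with
         | true => s
         | false => constr:(t :: s)
         end
  end.
Ltac zreify t s :=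
  lazymatch t with
  | 0%R => constr:(Z0)
  | GRing.add ?a ?b =>
    let a' := zreify a s in let b' := zreify b s in constr:(ZAdd a' b')
  | GRing.opp ?a => let a' := zreify a s in constr:(ZOpp a')
  | GRing.natmul ?a ?n => let a' := zreify a s in constr:(ZMuln a' n)
  | _ => let n := zindex t s in constr:(ZAtom n)
  end.

Ltac zmodule :=
  lazymatch goal with
  | |- @eq ?M ?l ?r =>
    let s := zatoms l (@nil M) in
    let s := zatoms r s in
    let el := zreify l s in
    let er := zreify r s in
    refine (@zeval_eq _ s el er _); vm_compute; reflexivity
  end.

(** * Finitely supported sums and direct sums *)

Section FiniteSums.
Variables (T : choiceType) (M : nmodType).

Lemma fsum_seq (r : seq T) (f : T -> M) :
  uniq r -> (forall i, i \notin r -> f i = 0) ->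
  \sum_(i \in [set: T]) f i = \sum_(i <- r) f i.
Proof.
move=> ur h; rewrite (fsbigE r) //; last by move=> i _; exact: h.
by apply: eq_bigl => i; rewrite in_setT.
Qed.

End FiniteSums.

Lemma fsum_nat (M : nmodType) N (f : nat -> M) :
  (forall j, (N <= j)%N -> f j = 0) ->
  \sum_(j \in [set: nat]) f j = \sum_(j < N) f j.
Proof.
move=> h; rewrite (@fsum_seq _ _ (iota 0 N)) ?iota_uniq //.
  by rewrite -(big_mkord xpredT) /index_iota subn0.
by move=> i; rewrite mem_iota add0n -leqNgt; exact: h.
Qed.

(** The maximum makes the range empty when [b] is below [a], where the absolute value of [b - a]
    would be wrong. *)
Lemma fsum_int (M : nmodType) (a b : int) (f : int -> M) :
  (forall k, ~~ (a <= k < b) -> f k = 0) ->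
  \sum_(k \in [set: int]) f k = \sum_(i < `|Num.max a b - a|) f (a + i%:Z).
Proof.
move=> h; rewrite (@fsum_seq _ _ [seq a + i%:Z | i <- iota 0 `|Num.max a b - a|]).
- by rewrite big_map -[RHS](big_mkord xpredT (fun i => f (a + i%:Z))) /index_iota subn0.
- by rewrite map_inj_uniq ?iota_uniq // => i j /addrI [].
move=> k /mapP nk; apply: h; apply/negP => /andP[ak kb]; apply: nk.
exists `|k - a|%N; last by lia.
rewrite mem_iota; lia.
Qed.

Lemma big_ord2 (M : nmodType) (F : nat -> M) :
  \sum_(i < 2) F i = F 0%N + F 1%N.
Proof. by rewrite !big_ord_recl big_ord0 addr0 ?addrA. Qed.

Lemma big_ord3 (M : nmodType) (F : nat -> M) :
  \sum_(i < 3) F i = F 0%N + F 1%N + F 2%N.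
Proof. by rewrite !big_ord_recl big_ord0 addr0 ?addrA. Qed.

Section DirectSums.
Variables (K : fieldType) (I : Type) (M : lmodType K).

Lemma dsumN (x : dsum I M) i : (- x) i = - x i.
Proof. by []. Qed.

Lemma dsum_sum J (r : seq J) (P : pred J) (F : J -> dsum I M) i :
  (\sum_(j <- r | P j) F j) i = \sum_(j <- r | P j) F j i.
Proof. exact: (big_morph (fun x : dsum I M => x i)). Qed.

End DirectSums.

Section Subspaces.
Variables (K : fieldType) (U : lmodType K) (S : set U).
Hypothesis subS : subspace S.

Lemma subspace0 : S 0. Proof. by case: subS. Qed.

Lemma subspaceZ a x : S x -> S (a *: x).
Proof. by case: subS => S0 h Sx; rewrite -[_ *: _]addr0; exact: h. Qed.

Lemma subspaceD x y : S x -> S y -> S (x + y).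
Proof. by case: subS => S0 h Sx Sy; rewrite -[x]scale1r; exact: h. Qed.

Lemma subspaceN x : S x -> S (- x).
Proof. by rewrite -scaleN1r; exact: subspaceZ. Qed.

End Subspaces.

(** * Vertex algebras in weights 0 and 1 *)

Section VertexAlgebra.
Variables (K : numFieldType) (U : lmodType K) (wt : nat -> set U) (T : voa wt).
Implicit Types A B C : U.

Local Notation vm := (vmode T).
Local Notation vac := (vvac T).
Local Notation om := (vconf T).

Lemma vmodeDl A A' n B : vm (A + A') n B = vm A n B + vm A' n B.
Proof. by have := vlinl T 1 A A' n B; rewrite !scale1r. Qed.

Lemma vmode0l n B : vm 0 n B = 0.
Proof. by apply: (addrI (vm 0 n B)); rewrite -vmodeDl !addr0. Qed.

Lemma vmodeZl a A n B : vm (a *: A) n B = a *: vm A n B.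
Proof. by have := vlinl T a A 0 n B; rewrite vmode0l !addr0. Qed.

Lemma vmodeNl A n B : vm (- A) n B = - vm A n B.
Proof. by rewrite -scaleN1r vmodeZl scaleN1r. Qed.

Lemma vmodeDr A n B B' : vm A n (B + B') = vm A n B + vm A n B'.
Proof. by have := vlinr T 1 A n B B'; rewrite !scale1r. Qed.

Lemma vmode0r A n : vm A n 0 = 0.
Proof. by apply: (addrI (vm A n 0)); rewrite -vmodeDr !addr0. Qed.

Lemma vmodeZr a A n B : vm A n (a *: B) = a *: vm A n B.
Proof. by have := vlinr T a A n B 0; rewrite vmode0r !addr0. Qed.

Lemma vmodeNr A n B : vm A n (- B) = - vm A n B.
Proof. by rewrite -scaleN1r vmodeZr scaleN1r. Qed.

Lemma vmode_sumr I (r : seq I) (P : pred I) F A n :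
  vm A n (\sum_(i <- r | P i) F i) = \sum_(i <- r | P i) vm A n (F i).
Proof. by apply: (big_morph _ (vmodeDr A n)); exact: vmode0r. Qed.

Lemma binz0 m : binz K m 0 = 1.
Proof. by rewrite /binz big_ord0 divr1. Qed.

Lemma binz1 m : binz K m 1 = m%:~R.
Proof. by rewrite /binz big_ord1 subr0 divr1. Qed.

Lemma binz0S j : binz K 0 j.+1 = 0.
Proof. by rewrite /binz big_ord_recl subrr !mul0r. Qed.

Lemma binz1SS j : binz K 1 j.+2 = 0.
Proof. by rewrite /binz !big_ord_recl /= subrr !(mul0r, mulr0). Qed.

Lemma binz22 : binz K 2 2 = 1.
Proof.
rewrite /binz !big_ord_recl big_ord0 /= subr0 mulr1 mulrC.
by rewrite mulrA mulVf ?mul1r // pnatr_eq0.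
Qed.

Lemma binz2SSS j : binz K 2 j.+3 = 0.
Proof. by rewrite /binz !big_ord_recl /= subrr !(mul0r, mulr0). Qed.

Lemma binzN1 j : binz K (-1) j = (-1) ^+ j.
Proof.
rewrite /binz; elim: j => [|j ih]; first by rewrite big_ord0 divr1.
rewrite big_ord_recr /= factS mulnC natrM invfM mulrACA ih exprSr; congr (_ * _).
have -> : -1 - j%:Z = - j.+1%:Z :> int by lia.
rewrite intrN mulNr -pmulrn divff //.
by rewrite pnatr_eq0.
Qed.

(** The Borcherds identity at [n = 0]: the binomials on the right leave only the term [j = 0], which
    is the commutator. The bound [N] is left free so that weights or truncation can supply it. *)
Lemma vcommutator N A B C m k :
  (forall j, (N <= j)%N -> vm A j%:Z B = 0) ->
  vm A m (vm B k C) - vm B k (vm A m C) =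
  \sum_(j < N) binz K m j *: vm (vm A j%:Z B) (m + k - j%:Z) C.
Proof.
move=> h; have := vborcherds T A B C m 0 k.
rewrite [RHS](@fsum_nat _ 1) => [|[|j] // _]; last first.
  by rewrite binz0S mulr0 scale0r.
rewrite big_ord1 binz0 mulr1 expr0z !scale1r.
rewrite /= ?(subr0, addr0, add0r) => <-.
rewrite (@fsum_nat _ N) => [|j jN]; first by apply: eq_bigr => j _; rewrite add0r.
by rewrite add0r h // vmode0l scaler0.
Qed.

Lemma vassociativity A B C n k :
  vm (vm A n B) k C = \sum_(j \in [set: nat]) ((-1) ^+ j * binz K n j) *:
    (vm A (n - j%:Z) (vm B (k + j%:Z) C)
     - (-1) ^ n *: vm B (n + k - j%:Z) (vm A j%:Z C)).
Proof.
have := vborcherds T A B C 0 n k.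
rewrite [LHS](@fsum_nat _ 1) => [|[|j] // _]; last by rewrite binz0S scale0r.
rewrite big_ord1 binz0 scale1r /= ?(subr0, addr0, add0r) => ->.
by apply: eq_fsbigr => j _; rewrite !add0r.
Qed.

(** The last two terms measure the failure of associativity of the normally ordered product. Each
    contains a mode of index 0, hence is of higher order once $h$ is present. *)
Lemma vassociativityN1 A B C : (forall n, 0 < n -> vm A n C = 0) ->
  (forall n, 0 < n -> vm B n C = 0) ->
  vm (vm A (-1) B) (-1) C =
  vm A (-1) (vm B (-1) C) + vm B (-2) (vm A 0 C) + vm A (-2) (vm B 0 C).
Proof.
move=> AC BC; rewrite vassociativity (@fsum_nat _ 2) => [|[|[|j]] // _].
  rewrite !big_ord_recl big_ord0 addr0 binz0 binz1 expr0 mul1r scale1r.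
  rewrite [vm A (lift _ _)%:Z C]AC // vmode0r scaler0 subr0 expN1r scaleN1r opprK.
  rewrite expr1 intrN mulrNN !mulr1 scale1r [X in _ + X]addr0 [X in _ + X]subr0.
  reflexivity.
have -> : -1 + j.+2%:Z = j.+1%:Z by lia.
by rewrite AC // BC // !vmode0r scaler0 subr0 scaler0.
Qed.

Lemma vskew A B n :
  vm A n B + (-1) ^ n *: vm B n A =
  \sum_(j \in [set: nat]) (-1) ^+ j *: vm (vm A (n + 1 + j%:Z) B) (- 2 - j%:Z) vac.
Proof.
(* With the vacuum as third state and [m = k = -1], the inner modes on the right have index [j - 1]
   and kill the vacuum for [j > 0]; the term [j = 0] gives $A_nB$ and $B_nA$ by [vcreate]. *)
have := vborcherds T A B vac (-1) (n + 1) (-1).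
rewrite [RHS](@fsum_nat _ 1) => [|[|j] // _]; last first.
  have -> : -1 + j.+1%:Z = j by lia.
  by rewrite !vvacr // !vmode0r scaler0 subr0 scaler0.
rewrite big_ord1 binz0 mulr1 expr0 scale1r /= ?(subr0, addr0) !vcreate.
have -> : -1 + (n + 1) = n by lia.
have -> : n + 1 - 1 = n by lia.
rewrite expfzDr ?oppr_eq0 ?oner_eq0 // expr1z mulrN1 scaleNr opprK => <-.
apply: eq_fsbigr => j _; rewrite binzN1.
by have -> : -1 - 1 - j%:Z = - 2 - j%:Z by lia.
Qed.

Local Notation Lm1 := (virasoro T (-1)).
Local Notation L0 := (virasoro T 0).
Local Notation L1 := (virasoro T 1).

Lemma vmode_Lm1 A n B : vm (Lm1 A) n B = (- n)%:~R *: vm A (n - 1) B.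
Proof. by rewrite /virasoro addNr vderiv intrN scaleNr. Qed.

Lemma vmode_m2_vac A : vm A (-2) vac = Lm1 A.
Proof. by rewrite -[RHS](vcreate T) vmode_Lm1 scale1r. Qed.

Lemma L0_wt p A : wt p A -> L0 A = p%:R *: A.
Proof. by move=> h; rewrite /virasoro add0r (vweight T h). Qed.

Lemma subspace_wt p : subspace (wt p).
Proof. by case: (vgraded T). Qed.

(** Converse of [vweight]. The operator $L_0-p$ multiplies the component of weight $n$ by $n-p$,
    which is nonzero for $n\ne p$ in characteristic 0; as the grading is direct, all other
    components vanish. No nonzero state has a negative eigenvalue. *)
Lemma L0_eigen (p : int) A : L0 A = p%:~R *: A ->
  if p is Posz q then wt q A else A = 0.
Proof.
move=> h; case: (vgraded T) => _ dec uniq.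
have [N [f ff defA]] := dec A.
have z n : (n < N)%N -> n%:Z != p -> f n = 0.
  move=> nN np.
  have : \sum_(n < N) (n%:R - p%:~R : K) *: f n = 0.
    under eq_bigr do rewrite scalerBl -(L0_wt (ff _)).
    by rewrite sumrB -scaler_sumr -defA -h defA /virasoro vmode_sumr subrr.
  move=> /(uniq N (fun n => (n%:R - p%:~R) *: f n)) hh.
  have /eqP := hh (fun n => subspaceZ (subspace_wt n) _ (ff n)) n nN.
  rewrite scaler_eq0 subr_eq0 => /orP[|/eqP //].
  by rewrite pmulrn eqr_int (negbTE np).
case: p h z => [q|q] h z; last first.
  by rewrite defA big1 // => i _; rewrite z.
have [qN|qN] := ltnP q N.
  rewrite defA (bigD1 (Ordinal qN)) //= big1 ?addr0 // => i iq.
  by rewrite z //; apply: contra iq => /eqP[/eqP].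
rewrite defA big1; first exact: subspace0 (subspace_wt q).
move=> i _; rewrite z //.
by apply/eqP => -[iq]; move: (ltn_ord i); rewrite iq ltnNge qN.
Qed.

Lemma conf_commutator A B m n : 
  vm om m (vm A n B) - vm A n (vm om m B) =
  \sum_(j \in [set: nat]) binz K m j *: vm (vm om j%:Z A) (m + n - j%:Z) B.
Proof.
have [[N|N] h] := vtrunc T om A.
  rewrite (@vcommutator N) => [|j jN]; last by apply: h; lia.
  by rewrite (@fsum_nat _ N) // => j jN; rewrite h ?vmode0l ?scaler0.
rewrite (@vcommutator 0) => [|j jN]; last by apply: h; lia.
by rewrite (@fsum_nat _ 0) // => j jN; rewrite h ?vmode0l ?scaler0.
Qed.

(** Since $[L_0,A_n]=(L_{-1}A)_{n+1}+(L_0A)_n$ and $(L_{-1}A)_{n+1}=-(n+1)A_n$, the state $A_nB$ is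
    an eigenvector of $L_0$ with eigenvalue $p+q-n-1$, and [L0_eigen] locates it. *)
Lemma vmode_wt p q A B n : wt p A -> wt q B ->
  if p%:Z + q%:Z - n - 1 is Posz r then wt r (vm A n B) else vm A n B = 0.
Proof.
move=> wA wB; apply: L0_eigen.
have := conf_commutator A B 1 n.
rewrite (@fsum_nat _ 2) => [|[|[|j]] // _]; last by rewrite binz1SS scale0r.
rewrite !big_ord_recl big_ord0 addr0 /= binz0 binz1 !scale1r.
have /= := L0_wt wA; have /= := L0_wt wB; rewrite /virasoro add0r => -> ->.
rewrite vmodeZl vmodeZr addr0 -[bump 0 0]/1%N.
have /= := vmode_Lm1 A (1 + n) B; rewrite /virasoro addNr => ->.
have -> : 1 + n - 1 = n by lia.
move=> /eqP; rewrite subr_eq => /eqP ->; rewrite -!scalerDl; congr (_ *: _).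
by rewrite !intrD !intrN /= -!pmulrn intrD; ring.
Qed.

Lemma vmode_wt_lt p q A B n : wt p A -> wt q B -> p%:Z + q%:Z <= n ->
  vm A n B = 0.
Proof.
move=> wA wB h; have := vmode_wt n wA wB.
by case E: (p%:Z + q%:Z - n - 1) => [r|//]; lia.
Qed.

Lemma vmode_wt_eq r p q A B n : wt p A -> wt q B ->
  p%:Z + q%:Z - n - 1 = r%:Z -> wt r (vm A n B).
Proof. by move=> wA wB h; have := vmode_wt n wA wB; rewrite h. Qed.

Lemma vskew1 A B n : (forall j : nat, (0 < j)%N -> vm A (n + 1 + j%:Z) B = 0) ->
  vm A n B + (-1) ^ n *: vm B n A = Lm1 (vm A (n + 1) B).
Proof.
move=> h; rewrite vskew (@fsum_nat _ 1) => [|j j0]; last first.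
  by rewrite h // vmode0l scaler0.
by rewrite big_ord1 expr0 scale1r /= addr0 vmode_m2_vac.
Qed.

Section LowWeight.
Variables u v A B C : U.
Hypotheses (wu : wt 0 u) (wv : wt 0 v) (wA : wt 1 A) (wB : wt 1 B).

Lemma mode00_ge0 n : 0 <= n -> vm u n v = 0.
Proof. by move=> h; apply: (vmode_wt_lt wu wv); lia. Qed.

Lemma mode01_gt0 n : 0 < n -> vm u n A = 0.
Proof. by move=> h; apply: (vmode_wt_lt wu wA); lia. Qed.

Lemma mode10_gt0 n : 0 < n -> vm A n u = 0.
Proof. by move=> h; apply: (vmode_wt_lt wA wu); lia. Qed.

Lemma mode11_gt1 n : 1 < n -> vm A n B = 0.
Proof. by move=> h; apply: (vmode_wt_lt wA wB); lia. Qed.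

Lemma wt_Lm1 : wt 1 (Lm1 u).
Proof. by rewrite -vmode_m2_vac; apply: (vmode_wt_eq wu (vvac_wt T)). Qed.

Lemma wt_L1 : wt 0 (L1 A).
Proof. by apply: (vmode_wt_eq (vconf_wt T) wA). Qed.

Lemma mode00_comm : vm u (-1) v = vm v (-1) u.
Proof.
apply/eqP; rewrite -subr_eq0; apply/eqP.
have := @vskew1 u v (-1); rewrite expN1r scaleN1r => -> => [|j j0].
  by rewrite addNr mode00_ge0 // /virasoro vmode0r.
by rewrite mode00_ge0.
Qed.

Lemma mode10_skew : vm A (-1) u = vm u (-1) A + Lm1 (vm A 0 u).
Proof.
apply/eqP; rewrite addrC -subr_eq; apply/eqP.
have := @vskew1 A u (-1); rewrite expN1r scaleN1r => -> // j j0.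
by rewrite mode10_gt0.
Qed.

Lemma mode01_skew0 : vm u 0 A = - vm A 0 u.
Proof.
apply/eqP; rewrite -addr_eq0 addrC; apply/eqP.
have := @vskew1 A u 0; rewrite expr0z scale1r => -> => [|j j0].
  by rewrite mode10_gt0 // /virasoro vmode0r.
by rewrite mode10_gt0.
Qed.

Lemma mode11_skew0 : vm A 0 B + vm B 0 A = Lm1 (vm A 1 B).
Proof.
have := @vskew1 A B 0; rewrite expr0z scale1r => -> // j j0.
by rewrite mode11_gt1 //; lia.
Qed.

Lemma mode11_comm1 : vm A 1 B = vm B 1 A.
Proof.
apply/eqP; rewrite -subr_eq0; apply/eqP.
have := @vskew1 A B 1; rewrite expr1z scaleN1r => -> => [|j j0].
  by rewrite mode11_gt1 // /virasoro vmode0r.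
by rewrite mode11_gt1 //; lia.
Qed.

Lemma Lm1_mode0 x : vm (Lm1 u) 0 x = 0.
Proof. by rewrite vmode_Lm1 oppr0 scale0r. Qed.

Lemma Lm1_mode1 : vm (Lm1 u) 1 A = vm A 0 u.
Proof. by rewrite vmode_Lm1 scaleN1r subrr mode01_skew0 opprK. Qed.

(** From $[L_{-1},A_1]=-A_0$, as $A_1u=0$ by weight. *)
Lemma Lm1_mode1r : vm A 1 (Lm1 u) = vm A 0 u.
Proof.
have := conf_commutator A u 0 1; rewrite (@fsum_nat _ 1) => [|[|j] // _].
  rewrite big_ord1 binz0 scale1r /= => /eqP; rewrite (mode10_gt0 (n := 1)) //.
  rewrite vmode0r add0r eqr_oppLR => /eqP.
  have /= := vmode_Lm1 A 1 u; rewrite /virasoro addNr.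
  by rewrite addr0 => -> ->; rewrite scaleN1r opprK subrr.
by rewrite binz0S scale0r.
Qed.

End LowWeight.

Lemma Lm1_vmode A n B : Lm1 (vm A n B) = vm (Lm1 A) n B + vm A n (Lm1 B).
Proof.
apply/eqP; rewrite -subr_eq; apply/eqP.
have := conf_commutator A B 0 n; rewrite (@fsum_nat _ 1) => [|[|j] // _].
  by rewrite big_ord1 binz0 scale1r /= ?subr0 add0r /virasoro addNr => <-.
by rewrite binz0S scale0r.
Qed.

(** Commutator with mode 2 of the conformal vector; the multiplicities 1, 2, 1 are the binomials of
    2. *)
Lemma L1_vmode A n B :
  L1 (vm A n B) = vm A n (L1 B) + vm (Lm1 A) (n + 2) B
    + vm (L0 A) (n + 1) B *+ 2 + vm (L1 A) n B.
Proof.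
have := conf_commutator A B 2 n; rewrite (@fsum_nat _ 3) => [|[|[|[|j]]] // _].
  rewrite !big_ord_recl big_ord0 binz0 binz1 binz22 !scale1r !lift0 /=.
  rewrite /virasoro addNr add0r -[Posz 0]/(0 : int) -[Posz 1]/(1 : int).
  rewrite -[Posz 2]/(2 : int) -[1 + 1]/(2 : int).
  have -> : 2 + n - 0 = n + 2 by lia.
  have -> : 2 + n - 1 = n + 1 by lia.
  have -> : 2 + n - 2 = n by lia.
  move=> /eqP; rewrite subr_eq => /eqP ->.
  rewrite -[2%:~R]/(2%:R) scaler_nat addr0. zmodule.
by rewrite binz2SSS scale0r.
Qed.

Lemma mode0_deriv A B C n : vm A 0 (vm B n C) =
  vm (vm A 0 B) n C + vm B n (vm A 0 C).
Proof.
have [[N|N] h] := vtrunc T A B; apply/eqP; rewrite -subr_eq; apply/eqP.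
  rewrite (@vcommutator N.+1) => [|j jN]; last by apply: h; lia.
  rewrite big_ord_recl big1 ?addr0 => [|j _]; last by rewrite binz0S scale0r.
  by rewrite binz0 scale1r /= ?(subr0, add0r).
rewrite (@vcommutator 1) => [|j jN]; last by apply: h; lia.
by rewrite big_ord1 binz0 scale1r /= ?(subr0, add0r).
Qed.

Lemma mode1_deriv A B C n : vm A 1 (vm B n C) =
  vm (vm A 0 B) (n + 1) C + vm (vm A 1 B) n C + vm B n (vm A 1 C).
Proof.
have : exists N, forall j, (N.+2 <= j)%N -> vm A j%:Z B = 0.
  by have [[N|N] h] := vtrunc T A B; exists N => j jN; apply: h; lia.
case=> N h; apply/eqP; rewrite -subr_eq; apply/eqP.
rewrite (vcommutator _ _ _ h) !big_ord_recl big1 ?addr0 => [|j _]; last first.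
  by rewrite binz1SS scale0r.
rewrite binz0 binz1 mulr1z !scale1r /= -[bump 0 0]/1%N ?subr0.
have -> : 1 + n - 1%Z = n by lia.
by rewrite [1 + n]addrC; reflexivity.
Qed.

End VertexAlgebra.

(** * Leading coefficients in h *)

Section LaurentTheory.
Variables (K : fieldType) (V : lmodType K).
Implicit Types (f : laurent V) (k : int).

Lemma hmonoE k (v : V) j : hmono k v j = if j == k then v else 0.
Proof. exact: dsingleE. Qed.

Lemma hmono_linear k : linear (@hmono K V k).
Proof.
move=> a u v; apply: dsumP => i; rewrite dsumD dsumZ !hmonoE.
by case: eqP; rewrite ?scaler0 ?addr0.
Qed.

Lemma hmonoD k (u v : V) : hmono k (u + v) = hmono k u + hmono k v.
Proof. by have := hmono_linear k 1 u v; rewrite !scale1r. Qed.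

Lemma hmono0 k : hmono k (0 : V) = 0.
Proof. by apply: dsumP => i; rewrite hmonoE; case: eqP. Qed.

Lemma hshift_linear k : linear (@hshift K V k).
Proof. by move=> a f g; apply: dsumP => i; rewrite dsumD dsumZ !hshiftE. Qed.

Lemma hshiftD k f g : hshift k (f + g) = hshift k f + hshift k g.
Proof. by have := hshift_linear k 1 f g; rewrite !scale1r. Qed.

Lemma hshift0 k : hshift k (0 : laurent V) = 0.
Proof. by apply: dsumP => i; rewrite hshiftE. Qed.

Lemma hshiftZ k a f : hshift k (a *: f) = a *: hshift k f.
Proof. by have := hshift_linear k a f 0; rewrite hshift0 !addr0. Qed.

Lemma hshift_mono k j (v : V) : hshift k (hmono j v) = hmono (k + j) v.
Proof.
apply: dsumP => i; rewrite hshiftE !hmonoE.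
by rewrite (can2_eq (subrK _) (addrK _)) [j + k]addrC.
Qed.

Definition orderge (a : int) : set (laurent V) :=
  [set f | forall k, k < a -> f k = 0].

Lemma orderge_mono k v : orderge k (hmono k v).
Proof. by move=> j jk; rewrite hmonoE lt_eqF. Qed.

Lemma laurent_bound f : exists N : nat, forall k, N%:Z <= `|k| -> f k = 0.
Proof.
pose A := fset_set [set k | f k <> 0].
exists (\max_(k <- A) `|k|.+1)%N => k kN; apply/eqP; apply: contraLR kN => fk0.
have kA : k \in A by rewrite in_fset_set ?inE; [apply/eqP|exact: dsum_fin].
rewrite -ltNge -abszE ltz_nat.
exact: (@leq_bigmax_seq int (enum_fset A) xpredT (fun k => `|k|.+1)%N k kA isT).
Qed.

Lemma laurent_sum a N f : (forall k, ~~ (a <= k < a + N%:Z) -> f k = 0) ->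
  f = \sum_(j < N) hmono (a + j%:Z) (f (a + j%:Z)).
Proof.
move=> h; apply: dsumP => k; rewrite dsum_sum.
have [kN|kN] := boolP (a <= k < a + N%:Z).
  have jN : (`|k - a| < N)%N by lia.
  have ka : a + `|k - a|%N%:Z = k by lia.
  rewrite (bigD1 (Ordinal jN)) //= hmonoE ka eqxx big1 ?addr0 // => i ij.
  rewrite hmonoE; case: eqP => // ki; case/eqP: ij; apply: val_inj => /=; lia.
rewrite h // big1 // => i _; rewrite hmonoE; case: eqP => // ki.
by move: kN; rewrite ki; have := ltn_ord i; lia.
Qed.

Lemma orderge_sum a f : orderge a f -> exists N, forall M, (N <= M)%N ->
  f = \sum_(j < M) hmono (a + j%:Z) (f (a + j%:Z)).
Proof.
move=> fa; have [N fN] := laurent_bound f.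
exists (N + `|a|)%N => M NM; apply: laurent_sum => k; rewrite negb_and -ltNge.
by case/orP => [/fa //|kM]; apply: fN; move: kM; lia.
Qed.

(* An operator commuting with h is determined, to leading order, by its values
   on coefficients. *)
Lemma leading_operator (F : laurent V -> laurent V) (S : set V) a e f :
  F 0 = 0 -> (forall g g', F (g + g') = F g + F g') ->
  (forall k g, F (hshift k g) = hshift k (F g)) ->
  (forall v, S v -> orderge e (F (hmono 0 v))) ->
  orderge a f -> (forall k, S (f k)) ->
  orderge (a + e) (F f) /\ F f (a + e) = F (hmono 0 (f a)) e.
Proof.
move=> F0 FD Fh FS fa Sf; have [N /(_ N.+1 (leqnSn N)) def_f] := orderge_sum fa.
have FfE k : F f k = \sum_(j < N.+1) F (hmono 0 (f (a + j%:Z))) (k - (a + j%:Z)).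
  rewrite [in LHS]def_f (big_morph F FD F0) dsum_sum; apply: eq_bigr => j _.
  by rewrite -[a + j%:Z]addr0 -hshift_mono Fh hshiftE addr0.
split=> [k ka|]; rewrite FfE.
  by rewrite big1 // => j _; apply: (FS _ (Sf _)); lia.
rewrite big_ord_recl big1 ?addr0 /= => [|j _].
  by congr (F _ _); lia.
by apply: (FS _ (Sf _)); rewrite /bump; lia.
Qed.

End LaurentTheory.

Section FormalParameter.
Variables (K : numFieldType) (V : lmodType K) (Vgr : nat -> set V).
Variables (T : voa (fun n => laurent_in (Vgr n))) (fpT : formal_parameter T).
Implicit Types (X Y : laurent V) (u v : V).

Local Notation vm := (vmode T).
Local Notation vac := (vvac T).

(** Here $X_{-1-j}\mathbf 1=L_{-1}^jX/j!$, and $L_{-1}$ commutes with $h$ by [fp_comm], being a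
    mode. Such terms are the corrections in the skew-symmetry formula. *)
Lemma vmode_vac_hshift k X j :
  vm (hshift k X) (- 1 - j%:Z) vac = hshift k (vm X (- 1 - j%:Z) vac).
Proof.
elim: j X => [|j ih] X; first by rewrite subr0 !vcreate.
have E Y : vm Y (- 1 - j.+1%:Z) vac =
    j.+1%:R^-1 *: vm (virasoro T (-1) Y) (- 1 - j%:Z) vac.
  rewrite vmode_Lm1 scalerA; have -> : - (-1 - j%:Z) = j.+1%:Z by lia.
  rewrite -pmulrn mulVf ?pnatr_eq0 // scale1r; congr (vm _ _ _); lia.
by rewrite E [in RHS]E /virasoro (fp_comm fpT) ih hshiftZ.
Qed.

(** Skew-symmetry moves the shifted state to the right, where [fp_comm] applies, at the price of the
    modes $X_{n+1+j}Y$ of larger index. A descending induction on [n] handles these; it starts where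
    truncation annihilates both sides. *)
Lemma vmode_hshiftl k X n Y : vm (hshift k X) n Y = hshift k (vm X n Y).
Proof.
have [N1 h1] := vtrunc T (hshift k X) Y; have [N2 h2] := vtrunc T X Y.
(* [m] bounds the distance of [n] below an index from which both products vanish. *)
have [m mE] : exists m : nat, Num.max N1 N2 - m%:Z <= n.
  by exists `|Num.max N1 N2 - n|%N; lia.
elim: m => [|m ih] in n mE *; first by rewrite h1 ?h2 ?hshift0 //; lia.
have sk Z : vm Z n Y = - ((-1) ^ n *: vm Y n Z) +
  \sum_(j \in [set: nat]) (-1) ^+ j *: vm (vm Z (n + 1 + j%:Z) Y) (- 2 - j%:Z) vac.
  by rewrite -vskew addrC addrK.
rewrite sk [in RHS]sk hshiftD (fp_comm fpT) -!scaleNr hshiftZ; congr (_ + _).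
pose M := `|Num.max N1 N2 - n|%N.
rewrite !(@fsum_nat _ M) => [|j jM|j jM]; last 2 first.
- by rewrite h2 ?vmode0l ?scaler0 //; lia.
- by rewrite h1 ?vmode0l ?scaler0 //; lia.
rewrite (big_morph _ (hshiftD k) (hshift0 _ k)); apply: eq_bigr => j _.
rewrite ih; last by lia.
rewrite hshiftZ; congr (_ *: _).
have -> : - 2 - j%:Z = - 1 - j.+1%:Z :> int by lia.
exact: vmode_vac_hshift.
Qed.

(** The power of $h$ guaranteed in $u_nv$ for $u,v\in V$: [fp_small] gives one factor for
    nonnegative modes, [fp_closed] only the absence of poles for the others. *)
Definition mode_order (n : int) : int := if 0 <= n then 1 else 0.

Definition symbol (n : int) u v : V :=
  vm (hmono 0 u) n (hmono 0 v) (mode_order n).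

Lemma orderge_mode n u v : orderge (mode_order n) (vm (hmono 0 u) n (hmono 0 v)).
Proof.
have cL w : constL (hmono 0 w : laurent V).
  by move=> k k0; rewrite hmonoE (negbTE k0).
rewrite /mode_order; case: (boolP (0 <= n)) => n0 k k1.
  by apply: (fp_small fpT (cL u) (cL v) n0); lia.
by apply: (fp_closed fpT); [| |lia] => j j0; apply: cL; lia.
Qed.

(** [leading_operator] is applied in each argument in turn; in the left one its $h$-linearity
    hypothesis is [vmode_hshiftl]. *)
Lemma leading_mode a b n X Y : orderge a X -> orderge b Y ->
  orderge (a + b + mode_order n) (vm X n Y) /\
  vm X n Y (a + b + mode_order n) = symbol n (X a) (Y b).
Proof.
move=> aX bY.
have step u : orderge (b + mode_order n) (vm (hmono 0 u) n Y) /\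
    vm (hmono 0 u) n Y (b + mode_order n) = symbol n u (Y b).
  apply: (@leading_operator _ _ (vm (hmono 0 u) n) setT) => //.
  - exact: vmode0r.
  - by move=> ? ?; rewrite vmodeDr.
  - by move=> ? ?; rewrite (fp_comm fpT).
  - by move=> v _; exact: orderge_mode.
rewrite -addrA -(step (X a)).2.
apply: (@leading_operator _ _ (fun X => vm X n Y) setT) => //.
- exact: vmode0l.
- by move=> ? ?; rewrite vmodeDl.
- by move=> ? ?; rewrite vmode_hshiftl.
- by move=> v _; exact: (step v).1.
Qed.

Definition symbol_Lm1 u : V := virasoro T (-1) (hmono 0 u) 0.
Definition symbol_L1 u : V := virasoro T 1 (hmono 0 u) 1.

Lemma leading_Lm1 a X : orderge a X ->
  orderge a (virasoro T (-1) X) /\ virasoro T (-1) X a = symbol_Lm1 (X a).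
Proof.
move=> aX; rewrite -[a]addr0 /symbol_Lm1.
have := @leading_operator _ _ (virasoro T (-1)) setT a 0 X.
rewrite !addr0; apply => //.
- exact: vmode0r.
- by move=> ? ?; rewrite /virasoro vmodeDr.
- by move=> ? ?; rewrite /virasoro (fp_comm fpT).
move=> v _ k k0; apply: (fp_Lm1 fpT); last by lia.
by move=> j j0; rewrite hmonoE (negbTE j0).
Qed.

(** [fp_L1] provides the factor $h$ on $V^1$, which is why [leading_operator] allows the
    coefficients to be restricted to a set. *)
Lemma leading_L1 a X : orderge a X -> laurent_in (Vgr 1) X ->
  orderge (a + 1) (virasoro T 1 X) /\ virasoro T 1 X (a + 1) = symbol_L1 (X a).
Proof.
move=> aX wX; apply: (@leading_operator _ _ (virasoro T 1) (Vgr 1)) => //.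
- exact: vmode0r.
- by move=> ? ?; rewrite /virasoro vmodeDr.
- by move=> ? ?; rewrite /virasoro (fp_comm fpT).
by move=> v wv k k0; apply: (fp_L1 fpT wv); lia.
Qed.

End FormalParameter.

(** * Courant algebroids with divergence *)

Definition bilin (K : fieldType) (U V W : lmodType K) (f : U -> V -> W) : Prop :=
  (forall a x x' y, f (a *: x + x') y = a *: f x y + f x' y) /\
  (forall a x y y', f x (a *: y + y') = a *: f x y + f x y').

Definition lin (K : fieldType) (U W : lmodType K) (f : U -> W) : Prop :=
  forall a x x', f (a *: x + x') = a *: f x + f x'.

Section LinearMaps.
Variables (K : fieldType) (U W : lmodType K) (f : U -> W).
Hypothesis fl : lin f.

Lemma linD x y : f (x + y) = f x + f y.
Proof. by have := fl 1 x y; rewrite !scale1r. Qed.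

Lemma lin0 : f 0 = 0.
Proof. by apply: (addrI (f 0)); rewrite -linD !addr0. Qed.

Lemma linZ a x : f (a *: x) = a *: f x.
Proof. by have := fl a x 0; rewrite lin0 !addr0. Qed.

Lemma linN x : f (- x) = - f x.
Proof. by rewrite -scaleN1r linZ scaleN1r. Qed.

Lemma linMn x n : f (x *+ n) = f x *+ n.
Proof. by rewrite -!scaler_nat linZ. Qed.

Definition linE := (linD, linN, lin0, linMn).
End LinearMaps.

Section BilinearMaps.
Variables (K : fieldType) (U V W : lmodType K) (f : U -> V -> W).
Hypothesis fb : bilin f.

Lemma bilinl y : lin (f^~ y). Proof. by move=> a x x'; exact: fb.1. Qed.
Lemma bilinr x : lin (f x). Proof. by move=> a y y'; exact: fb.2. Qed.

Lemma bilinDl x x' y : f (x + x') y = f x y + f x' y.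
Proof. exact: (linD (bilinl y)). Qed.
Lemma bilinNl x y : f (- x) y = - f x y.
Proof. exact: (linN (bilinl y)). Qed.
Lemma bilin0l y : f 0 y = 0.
Proof. exact: (lin0 (bilinl y)). Qed.
Lemma bilinZl a x y : f (a *: x) y = a *: f x y.
Proof. exact: (linZ (bilinl y)). Qed.
Lemma bilinMnl x n y : f (x *+ n) y = f x y *+ n.
Proof. exact: (linMn (bilinl y)). Qed.
Lemma bilinDr x y y' : f x (y + y') = f x y + f x y'.
Proof. exact: (linD (bilinr x)). Qed.
Lemma bilinNr x y : f x (- y) = - f x y.
Proof. exact: (linN (bilinr x)). Qed.
Lemma bilin0r x : f x 0 = 0.
Proof. exact: (lin0 (bilinr x)). Qed.
Lemma bilinZr a x y : f x (a *: y) = a *: f x y.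
Proof. exact: (linZ (bilinr x)). Qed.
Lemma bilinMnr x n y : f x (y *+ n) = f x y *+ n.
Proof. exact: (linMn (bilinr x)). Qed.

Definition bilinE := (bilinDl, bilinDr, bilinNl, bilinNr, bilin0l, bilin0r,
  bilinMnl, bilinMnr).
End BilinearMaps.

(* A Courant algebroid with a divergence operator: [amul], [aact], [ader],
   [aanc], [abr], [apr], [adiv] are uv, uA, du, A(u), [A, B], <A, B>, div A. *)
Record courant (K : fieldType) (V0 V1 : lmodType K) := Courant {
  amul : V0 -> V0 -> V0;
  aact : V0 -> V1 -> V1;
  ader : V0 -> V1;
  aanc : V1 -> V0 -> V0;
  abr : V1 -> V1 -> V1;
  apr : V1 -> V1 -> V0;
  adiv : V1 -> V0;
  amul_bilin : bilin amul;
  aact_bilin : bilin aact;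
  ader_lin : lin ader;
  aanc_bilin : bilin aanc;
  abr_bilin : bilin abr;
  apr_bilin : bilin apr;
  adiv_lin : lin adiv;
  amulC : forall u v, amul u v = amul v u;
  amulA : forall u v w, amul u (amul v w) = amul (amul u v) w;
  aactA : forall u v A, aact u (aact v A) = aact (amul u v) A;
  aderM : forall u v, ader (amul u v) = aact u (ader v) + aact v (ader u);
  aancM : forall A u v, aanc A (amul u v) = amul u (aanc A v) + amul (aanc A u) v;
  aanc_act : forall u A v, aanc (aact u A) v = amul u (aanc A v);
  apr_sym : forall A B, apr A B = apr B A;
  apr_actl : forall u A B, apr (aact u A) B = amul u (apr A B);
  abr_skew : forall A B, abr A B = - abr B A + ader (apr A B);
  abr_actr : forall u A B, abr A (aact u B) = aact (aanc A u) B + aact u (abr A B);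
  apr_derr : forall A u, apr A (ader u) = aanc A u;
  abr_derl : forall u A, abr (ader u) A = 0;
  abr_derr : forall A u, abr A (ader u) = ader (aanc A u);
  aanc_der : forall u v, aanc (ader u) v = 0;
  aanc_pr : forall A B C, aanc A (apr B C) = apr (abr A B) C + apr B (abr A C);
  adiv_act : forall u A, adiv (aact u A) = amul u (adiv A) + aanc A u;
  adiv_br : forall A B, adiv (abr A B) = aanc A (adiv B) - aanc B (adiv A);
  adiv_der : forall u, adiv (ader u) = 0
}.

Section Courant.
Variables (K : fieldType) (V0 V1 : lmodType K) (S : courant V0 V1).

Local Notation "u ** v" := (amul S u v) (at level 40, left associativity).
Local Notation "u '@@' A" := (aact S u A) (at level 40).
Local Notation D := (ader S).
Local Notation "A '#' u" := (aanc S A u) (at level 38).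
Local Notation "[| A , B |]" := (abr S A B).
Local Notation "<| A , B |>" := (apr S A B).
Local Notation div := (adiv S).

Lemma apr_derl u A : <| D u, A |> = A # u.
Proof. by rewrite apr_sym apr_derr. Qed.

Lemma apr_actr u A B : <| A, u @@ B |> = u ** <| A, B |>.
Proof. by rewrite apr_sym apr_actl apr_sym. Qed.

Lemma amulAC u v w : u ** v ** w = u ** w ** v.
Proof. by rewrite -!amulA (amulC S v). Qed.

(** The Leibniz rule on the right, conjugated by skew-symmetry; the term with [D u] comes from the
    symmetric part of the bracket. *)
Lemma abr_actl u A B :
  [| u @@ A, B |] = u @@ [| A, B |] - (B # u) @@ A + <| A, B |> @@ D u.
Proof.
rewrite abr_skew abr_actr apr_actl aderM (abr_skew S A B).
rewrite !(bilinE (aact_bilin S)); zmodule.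
Qed.

Definition bvops := (bilinE (amul_bilin S), bilinE (aact_bilin S),
  bilinE (aanc_bilin S), bilinE (abr_bilin S), bilinE (apr_bilin S),
  linE (ader_lin S), linE (adiv_lin S)).

Definition courantE := (aactA, aderM, aancM, aanc_act, apr_actl, apr_actr,
  apr_derl, apr_derr, abr_actr, abr_actl, abr_derl, abr_derr, aanc_der,
  adiv_act, adiv_br, adiv_der, amulA).

(* The element (x0, (X1, x1), (X2, x2), x3) stands for x0 + c X1 + h (partial c) x1
   + h c (partial c) X2 + h c (partial^2 c) x2 / 2
   + h^2 c (partial c) (partial^2 c) x3 / 2. *)
Definition sixtuple : lmodType K := (V0 * (V1 * V0) * (V1 * V0) * V0)%type.

Implicit Types x y z w : sixtuple.

Definition aQ x : sixtuple :=
  let: (x0, (X1, x1), (X2, x2), x3) := x in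
  (0, (D x0, 0), (D x1, x1 *+ 2 - div X1), div X2).

(** The components of [tmode_N1_light] with modes replaced by symbols. The terms that carry a factor
    2 there have too high an order in $h$ and are absent here. *)
Definition amu x y : sixtuple :=
  let: (x0, (X1, x1), (X2, x2), x3) := x in
  let: (y0, (Y1, y1), (Y2, y2), y3) := y in
  (x0 ** y0,
   (x0 @@ Y1 + y0 @@ X1, x0 ** y1 + X1 # y0 + x1 ** y0),
   (x0 @@ Y2 - [| X1, Y1 |] + y1 @@ X1 - x1 @@ Y1 + y0 @@ X2,
    x0 ** y2 - <| X1, Y1 |> + x2 ** y0),
   x0 ** y3 + <| X1, Y2 |> - X1 # y2 - x1 ** y2 + <| X2, Y1 |> - Y1 # x2
   - x2 ** y1 + x3 ** y0).

Definition an x y z : sixtuple :=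
  let: (x0, (X1, x1), (X2, x2), x3) := x in
  let: (y0, (Y1, y1), (Y2, y2), y3) := y in
  let: (z0, (Z1, z1), (Z2, z2), z3) := z in
  (0, (0, 0), (<| X1, Z1 |> @@ Y1 - <| Y1, Z1 |> @@ X1, 0),
   - (x2 ** <| Y1, Z1 |>) - y2 ** <| X1, Z1 |>).

(** The sign $(-1)^{|x|}$ extended linearly, so that the relations can be checked on all sextuples
    at once; [asg_deg] returns to the sign of a homogeneous element. *)
Definition asg x : sixtuple :=
  let: (x0, (X1, x1), (X2, x2), x3) := x in
  (x0, (- X1, - x1), (X2, x2), - x3).

Lemma sixtupleD (x0 x1 x2 x3 y0 y1 y2 y3 : V0) (X1 X2 Y1 Y2 : V1) :
  ((x0, (X1, x1), (X2, x2), x3) : sixtuple) +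
    ((y0, (Y1, y1), (Y2, y2), y3) : sixtuple) =
  (x0 + y0, (X1 + Y1, x1 + y1), (X2 + Y2, x2 + y2), x3 + y3) :> sixtuple.
Proof. by []. Qed.

Lemma sixtupleN (x0 x1 x2 x3 : V0) (X1 X2 : V1) :
  - ((x0, (X1, x1), (X2, x2), x3) : sixtuple) =
  (- x0, (- X1, - x1), (- X2, - x2), - x3) :> sixtuple.
Proof. by []. Qed.

Lemma sixtuple0 : (0 : sixtuple) = (0, (0, 0), (0, 0), 0).
Proof. by []. Qed.

Ltac sixcases x :=
  let x0 := fresh x "0" in let X1 := fresh x "A1" in let x1 := fresh x "1" in
  let X2 := fresh x "A2" in let x2 := fresh x "2" in let x3 := fresh x "3" in
  case: x => [[[x0 [X1 x1]] [X2 x2]] x3].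

Lemma aQQ x : aQ (aQ x) = 0.
Proof.
sixcases x; rewrite /aQ /= sixtuple0.
congr (_, (_, _), (_, _), _) => /=; rewrite ?(courantE, bvops); try zmodule.
Qed.

Lemma aQ_mu x y : aQ (amu x y) = amu (aQ x) y + amu (asg x) (aQ y).
Proof.
sixcases x; sixcases y; rewrite /aQ /amu /asg sixtupleD.
congr (_, (_, _), (_, _), _) => /=; rewrite ?(courantE, bvops); try zmodule.
(* [zmodule] sees products as atoms, so commutativity must first bring equal products to the same
   form. *)
- rewrite [y0 ** div xA1]amulC; zmodule.
- rewrite [y1 ** div xA1]amulC [y0 ** div xA2]amulC; zmodule.
Qed.

Lemma aQ_n x y z :
  aQ (an x y z) + an (aQ x) y z + an (asg x) (aQ y) z + an (asg x) (asg y) (aQ z)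
  = amu (amu x y) z - amu x (amu y z).
Proof.
sixcases x; sixcases y; sixcases z; rewrite /aQ /amu /an /asg !(sixtupleD, sixtupleN).
congr (_, (_, _), (_, _), _) => /=; rewrite ?(courantE, bvops); try zmodule.
- rewrite !(amulC S z0); zmodule.
- rewrite !(amulC S z1) !(amulC S z0); zmodule.
- rewrite !(amulC S z0); zmodule.
(* In ghost number 3 the anchor meets a pairing: invariance of the pairing under the bracket turns
   it into brackets, and the skew-symmetry rule makes these comparable with $[X,Y]$. *)
rewrite [yA1 # <| xA1, zA1 |>]aanc_pr (abr_skew S yA1 xA1).
rewrite ?(courantE, bvops) [<| yA1, xA1 |>]apr_sym.
rewrite !(amulC S z0) !(amulC S z1) [zA1 # x0 ** y2]amulC [zA1 # x2 ** y0]amulC.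
rewrite ![div _ ** _]amulC; zmodule.
Qed.

Lemma amu_n x y z w :
  amu (asg x) (an y z w) + amu (an x y z) w =
  an (amu x y) z w - an x (amu y z) w + an x y (amu z w).
Proof.
sixcases x; sixcases y; sixcases z; sixcases w; rewrite /amu /an /asg !(sixtupleD, sixtupleN).
congr (_, (_, _), (_, _), _) => /=; rewrite ?(courantE, bvops); try zmodule.
- rewrite ![<| _, _ |> ** _]amulC; zmodule.
rewrite ![<| _, wA1 |> ** _]amulC !(amulC S z2) !(amulAC _ w0); zmodule.
Qed.
(** [an] reads its arguments only in the components [X1] and [x2], and its values have only the
    components [X2] and [x3]. The same reason serves the other two positions. *)
Lemma an_n1 x y z w t : an (an x y z) w t = 0.
Proof.
sixcases x; sixcases y; sixcases z; sixcases w; sixcases t.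
by rewrite /an !bvops ?(oppr0, subr0, addr0).
Qed.

Lemma an_n2 x y z w t : an x (an y z w) t = 0.
Proof.
sixcases x; sixcases y; sixcases z; sixcases w; sixcases t.
by rewrite /an !bvops ?(oppr0, subr0, addr0).
Qed.

Lemma an_n3 x y z w t : an x y (an z w t) = 0.
Proof.
sixcases x; sixcases y; sixcases z; sixcases w; sixcases t.
by rewrite /an !bvops ?(oppr0, subr0, addr0).
Qed.

Lemma sixtupleZ a (x0 x1 x2 x3 : V0) (X1 X2 : V1) :
  a *: ((x0, (X1, x1), (X2, x2), x3) : sixtuple) =
  (a *: x0, (a *: X1, a *: x1), (a *: X2, a *: x2), a *: x3) :> sixtuple.
Proof. by []. Qed.

Definition bvopsZ := (linZ (ader_lin S), linZ (adiv_lin S),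
  (bilinZl (amul_bilin S), bilinZr (amul_bilin S)),
  (bilinZl (aact_bilin S), bilinZr (aact_bilin S)),
  (bilinZl (aanc_bilin S), bilinZr (aanc_bilin S)),
  (bilinZl (abr_bilin S), bilinZr (abr_bilin S)),
  (bilinZl (apr_bilin S), bilinZr (apr_bilin S))).

Ltac sixlinear f :=
  rewrite sixtupleZ sixtupleD /f sixtupleZ sixtupleD;
  congr (_, (_, _), (_, _), _) => /=;
  rewrite ?(bvops, bvopsZ) ?scalerDr ?scalerN -?scalerMnr ?scaler0; zmodule.

Lemma aQ_linear : lin aQ.
Proof. by move=> a x y; sixcases x; sixcases y; sixlinear aQ. Qed.

Lemma amu_bilinear : bilin amu.
Proof.
by split=> a x y z; sixcases x; sixcases y; sixcases z; sixlinear amu.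
Qed.

Lemma an_linear1 y z : lin (fun x => an x y z).
Proof.
by move=> a x x'; sixcases x; sixcases x'; sixcases y; sixcases z; sixlinear an.
Qed.

Lemma an_linear2 x z : lin (fun y => an x y z).
Proof.
by move=> a y y'; sixcases x; sixcases y'; sixcases y; sixcases z; sixlinear an.
Qed.

Lemma an_linear3 x y : lin (an x y).
Proof.
by move=> a z z'; sixcases x; sixcases z'; sixcases y; sixcases z; sixlinear an.
Qed.

Definition adeg (i : int) : set sixtuple := [set x |
  let: (x0, (X1, x1), (X2, x2), x3) := x in
  [/\ i != 0 -> x0 = 0, i != 1 -> X1 = 0 /\ x1 = 0,
      i != 2 -> X2 = 0 /\ x2 = 0 & i != 3 -> x3 = 0]].

Lemma adeg_subspace i : subspace (adeg i).
Proof.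
split=> [ |a x y]; first by split.
sixcases x; sixcases y; move=> -[hx0 hx1 hx2 hx3] [hy0 hy1 hy2 hy3].
split=> h /=.
- by rewrite (hx0 h) (hy0 h) scaler0 addr0.
- by have [-> ->] := hx1 h; have [-> ->] := hy1 h; rewrite !scaler0 !addr0.
- by have [-> ->] := hx2 h; have [-> ->] := hy2 h; rewrite !scaler0 !addr0.
by rewrite (hx3 h) (hy3 h) scaler0 addr0.
Qed.

Lemma asg_deg i x : adeg i x -> (-1) ^ i *: x = asg x.
Proof.
sixcases x; move=> -[hx0 hx1 hx2 hx3]; rewrite sixtupleZ /asg.
have [i0|/hx0 ->] := eqVneq i 0.
  have [-> ->] : xA1 = 0 /\ x1 = 0 by apply: hx1; rewrite i0.
  by rewrite i0 expr0z !scale1r hx3 ?i0 // !oppr0.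
have [i1|/hx1[-> ->]] := eqVneq i 1.
  have [-> ->] : xA2 = 0 /\ x2 = 0 by apply: hx2; rewrite i1.
  by rewrite i1 expr1z !scaleN1r hx3 ?i1 // !oppr0.
have [i2|/hx2[-> ->]] := eqVneq i 2.
  by rewrite i2 -exprnP sqrrN expr1n !scale1r hx3 ?i2 // !oppr0.
rewrite !scaler0 !oppr0; have [->|/hx3 ->] := eqVneq i 3.
  by rewrite -exprnP exprS sqrrN expr1n mulr1 scaleN1r.
by rewrite scaler0 oppr0.
Qed.

(** A product of components of degrees [a] and [b] can be nonzero only on arguments of exactly these
    degrees; all degree statements reduce to this, term by term. *)
Lemma bilin_deg (U V W : lmodType K) (f : U -> V -> W) (i j a b : int) u v :
  bilin f ->
  (i != a -> u = 0) -> (j != b -> v = 0) -> i + j != a + b -> f u v = 0.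
Proof.
move=> fb hu hv; have [->|/hu -> _] := eqVneq i a; last exact: bilin0l.
by have [->|/hv -> _] := eqVneq j b; [rewrite eqxx|exact: bilin0r].
Qed.

Lemma aQ_deg i x : adeg i x -> adeg (i + 1) (aQ x).
Proof.
sixcases x; move=> -[hx0 hx1 hx2 hx3]; split=> //= h.
- by rewrite hx0 ?(lin0 (ader_lin S)) //; apply: contraNneq h => ->.
- have /hx1[-> ->] : i != 1 by apply: contraNneq h => ->.
  by rewrite (lin0 (adiv_lin S)) (lin0 (ader_lin S)) mul0rn subr0.
have /hx2[-> _] : i != 2 by apply: contraNneq h => ->.
by rewrite (lin0 (adiv_lin S)).
Qed.

Lemma amu_deg i j x y : adeg i x -> adeg j y -> adeg (i + j) (amu x y).
Proof.
sixcases x; sixcases y; move=> -[hx0 hx1 hx2 hx3] [hy0 hy1 hy2 hy3].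
have bM i' j' a b u v := @bilin_deg _ _ _ _ i' j' a b u v (amul_bilin S).
have bA i' j' a b u v := @bilin_deg _ _ _ _ i' j' a b u v (aact_bilin S).
have bN i' j' a b u v := @bilin_deg _ _ _ _ i' j' a b u v (aanc_bilin S).
have bB i' j' a b u v := @bilin_deg _ _ _ _ i' j' a b u v (abr_bilin S).
have bP i' j' a b u v := @bilin_deg _ _ _ _ i' j' a b u v (apr_bilin S).
have X1 h := (hx1 h).1; have x1' h := (hx1 h).2.
have X2 h := (hx2 h).1; have x2' h := (hx2 h).2.
have Y1 h := (hy1 h).1; have y1' h := (hy1 h).2.
have Y2 h := (hy2 h).1; have y2' h := (hy2 h).2.
split=> /= h; last 1 first.
- have h' : j + i != 3 by rewrite addrC.
  rewrite (bM _ _ _ _ _ _ hx0 hy3 h) (bP _ _ _ _ _ _ X1 Y2 h).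
  rewrite (bN _ _ _ _ _ _ X1 y2' h) (bM _ _ _ _ _ _ x1' y2' h).
  rewrite (bP _ _ _ _ _ _ X2 Y1 h) (bN _ _ _ _ _ _ Y1 x2' h').
  by rewrite (bM _ _ _ _ _ _ x2' y1' h) (bM _ _ _ _ _ _ hx3 hy0 h) !addr0 !subr0.
- exact: (bM _ _ _ _ _ _ hx0 hy0 h).
- have h' : j + i != 1 by rewrite addrC.
  rewrite (bA _ _ _ _ _ _ hx0 Y1 h) (bA _ _ _ _ _ _ hy0 X1 h').
  rewrite (bM _ _ _ _ _ _ hx0 y1' h) (bN _ _ _ _ _ _ X1 hy0 h).
  by rewrite (bM _ _ _ _ _ _ x1' hy0 h) !addr0.
have h' : j + i != 2 by rewrite addrC.
rewrite (bA _ _ _ _ _ _ hx0 Y2 h) (bB _ _ _ _ _ _ X1 Y1 h).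
rewrite (bA _ _ _ _ _ _ y1' X1 h') (bA _ _ _ _ _ _ x1' Y1 h).
rewrite (bA _ _ _ _ _ _ hy0 X2 h') (bM _ _ _ _ _ _ hx0 y2' h).
by rewrite (bP _ _ _ _ _ _ X1 Y1 h) (bM _ _ _ _ _ _ x2' hy0 h) !(addr0, subr0).
Qed.

Lemma an_deg i j k x y z : adeg i x -> adeg j y -> adeg k z ->
  adeg (i + j + k - 1) (an x y z).
Proof.
sixcases x; sixcases y; sixcases z; move=> -[_ hx1 hx2 _] [_ hy1 hy2 _] [_ hz1 _ _].
have X1 h := (hx1 h).1; have x2' h := (hx2 h).2.
have Y1 h := (hy1 h).1; have y2' h := (hy2 h).2; have Z1 h := (hz1 h).1.
have pr0 A B (a b : int) : (a != 1 -> A = 0) -> (b != 1 -> B = 0) -> a + b != 2 ->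
    <| A, B |> = 0.
  by move=> hA hB h; exact: (bilin_deg (apr_bilin S) hA hB h).
split=> //= h.
  split=> //; rewrite (bilin_deg (i := i + k) (a := 2) (aact_bilin S) _ Y1).
  - rewrite (bilin_deg (i := j + k) (a := 2) (aact_bilin S) _ X1) ?subr0 //.
      by apply: pr0.
    by apply: contraNneq h; lia.
  - by apply: pr0.
  - by apply: contraNneq h; lia.
rewrite (bilin_deg (j := j + k) (b := 2) (amul_bilin S) x2').
- rewrite (bilin_deg (j := i + k) (b := 2) (amul_bilin S) y2') ?oppr0 ?addr0 //.
    by apply: pr0.
  by apply: contraNneq h; lia.
- by apply: pr0.
- by apply: contraNneq h; lia.
Qed.

Theorem courant_A3 : A3_algebra adeg aQ amu an.
Proof.
split.
- exact: adeg_subspace.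
- exact: aQ_deg.
- exact: amu_deg.
- exact: an_deg.
- by move=> i a x x' _ _; exact: aQ_linear.
- by move=> i j a x x' y _ _ _; exact: amu_bilinear.1.
- by move=> i j a x x' y _ _ _; exact: amu_bilinear.2.
- by move=> i j k a x x' y z _ _ _ _; exact: an_linear1.
- by move=> i j k a x y y' z _ _ _ _; exact: an_linear2.
- by move=> i j k a x y z z' _ _ _ _; exact: an_linear3.
- by move=> i x _; exact: aQQ.
- move=> i j x y dx dy.
  by rewrite aQ_mu -(asg_deg dx) (bilinZl amu_bilinear).
- move=> i j k x y z dx dy dz; rewrite -aQ_n -(asg_deg dx) -(asg_deg dy).
  rewrite (linZ (an_linear1 _ _)) (linZ (an_linear1 _ _)) (linZ (an_linear2 _ _)).
  by rewrite scalerA expfzDr // oppr_eq0 oner_eq0.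
- move=> i j k l x y z w dx dy dz dw.
  by rewrite -amu_n -(asg_deg dx) (bilinZl amu_bilinear).
- move=> i j k l m x y z w t _ _ _ _ _.
  by rewrite an_n1 an_n2 an_n3 !scaler0 !addr0.
Qed.

End Courant.

(** All axioms are memberships or equations between homogeneous elements, each of which is the image
    of a homogeneous one. So it is enough that the linear map [phi] intertwines the operations in
    every degree. *)
Lemma A3_algebra_image (K : fieldType) (W W' : lmodType K) (F : int -> set W)
    (F' : int -> set W') Q Q' mu mu' n n' (phi : W -> W') :
  lin phi ->
  (forall i y, F' i y <-> exists2 x, F i x & y = phi x) ->
  (forall i x, F i x -> Q' (phi x) = phi (Q x)) ->
  (forall i j x y, F i x -> F j y -> mu' (phi x) (phi y) = phi (mu x y)) ->
  (forall i j k x y z, F i x -> F j y -> F k z ->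
    n' (phi x) (phi y) (phi z) = phi (n x y z)) ->
  A3_algebra F Q mu n -> A3_algebra F' Q' mu' n'.
Proof.
move=> phil F'E QE muE nE [sub dQ dmu dn lQ lmu1 lmu2 ln1 ln2 ln3 r1 r2 r3 r4 r5].
have FF i x : F i x -> F' i (phi x) by move=> Fx; apply/F'E; exists x.
have FZ i a x x' : F i x -> F i x' -> F i (a *: x + x') := (sub i).2 a x x'.
have phiB x y : phi (x - y) = phi x - phi y by rewrite (linD phil) (linN phil).
split.
- move=> i; split=> [|a y y' /F'E[x Fx ->] /F'E[x' Fx' ->]].
    by rewrite -(lin0 phil); apply: FF; exact: (sub i).1.
  by rewrite -phil; apply: FF; exact: FZ.
- by move=> i _ /F'E[x Fx ->]; rewrite (QE i) //; apply: FF; exact: dQ.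
- move=> i j _ _ /F'E[x Fx ->] /F'E[y Fy ->].
  by rewrite (muE i j) //; apply: FF; exact: dmu.
- move=> i j k _ _ _ /F'E[x Fx ->] /F'E[y Fy ->] /F'E[z Fz ->].
  by rewrite (nE i j k) //; apply: FF; exact: dn.
- move=> i a _ _ /F'E[x Fx ->] /F'E[x' Fx' ->].
  by rewrite -phil !(QE i) -?phil ?(lQ i) //; exact: FZ.
- move=> i j a _ _ _ /F'E[x Fx ->] /F'E[x' Fx' ->] /F'E[y Fy ->].
  by rewrite -phil !(muE i j) -?phil ?(lmu1 i j) //; exact: FZ.
- move=> i j a _ _ _ /F'E[x Fx ->] /F'E[y Fy ->] /F'E[y' Fy' ->].
  by rewrite -phil !(muE i j) -?phil ?(lmu2 i j) //; exact: FZ.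
- move=> i j k a _ _ _ _ /F'E[x Fx ->] /F'E[x' Fx' ->] /F'E[y Fy ->] /F'E[z Fz ->].
  by rewrite -phil !(nE i j k) -?phil ?(ln1 i j k) //; exact: FZ.
- move=> i j k a _ _ _ _ /F'E[x Fx ->] /F'E[y Fy ->] /F'E[y' Fy' ->] /F'E[z Fz ->].
  by rewrite -phil !(nE i j k) -?phil ?(ln2 i j k) //; exact: FZ.
- move=> i j k a _ _ _ _ /F'E[x Fx ->] /F'E[y Fy ->] /F'E[z Fz ->] /F'E[z' Fz' ->].
  by rewrite -phil !(nE i j k) -?phil ?(ln3 i j k) //; exact: FZ.
- move=> i _ /F'E[x Fx ->].
  by rewrite (QE i) // (QE (i + 1)) ?(r1 i) ?(lin0 phil) //; exact: dQ.
- move=> i j _ _ /F'E[x Fx ->] /F'E[y Fy ->].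
  rewrite (muE i j) // (QE (i + j)) ?(r2 i j) //; last exact: dmu.
  rewrite (QE i) // (QE j) // (muE (i + 1) j) ?(muE i (j + 1)) //; try exact: dQ.
  by rewrite (linD phil) (linZ phil).
- move=> i j k _ _ _ /F'E[x Fx ->] /F'E[y Fy ->] /F'E[z Fz ->].
  rewrite (nE i j k x y z) // (QE i x) // (QE j y) // (QE k z) //.
  rewrite (QE (i + j + k - 1)); last exact: dn.
  rewrite (nE (i + 1) j k (Q x)) //; last exact: dQ.
  rewrite (nE i (j + 1) k x (Q y)) //; last exact: dQ.
  rewrite (nE i j (k + 1) x y (Q z)) //; last exact: dQ.
  rewrite (muE i j x y) // (muE j k y z) //.
  rewrite (muE (i + j) k (mu x y)) //; last exact: dmu.
  rewrite (muE i (j + k) x (mu y z)) //; last exact: dmu.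
  by rewrite -!(linZ phil) -!(linD phil) -phiB (r3 i j k).
- move=> i j k l _ _ _ _ /F'E[x Fx ->] /F'E[y Fy ->] /F'E[z Fz ->] /F'E[w Fw ->].
  rewrite (nE j k l y z w) // (nE i j k x y z) //.
  rewrite (muE i (j + k + l - 1) x (n y z w)) //; last exact: dn.
  rewrite (muE (i + j + k - 1) l (n x y z)) //; last exact: dn.
  rewrite (muE i j x y) // (muE j k y z) // (muE k l z w) //.
  rewrite (nE (i + j) k l (mu x y)) //; last exact: dmu.
  rewrite (nE i (j + k) l x (mu y z)) //; last exact: dmu.
  rewrite (nE i j (k + l) x y (mu z w)) //; last exact: dmu.
  by rewrite -!(linZ phil) -phiB -!(linD phil) (r4 i j k l).
move=> i j k l m _ _ _ _ _ /F'E[x Fx ->] /F'E[y Fy ->]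
  /F'E[z Fz ->] /F'E[w Fw ->] /F'E[t Ft ->].
rewrite (nE i j k x y z) // (nE j k l y z w) // (nE k l m z w t) //.
rewrite (nE (i + j + k - 1) l m (n x y z)) //; last exact: dn.
rewrite (nE i (j + k + l - 1) m x (n y z w)) //; last exact: dn.
rewrite (nE i j (k + l + m - 1) x y (n z w t)) //; last exact: dn.
by rewrite -!(linZ phil) -!(linD phil) (r5 i j k l m) // (lin0 phil).
Qed.

(** * Ghost modes *)

Section GhostModes.
Variables (K : fieldType) (M : lmodType K).
Implicit Types (w : fock M) (A : M) (m n : int) (D : {fset int}).

Lemma gc_lin m : lin (@gc K M m).
Proof.
move=> a x y; apply: dsumP => D; rewrite dsumD dsumZ !gcE dsumD dsumZ.
by rewrite scalerDr !scalerA mulrC.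
Qed.

Lemma gb_lin m : lin (@gb K M m).
Proof.
move=> a x y; apply: dsumP => D; rewrite dsumD dsumZ !gbE dsumD dsumZ.
by rewrite scalerDr !scalerA mulrC.
Qed.

Lemma par_lin p : lin (@par K M p).
Proof.
move=> a x y; apply: dsumP => D; rewrite dsumD dsumZ !parE dsumD dsumZ.
by case: eqP; rewrite ?scaler0 ?addr0.
Qed.

Lemma gvac_lin : lin (@gvac K M).
Proof.
move=> a x y; apply: dsumP => D; rewrite dsumD dsumZ !dsingleE.
by case: eqP; rewrite ?scaler0 ?addr0.
Qed.

Lemma gvacE A D : gvac A D = if D == fset0 then A else 0.
Proof. exact: dsingleE. Qed.

Lemma dmap_lin (g : M -> M) : lin g -> lin (@dmap K {fset int} M g).
Proof.
move=> gl a x y; apply: dsumP => D; rewrite dsumD dsumZ !dmapE ?(lin0 gl) //.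
by rewrite -gl dsumD dsumZ.
Qed.

Lemma dmap_gc (g : M -> M) m w : lin g -> dmap g (gc m w) = gc m (dmap g w).
Proof.
move=> gl; apply: dsumP => D; rewrite gcE !dmapE ?(lin0 gl) // gcE.
by rewrite (linZ gl).
Qed.

Lemma dmap_gvac (g : M -> M) A : g 0 = 0 -> dmap g (gvac A) = gvac (g A).
Proof.
by move=> g0; apply: dsumP => D; rewrite dmapE // !dsingleE; case: eqP.
Qed.

Lemma gc_sq m w : gc m (gc m w) = 0.
Proof.
apply: dsumP => D; rewrite !gcE mem_toggle eqxx addbT.
by case: (m \in D); case: (m <= 1); rewrite ?scale0r ?scaler0.
Qed.

Lemma gcC m n w : gc m (gc n w) = - gc n (gc m w).
Proof.
have [->|mn] := eqVneq m n; first by rewrite gc_sq oppr0.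
apply: dsumP => D.
rewrite dsumN !gcE !mem_toggle (negbTE mn).
have nm : (n == m) = false by rewrite eq_sym (negbTE mn).
rewrite nm !addbF !scalerA.
rewrite (signr_below_toggle K m n D) (signr_below_toggle K n m D).
rewrite [toggle m (toggle _ D)]toggleC -scaleNr; congr (_ *: _).
case: (_ == (m <= 1)); case: (_ == (n <= 1)); rewrite ?mul0r ?mulr0 ?oppr0 //.
by case: ltgtP mn => // _ _; rewrite ?mulrN ?opprK mulrC // -mulrN.
Qed.

Lemma par_gc p m w : par p (gc m w) = gc m (par (~~ p) w).
Proof.
apply: dsumP => D; rewrite parE (gcE m w) (gcE m (par _ w)) parE.
have -> : odd #|` toggle m D| = ~~ odd #|` D|.
  rewrite /toggle; case: ifP => mD.
    by rewrite [in RHS](cardfsD1 m) mD /= negbK.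
  by rewrite cardfsU1 mD.
by rewrite (inj_eq negb_inj); case: (_ == p); rewrite ?scaler0.
Qed.

Lemma par_gvac p A : par p (gvac A) = if p then 0 else gvac A.
Proof.
apply: dsumP => D; rewrite parE.
have -> : (if p then 0 else gvac A) D = if p then 0 else gvac A D by case: p.
rewrite dsingleE.
have [->|D0] := eqVneq D fset0; first by rewrite cardfs0; case: p.
by rewrite !if_same.
Qed.

Lemma gb_gcE n m w :
  gb n (gc m w) = (if n + m == 0 then w else 0) - gc m (gb n w).
Proof. by rewrite -gb_gc addrK. Qed.

(* [gcreate j] is the operator a_j of [fock]. *)
Definition gcreate (j : int) : fock M -> fock M :=
  if j <= 1 then gc j else gb (- j).

Definition estate (s : seq int) A : fock M := foldr gcreate (gvac A) s.

(** No element of [D] lies below [j], so the sign is 1. Words built from the right in increasing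
    order are therefore the basis vectors themselves. *)
Lemma gcreate_single j D A : (forall i, i \in D -> j < i) ->
  gcreate j (dsingle D A) = dsingle (j |` D)%fset A.
Proof.
move=> jD; apply: dsumP => E.
have -> w : gcreate j w E =
    (if j \in E then (-1) ^+ below j E else 0) *: w (toggle j E).
  rewrite /gcreate; case: ifP => j1.
    by rewrite gcE j1 eqb_id.
  have j2 : (1 < j) = true by lia.
  by rewrite gbE !(opprK j) j2 eqb_id.
rewrite !dsingleE; have [->|ED] := eqVneq E (j |` D)%fset.
  have jnD : j \notin D by apply/negP => /jD; rewrite ltxx.
  rewrite !inE eqxx /= /toggle !inE eqxx /= fsetU1K // eqxx.
  rewrite /below (_ : [fset i in _ | _]%fset = fset0) ?cardfs0 ?scale1r //.
  apply/fsetP => i; rewrite !inE /=; apply/negbTE/negP => /andP[].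
  case/orP => [/eqP ->|/jD ji]; first by rewrite ltxx.
  by rewrite ltNge (ltW ji).
case: ifP => jE; last by rewrite scale0r.
case: eqP => [eD|]; last by rewrite scaler0.
by move: ED; rewrite -eD /toggle jE fsetD1K // eqxx.
Qed.

Lemma estateE s A : sorted <%R s -> estate s A = dsingle [fset x in s]%fset A.
Proof.
elim: s => [|j s ih] /=.
  by move=> _; congr dsingle; apply/fsetP => i; rewrite !inE.
move=> js; rewrite ih ?(path_sorted js) // gcreate_single.
  by congr dsingle; apply/fsetP => i; rewrite !inE.
move=> i; rewrite !inE /= => /(allP _) h.
by have /allP := order_path_min (@lt_trans _ _) js; apply; apply: h.
Qed.

Lemma sort_fset (s : seq int) : sorted <%R s ->
  sort <=%R (enum_fset [fset x in s]%fset) = s.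
Proof.
move=> ss; apply: lt_sorted_eq => //.
  by rewrite sort_lt_sorted fset_uniq.
by move=> i; rewrite mem_sort !inE.
Qed.

(** States without [b] ghosts. On them the annihilating half of a normally ordered product of [c]
    fields vanishes, which leaves creation modes only. *)
Definition cstate w : Prop := forall m, 2 <= m -> gc m w = 0.

Lemma cstate_gc m w : cstate w -> cstate (gc m w).
Proof. by move=> cw n n2; rewrite gcC cw // (lin0 (gc_lin m)) oppr0. Qed.

Lemma cstateD w w' : cstate w -> cstate w' -> cstate (w + w').
Proof. by move=> cw cw' n n2; rewrite (linD (gc_lin n)) cw // cw' // addr0. Qed.

Lemma cstate_gvac A : cstate (gvac A).
Proof. by move=> m m2; exact: gc_vac. Qed.

Lemma cstate_dmap g w : lin g -> cstate w -> cstate (dmap g w).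
Proof.
by move=> gl cw m m2; rewrite -dmap_gc // cw // (lin0 (dmap_lin gl)).
Qed.

Lemma gmode0 j n : gmode j n (0 : fock M) = 0.
Proof.
by rewrite /gmode; case: ifP => _; [exact: (lin0 (gc_lin _))|exact: (lin0 (gb_lin _))].
Qed.

Lemma gfield0 s n : gfield s n (0 : fock M) = 0.
Proof.
elim: s n => [|j s ih] n /=; first by case: eqP.
by rewrite fsbig1 // => t _; rewrite !(ih, gmode0) scaler0 addr0 scaler0.
Qed.

Lemma gfield_cons N j s n w : j <= 1 -> cstate w ->
  (forall t : nat, (N <= t)%N -> gfield s (n + t%:Z) w = 0) ->
  gfield (j :: s) n w = \sum_(t < N)
    gc (1 - (gord j + t)%N%:Z) (gfield s (n + t%:Z) w) *+ 'C(gord j + t, t).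
Proof.
move=> j1 cw h /=; rewrite (@fsum_nat _ N) => [|t tN].
  apply: eq_bigr => t _; rewrite scaler_nat; congr (_ *+ _).
  rewrite /gmode j1 cw; last by lia.
  rewrite (gfield0 s (n - (gord j + t).+1%:Z)) scaler0 addr0.
  by have -> : - (gord j + t).+1%:Z + 2 = 1 - (gord j + t)%N%:Z by lia.
rewrite h // gmode0 /gmode j1 cw; last by lia.
by rewrite (gfield0 s (n - (gord j + t).+1%:Z)) scaler0 addr0 scaler0.
Qed.

(** A product of [c] fields has no poles on a state without [b] ghosts. *)
Lemma gfield_ge0 s n w : s != [::] -> all (fun j => j <= 1) s -> cstate w ->
  0 <= n -> gfield s n w = 0.
Proof.
case: s => // j s _; elim: s j n => [|i s ih] j n /andP[j1 js] cw n0.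
  by rewrite (@gfield_cons 0) ?big_ord0 // => t _; rewrite /=; case: eqP => //; lia.
by rewrite (@gfield_cons 0) ?big_ord0 // => t _; apply: ih => //; lia.
Qed.

Lemma gfield_dmap g s n w : lin g -> all (fun j => j <= 1) s -> cstate w ->
  dmap g (gfield s n w) = gfield s n (dmap g w).
Proof.
move=> gl; elim: s n => [|j s ih] n.
  by move=> _ _ /=; case: eqP => // _; exact: (lin0 (dmap_lin gl)).
move=> /andP[j1 s1] cw.
have h w' (t : nat) : cstate w' -> (`|n|.+1 <= t)%N -> gfield s (n + t%:Z) w' = 0.
  move=> cw' tn; case: s s1 {ih} => [|i s] s1; last by apply: gfield_ge0 => //; lia.
  by rewrite /=; case: eqP => //; lia.
rewrite !(@gfield_cons `|n|.+1) //;
  try by [exact: cstate_dmap|move=> t; apply: h => //; exact: cstate_dmap].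
rewrite (big_morph _ (linD (dmap_lin gl)) (lin0 (dmap_lin gl))).
by apply: eq_bigr => t _; rewrite (linMn (dmap_lin gl)) dmap_gc // ih.
Qed.

Section CreationModes.
Variables (j : int) (s : seq int) (w : fock M).
Hypotheses (j1 : j <= 1) (s1 : all (fun j => j <= 1) s) (cw : cstate w).

Lemma gfield_consE (k : nat) : gfield (j :: s) (- k%:Z) w =
  \sum_(t < k) gc (j - t%:Z) (gfield s (t%:Z - k%:Z) w) *+ 'C(gord j + t, t).
Proof.
rewrite (@gfield_cons k) // => [|t kt].
  apply: eq_bigr => t _.
  have -> : 1 - (gord j + t)%N%:Z = j - t%:Z by rewrite /gord j1; lia.
  by rewrite [- _ + _]addrC.
case: s s1 => [|i s'] s1'; last by apply: gfield_ge0 => //; lia.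
by rewrite /=; case: eqP => //; lia.
Qed.

Lemma gfield_consN1 : gfield (j :: s) (-1) w = gc j (gfield s (-1) w).
Proof. by rewrite (gfield_consE 1) big_ord1 /= addn0 bin0 subr0; reflexivity. Qed.

Lemma gfield_consN2 : gfield (j :: s) (-2) w =
  gc j (gfield s (-2) w) + gc (j - 1) (gfield s (-1) w) *+ (gord j).+1.
Proof.
by rewrite (gfield_consE 2) !big_ord_recl big_ord0 /= [X in _ + X]addr0 addn0
  bin0 addn1 bin1 [j - 0]subr0; reflexivity.
Qed.

Lemma gfield_consN3 : gfield (j :: s) (-3) w =
  gc j (gfield s (-3) w) + gc (j - 1) (gfield s (-2) w) *+ (gord j).+1
  + gc (j - 2) (gfield s (-1) w) *+ 'C((gord j).+2, 2).
Proof.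
rewrite (gfield_consE 3) !big_ord_recl big_ord0 /= [X in _ + (_ + X)]addr0 addrA
  addn0 bin0 addn1 bin1 addn2 [j - 0]subr0; reflexivity.
Qed.

End CreationModes.

Section Tables.
Variable w : fock M.
Hypothesis cw : cstate w.

Lemma gc0 m : gc m (0 : fock M) = 0. Proof. exact: (lin0 (gc_lin m)). Qed.

Definition gfield_cons_rules := (gfield_consN1, gfield_consN2, gfield_consN3).

Lemma gfield_1 : ((gfield [:: 1] (-1) w = gc 1 w) *
  (gfield [:: 1] (-2) w = gc 0 w) * (gfield [:: 1] (-3) w = gc (-1) w))%type.
Proof. by do 2?split; rewrite gfield_cons_rules //= !gc0 ?mul0rn ?add0r ?mulr1n. Qed.

Lemma gfield_0 : ((gfield [:: 0] (-1) w = gc 0 w) *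
  (gfield [:: 0] (-2) w = gc (-1) w *+ 2))%type.
Proof. by split; rewrite gfield_cons_rules //= !gc0 ?add0r. Qed.

Lemma gfield_N1 : ((gfield [:: -1] (-1) w = gc (-1) w) *
  (gfield [:: -1] (-2) w = gc (-2) w *+ 3))%type.
Proof. by split; rewrite gfield_cons_rules //= !gc0 ?add0r. Qed.

Lemma gfield_01 : ((gfield [:: 0; 1] (-1) w = gc 0 (gc 1 w)) *
  (gfield [:: 0; 1] (-2) w = gc (-1) (gc 1 w) *+ 2) *
  (gfield [:: 0; 1] (-3) w = (gc (-1) (gc 0 w) + gc (-2) (gc 1 w) *+ 3)%R))%type.
Proof.
do 2?split; rewrite gfield_cons_rules // ?gfield_1 //; first by rewrite gc_sq add0r.
have -> : 0 - 1 = -1 :> int by [].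
have -> : 0 - 2 = -2 :> int by [].
(* The binomials are 1, 2, 3, and $c_0c_{-1}+2c_{-1}c_0=c_{-1}c_0$. *)
rewrite (gcC 0 (-1)) -[(gord 0).+1]/2%N -['C((gord 0).+2, 2)]/3%N. zmodule.
Qed.

Lemma gfield_N11 : ((gfield [:: -1; 1] (-1) w = gc (-1) (gc 1 w)) *
  (gfield [:: -1; 1] (-2) w = (gc (-1) (gc 0 w) + gc (-2) (gc 1 w) *+ 3)%R))%type.
Proof. by split; rewrite gfield_cons_rules // ?gfield_1. Qed.

Lemma gfield_N10 : gfield [:: -1; 0] (-1) w = gc (-1) (gc 0 w).
Proof. by rewrite gfield_consN1 // gfield_0. Qed.

Lemma gfield_N101 : ((gfield [:: -1; 0; 1] (-1) w = gc (-1) (gc 0 (gc 1 w))) *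
  (gfield [:: -1; 0; 1] (-2) w = gc (-2) (gc 0 (gc 1 w)) *+ 3))%type.
Proof.
split; rewrite gfield_cons_rules // ?gfield_01 //.
by rewrite (linMn (gc_lin _)) gc_sq mul0rn add0r.
Qed.

End Tables.

End GhostModes.

(** * Modes on the tensor product with the Fock module *)

Section TensorModes.
Variables (K : numFieldType) (U : lmodType K) (wt : nat -> set U) (T : voa wt).
Implicit Types (r : seq (seq int * U)) (y : fock U) (n : int).

Lemma vmode_lin A k : lin (vmode T A k).
Proof. by move=> a x y; exact: vlinr. Qed.

Lemma in_unzip1_inj (I J : eqType) (r : seq (I * J)) p q :
  uniq (unzip1 r) -> p \in r -> q \in r -> p.1 = q.1 -> p = q.
Proof.
elim: r => //= a r ih /andP[ar ur]; rewrite !inE.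
case/predU1P=> [->|pr] /predU1P[->|qr] // pq; last exact: ih.
  by case/negP: ar; rewrite pq; exact: map_f.
by case/negP: ar; rewrite -pq; exact: map_f.
Qed.

(** [tmode] reads a state through its coefficients at the basis vectors $e_D$. Increasing words are
    such basis vectors, and distinctness makes each coefficient come from a single summand. *)
Lemma tmode_estates r n y :
  uniq (unzip1 r) -> all (fun p => sorted <%R p.1) r ->
  tmode T (\sum_(p <- r) estate p.1 p.2) n y =
  \sum_(p <- r) \sum_(k \in [set: int])
    dmap (vmode T p.2 k) (gfield p.1 (n - k - 1) y).
Proof.
move=> ur /allP sr; rewrite /tmode; set x := \sum_(p <- r) estate _ _.
pose D (t : seq int) := [fset x in t]%fset.
have DI : {in unzip1 r &, injective D}.
  move=> _ _ /mapP[p pr ->] /mapP[q qr ->].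
  by move=> /(congr1 (fun E => sort <=%R (enum_fset E))); rewrite !sort_fset ?sr.
have xE E : x E = \sum_(p <- r) (if E == D p.1 then p.2 else 0).
  rewrite dsum_sum; apply: eq_big_seq => p pr.
  by rewrite (estateE _ (sr p pr)) dsingleE.
rewrite (@fsum_seq _ _ [seq D t | t <- unzip1 r]) ?(map_inj_in_uniq DI) //.
  rewrite !big_map; apply: eq_big_seq => p pr.
  suff xD : x (D p.1) = p.2 by rewrite (sort_fset (sr p pr)) xD.
  rewrite xE (bigD1_seq p) //=; last exact: map_uniq ur.
  rewrite eqxx big_seq_cond big1 ?addr0 // => q /andP[qr qp].
  case: eqP => // /DI pq; case/eqP: qp.
  by apply: (in_unzip1_inj ur qr pr); rewrite pq //; exact: map_f.
move=> E nE; suff -> : x E = 0.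
  apply: fsbig1 => k _; apply: dsumP => F.
  by rewrite dmapE ?vmode0r // vmode0l.
rewrite xE big_seq big1 // => p pr; case: eqP => // EE.
by case/mapP: nE; exists p.1 => //; exact: map_f.
Qed.

(* The terms with k < n vanish by [gfield_ge0]. *)
Lemma field_sum N s A n y : all (fun j => j <= 1) s -> cstate y ->
  (forall k, n + N%:Z <= k -> dmap (vmode T A k) y = 0) ->
  \sum_(k \in [set: int]) dmap (vmode T A k) (gfield s (n - k - 1) y) =
  \sum_(i < N) gfield s (- 1 - i%:Z) (dmap (vmode T A (n + i%:Z)) y).
Proof.
move=> s1 cy hN; have vl k := vmode_lin A k.
transitivity (\sum_(k \in [set: int])
    gfield s (n - k - 1) (dmap (vmode T A k) y)).
  by apply: eq_fsbigr => k _; rewrite gfield_dmap.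
rewrite (@fsum_int _ n (n + N%:Z)) => [|k nk].
  have -> : absz (Num.max n (n + N%:Z) - n)%R = N by lia.
  by apply: eq_bigr => i _; congr gfield; lia.
have [nk'|kn] := leP (n + N%:Z) k; first by rewrite hN // gfield0.
case: s s1 => [|j s] s1; first by rewrite /=; case: eqP => //; lia.
by apply: gfield_ge0 => //; [exact: cstate_dmap|lia].
Qed.

Lemma tmode_clight N r n y :
  uniq (unzip1 r) -> all (fun p => sorted <%R p.1) r ->
  all (fun p => all (fun j => j <= 1) p.1) r -> cstate y ->
  (forall p k, p \in r -> n + N%:Z <= k -> dmap (vmode T p.2 k) y = 0) ->
  tmode T (\sum_(p <- r) estate p.1 p.2) n y =
  \sum_(p <- r) \sum_(i < N)
    gfield p.1 (- 1 - i%:Z) (dmap (vmode T p.2 (n + i%:Z)) y).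
Proof.
move=> ur sr /allP r1 cy hN; rewrite tmode_estates //; apply: eq_big_seq => p pr.
by apply: field_sum => //; [exact: r1|move=> k; exact: hN].
Qed.

End TensorModes.

(* The identities below only involve the anticommutation relations, and are
   proved for abstract modules in order to keep [fock] from being unfolded. *)
Section AntiCommuting.
Variables (K : fieldType) (M W : lmodType K).
Variables (v : M -> W) (c b : int -> W -> W).
Hypotheses (v_lin : lin v) (c_lin : forall m, lin (c m)).
Hypothesis cC : forall m n w, c m (c n w) = - c n (c m w).
Hypothesis c_sq : forall m w, c m (c m w) = 0.

Let linrules := ((fun m => linD (c_lin m)), (fun m => linN (c_lin m)),
  (fun m => linMn (c_lin m)), (fun m => lin0 (c_lin m)), linE v_lin).

Let order := (cC 0 1, cC (-1) 1, cC (-1) 0, cC (-2) 1, cC (-2) 0, cC (-2) (-1)).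

Let c_sq2 m n w : c m (c n (c m w)) = 0.
Proof. by rewrite cC c_sq (lin0 (c_lin n)) oppr0. Qed.

(* For [M] without negative weights these are the states of weight 0, [x2] and
   [x3] being the coefficients of c_1 c_(-1) = (c partial^2 c) / 2 and of
   c_1 c_0 c_(-1). *)
Definition cwords (x0 X1 x1 X2 x2 x3 : M) : W :=
  v x0 + c 1 (v X1) + c 0 (v x1) + c 1 (c 0 (v X2)) + c 1 (c (-1) (v x2))
  + c 1 (c 0 (c (-1) (v x3))).

Lemma cwordsD x0 X1 x1 X2 x2 x3 y0 Y1 y1 Y2 y2 y3 :
  cwords x0 X1 x1 X2 x2 x3 + cwords y0 Y1 y1 Y2 y2 y3 =
  cwords (x0 + y0) (X1 + Y1) (x1 + y1) (X2 + Y2) (x2 + y2) (x3 + y3).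
Proof. by rewrite /cwords ?linrules; zmodule. Qed.

Lemma cwordsZ a x0 X1 x1 X2 x2 x3 : a *: cwords x0 X1 x1 X2 x2 x3 =
  cwords (a *: x0) (a *: X1) (a *: x1) (a *: X2) (a *: x2) (a *: x3).
Proof.
by rewrite /cwords !scalerDr -!(linZ (c_lin _)) -!(linZ v_lin).
Qed.

Lemma cwords0 : cwords 0 0 0 0 0 0 = 0.
Proof. by rewrite /cwords ?linrules; zmodule. Qed.

Lemma cwords_sum N (x0 X1 x1 X2 x2 x3 : nat -> M) :
  \sum_(j < N) cwords (x0 j) (X1 j) (x1 j) (X2 j) (x2 j) (x3 j) =
  cwords (\sum_(j < N) x0 j) (\sum_(j < N) X1 j) (\sum_(j < N) x1 j)
    (\sum_(j < N) X2 j) (\sum_(j < N) x2 j) (\sum_(j < N) x3 j).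
Proof.
elim: N => [|N ih]; first by rewrite !big_ord0 cwords0.
by rewrite big_ord_recr /= ih cwordsD !big_ord_recr.
Qed.

Lemma cwords_deg0 x : cwords x 0 0 0 0 0 = v x.
Proof. by rewrite /cwords ?linrules; zmodule. Qed.

Lemma cwords_deg1 X x : cwords 0 X x 0 0 0 = c 1 (v X) + c 0 (v x).
Proof. by rewrite /cwords ?linrules; zmodule. Qed.

Lemma cwords_deg2 X x :
  cwords 0 0 0 X x 0 = c 1 (c 0 (v X)) + c 1 (c (-1) (v x)).
Proof. by rewrite /cwords ?linrules; zmodule. Qed.

Lemma cwords_deg3 x : cwords 0 0 0 0 0 x = c 1 (c 0 (c (-1) (v x))).
Proof. by rewrite /cwords ?linrules; zmodule. Qed.

(** The signs come from sorting the ghosts increasingly, as in $e_D$. The right-nested sum ending in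
    0 is the form that [big_cons] and [big_nil] produce in [clight_estates]. *)
Lemma cwords_increasing x0 X1 x1 X2 x2 x3 : cwords x0 X1 x1 X2 x2 x3 =
  v x0 + (c 1 (v X1) + (c 0 (v x1) + (c 0 (c 1 (v (- X2)))
  + (c (-1) (c 1 (v (- x2))) + (c (-1) (c 0 (c 1 (v (- x3)))) + 0))))).
Proof. by rewrite /cwords ?(order, linrules); zmodule. Qed.

Lemma cwords_morph (f : W -> W) (g : M -> M) x0 X1 x1 X2 x2 x3 :
  (forall w w', f (w + w') = f w + f w') -> (forall m w, f (c m w) = c m (f w)) ->
  (forall A, f (v A) = v (g A)) ->
  f (cwords x0 X1 x1 X2 x2 x3) =
  cwords (g x0) (g X1) (g x1) (g X2) (g x2) (g x3).
Proof. by move=> fD fc fv; rewrite /cwords !(fD, fc, fv). Qed.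

Lemma cwords_parity (f : bool -> W -> W) p x0 X1 x1 X2 x2 x3 :
  (forall p w w', f p (w + w') = f p w + f p w') ->
  (forall p m w, f p (c m w) = c m (f (~~ p) w)) ->
  (forall p A, f p (v A) = if p then 0 else v A) ->
  f p (cwords x0 X1 x1 X2 x2 x3) =
  if p then cwords 0 X1 x1 0 0 x3 else cwords x0 0 0 X2 x2 0.
Proof.
move=> fD fc fv; rewrite /cwords !(fD, fc, fv) !negbK.
by case: p; rewrite /= ?linrules.
Qed.

Lemma cwords_ind (P : W -> Prop) x0 X1 x1 X2 x2 x3 :
  (forall w w', P w -> P w' -> P (w + w')) -> (forall m w, P w -> P (c m w)) ->
  (forall A, P (v A)) -> P (cwords x0 X1 x1 X2 x2 x3).
Proof. by move=> PD Pc Pv; rewrite /cwords; repeat first [apply PD | apply Pc | apply Pv]. Qed.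

Let reorder := (c_sq, c_sq2, linrules, order).

(** The six groups on the left are the contributions of the six words of the left factor. Every
    $c_{-2}$ is accompanied by $c_1$ and acts on words that start with $c_1$, so it disappears and
    the result is again of the form [cwords]. *)
Lemma words_mode_N1 p0 P1 p1 P2 p2 p3 a0 A1 a1 A2 a2 a3 b0 B1 b1 B2 b2 b3 C1 C2
    d0 D1 d1 D2 d2 d3 E1 E2 f0 F1 f1 F2 f2 f3 g0 G1 g1 G2 g2 g3 H1 H2
    i0 I1 i1 I2 i2 i3 J1 J2 k0 K1 k1 K2 k2 k3 L1 L2 :
  cwords p0 P1 p1 P2 p2 p3
  + (c 1 (cwords a0 A1 a1 A2 a2 a3) + c 0 (cwords b0 B1 b1 B2 b2 b3)
     + c (-1) (cwords 0 C1 0 C2 0 0))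
  + (c 0 (cwords d0 D1 d1 D2 d2 d3) + c (-1) (cwords 0 E1 0 E2 0 0) *+ 2)
  + (c 0 (c 1 (cwords f0 F1 f1 F2 f2 f3))
     + c (-1) (c 1 (cwords g0 G1 g1 G2 g2 g3)) *+ 2
     + (c (-1) (c 0 (cwords 0 H1 0 H2 0 0))
        + c (-2) (c 1 (cwords 0 H1 0 H2 0 0)) *+ 3))
  + (c (-1) (c 1 (cwords i0 I1 i1 I2 i2 i3))
     + (c (-1) (c 0 (cwords 0 J1 0 J2 0 0))
        + c (-2) (c 1 (cwords 0 J1 0 J2 0 0)) *+ 3))
  + (c (-1) (c 0 (c 1 (cwords k0 K1 k1 K2 k2 k3)))
     + c (-2) (c 0 (c 1 (cwords 0 L1 0 L2 0 0))) *+ 3) =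
  cwords p0 (P1 + a0) (p1 + b0 + d0) (P2 + a1 - B1 - D1 - f0)
    (p2 - C1 - E1 *+ 2 - g0 *+ 2 - i0)
    (p3 - b2 + C2 - d2 + E2 *+ 2 + g1 *+ 2 - H1 + i1 - J1 - k0).
Proof. by rewrite /cwords ?reorder; zmodule. Qed.

Lemma words_mode_0 a1 a2 b0 B1 b1 B2 b2 b3 C1 C2 D1 D2 e0 E1 e1 E2 e2 e3 F1 F2
    G1 G2 H1 H2 :
  cwords 0 a1 0 a2 0 0
  + (c 1 (cwords b0 B1 b1 B2 b2 b3) + c 0 (cwords 0 C1 0 C2 0 0))
  + c 0 (cwords 0 D1 0 D2 0 0)
  + (c 0 (c 1 (cwords e0 E1 e1 E2 e2 e3))
     + c (-1) (c 1 (cwords 0 F1 0 F2 0 0)) *+ 2)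
  + c (-1) (c 1 (cwords 0 G1 0 G2 0 0))
  + c (-1) (c 0 (c 1 (cwords 0 H1 0 H2 0 0))) =
  cwords 0 (a1 + b0) 0 (a2 + b1 - C1 - D1 - e0) 0 0.
Proof. by rewrite /cwords ?reorder; zmodule. Qed.

Lemma words_mode_1 C1 C2 F1 F2 :
  c 1 (cwords 0 C1 0 C2 0 0) + c 0 (c 1 (cwords 0 F1 0 F2 0 0)) = 0.
Proof. by rewrite /cwords ?reorder; zmodule. Qed.

Lemma words_mode_bN1 p1 q1 p2 q2 r2 s2 p3 q3 p4 q4 :
  cwords 0 p1 0 q1 0 0
  + (c 0 (cwords 0 p2 0 q2 0 0) + c (-1) (cwords 0 r2 0 s2 0 0) *+ 2)
  + c (-1) (cwords 0 p3 0 q3 0 0) + c (-1) (c 0 (cwords 0 p4 0 q4 0 0)) =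
  cwords 0 p1 0 (q1 - p2) (- (r2 *+ 2) - p3) (s2 *+ 2 + q3 - p4).
Proof. by rewrite /cwords ?reorder; zmodule. Qed.

Lemma words_conf p0 P1 p1 P2 p2 p3 X1 X2 l1 l2 :
  c 1 (cwords p0 P1 p1 P2 p2 p3) + c 0 (cwords 0 X1 0 X2 0 0)
  + c (-1) (cwords 0 l1 0 l2 0 0) = cwords 0 p0 0 (p1 - X1) (- l1) l2.
Proof. by rewrite /cwords ?reorder; zmodule. Qed.

Section Annihilation.
Hypothesis b_lin : forall m, lin (b m).
Hypothesis b_c : forall m n w, b m (c n w) = (if m + n == 0 then w else 0) - c n (b m w).
Hypothesis b_vac : forall m A, -1 <= m -> b m (v A) = 0.

Let b_c_eq m n w : m + n = 0 -> b m (c n w) = w - c n (b m w).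
Proof. by move=> mn; rewrite b_c mn eqxx. Qed.

Let b_c_neq m n w : m + n != 0 -> b m (c n w) = - c n (b m w).
Proof. by move=> mn; rewrite b_c (negbTE mn) add0r. Qed.

Let blinrules := ((fun m => linD (b_lin m)), (fun m => linN (b_lin m)),
  (fun m => linMn (b_lin m)), (fun m => lin0 (b_lin m))).

Let b_rules := (@b_c_eq (-1) 1 ^~ erefl, @b_c_eq 0 0 ^~ erefl, @b_c_eq 1 (-1) ^~ erefl,
  @b_c_neq (-1) 0 ^~ isT, @b_c_neq (-1) (-1) ^~ isT, @b_c_neq 0 1 ^~ isT,
  @b_c_neq 0 (-1) ^~ isT, @b_c_neq 1 1 ^~ isT, @b_c_neq 1 0 ^~ isT,
  @b_vac (-1) ^~ isT, @b_vac 0 ^~ isT, @b_vac 1 ^~ isT).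

(** $b_{-1}$ acts as the derivative with respect to $c_1$, so only the words with $c_1$ contribute;
    sorting $c_0c_{-1}$ produces the sign of [x3]. *)
Lemma bN1_cwords x0 X1 x1 X2 x2 x3 : b (-1) (cwords x0 X1 x1 X2 x2 x3) =
  v X1 + (c 0 (v X2) + (c (-1) (v x2) + (c (-1) (c 0 (v (- x3))) + 0))).
Proof.
rewrite /cwords ?(blinrules, b_rules, linrules, order); zmodule.
Qed.

Lemma b_cwords_ge2 x0 X1 x1 X2 x2 x3 m : 2 <= m ->
  b m (cwords x0 X1 x1 X2 x2 x3) = 0.
Proof.
move=> m2; have bv A : b m (v A) = 0 by apply: b_vac; lia.
have bc n w : -1 <= n -> b m (c n w) = - c n (b m w) by move=> h; apply: b_c_neq; lia.
rewrite /cwords ?blinrules !(bc 1) // !(bc 0) // !(bc (-1)) // !bv ?linrules.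
by zmodule.
Qed.

(** The left side is the expansion, found in [gfield_ccb], of the residue of ${:}\partial
    c\,c\,b{:}$. *)
Lemma ghost_brst x0 X1 x1 X2 x2 x3 : let w := cwords x0 X1 x1 X2 x2 x3 in
  c 0 (c 1 (b (-1) w)) + c 0 (c (-1) (b 1 w))
  + (c (-1) (c 1 (b 0 w)) + c (-1) (c 0 (b 1 w))) *+ 2
  + c (-2) (c 1 (b 1 w)) *+ 3 =
  - cwords 0 0 0 X1 (x1 *+ 2) 0.
Proof.
rewrite /cwords /= ?(blinrules, b_rules, linrules).
rewrite ?(c_sq, c_sq2, linrules, order); zmodule.
Qed.

End Annihilation.
End AntiCommuting.

#[local] Opaque gc gb gvac dmap par.

(** * Weight-zero words in the Fock module *)

Section GhostStates.
Variables (K : fieldType) (M : lmodType K).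
Local Notation clight := (cwords (@gvac K M) (@gc K M)).

Lemma cstate_clight x0 X1 x1 X2 x2 x3 : cstate (clight x0 X1 x1 X2 x2 x3).
Proof.
by apply: cwords_ind; [exact: cstateD|exact: cstate_gc|exact: cstate_gvac].
Qed.

Lemma dmap_clight g x0 X1 x1 X2 x2 x3 : lin g ->
  dmap g (clight x0 X1 x1 X2 x2 x3) =
  clight (g x0) (g X1) (g x1) (g X2) (g x2) (g x3).
Proof.
move=> gl; apply: cwords_morph; first exact: (linD (dmap_lin gl)).
  by move=> m w; exact: dmap_gc.
by move=> A; apply: dmap_gvac; exact: lin0 gl.
Qed.

Lemma par_clight p x0 X1 x1 X2 x2 x3 :
  par p (clight x0 X1 x1 X2 x2 x3) =
  if p then clight 0 X1 x1 0 0 x3 else clight x0 0 0 X2 x2 0.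
Proof.
apply: (cwords_parity (@gvac_lin K M) (@gc_lin K M)).
- by move=> q; exact: (linD (par_lin q)).
- by move=> q m w; exact: par_gc.
by move=> q A; exact: par_gvac.
Qed.

Lemma clight_estates x0 X1 x1 X2 x2 x3 : clight x0 X1 x1 X2 x2 x3 =
  \sum_(p <- [:: ([::], x0); ([:: 1], X1); ([:: 0], x1); ([:: 0; 1], - X2);
                 ([:: -1; 1], - x2); ([:: -1; 0; 1], - x3)]) estate p.1 p.2.
Proof.
rewrite 6!big_cons big_nil.
exact: (cwords_increasing (@gvac_lin K M) (@gc_lin K M) (@gcC K M)).
Qed.

Lemma gbN1_clight x0 X1 x1 X2 x2 x3 : gb (-1) (clight x0 X1 x1 X2 x2 x3) =
  \sum_(p <- [:: ([::], X1); ([:: 0], X2); ([:: -1], x2); ([:: -1; 0], - x3)])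
    estate p.1 p.2.
Proof.
rewrite 4!big_cons big_nil.
exact: (bN1_cwords (@gvac_lin K M) (@gc_lin K M) (@gcC K M) (@gb_lin K M)
  (@gb_gcE K M) (@gb_vac K M)).
Qed.

Lemma gfield_nil (w : fock M) : ((gfield [::] (-1) w = w) *
  (gfield [::] (-2) w = 0) * (gfield [::] (-3) w = 0))%type.
Proof. by []. Qed.

Lemma gfield_b (w : fock M) (n : nat) : gfield [:: 2] n%:Z w = gb (n%:Z - 1) w.
Proof.
have E (t : nat) : (n%:Z - (gord 2 + t).+1%:Z == -1) = (t == n).
  by rewrite -[gord 2]/0%N; apply/eqP/eqP; lia.
rewrite /= (@fsum_seq _ _ [:: n]) => [| //|t]; last first.
  by rewrite inE E => /negbTE ->; rewrite gmode0 scaler0 addr0 scaler0.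
by rewrite big_seq1 binn scale1r E eqxx gmode0 add0r expr0 scale1r.
Qed.

Section Brst.
Variable w : fock M.
Hypotheses (cw : cstate w) (bw : forall m, 2 <= m -> gb m w = 0).

Lemma gfield_cb (n : nat) : gfield [:: 1; 2] n%:Z w =
  gc 1 (gb (n%:Z - 1) w) + gc 0 (gb n%:Z w) + gc (-1) (gb (n%:Z + 1) w).
Proof.
rewrite (@gfield_cons _ _ 3) // => [|t t3]; last first.
  by rewrite -PoszD gfield_b bw //; lia.
pose F (t : nat) := gc (1 - t%:Z) (gb (n%:Z + t%:Z - 1) w).
transitivity (\sum_(t < 3) F t).
  by apply: eq_bigr => t _; rewrite -PoszD gfield_b binn -[gord 1]/0%N.
have F0 : F 0%N = gc 1 (gb (n%:Z - 1) w) by rewrite /F subr0 addr0.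
have F1 : F 1%N = gc 0 (gb n%:Z w) by rewrite /F subrr addrK.
have F2 : F 2%N = gc (-1) (gb (n%:Z + 1) w).
  rewrite /F; have -> : n%:Z + 2%:Z - 1 = n%:Z + 1 by lia.
  by have -> : 1 - 2%:Z = -1 by lia.
by rewrite (big_ord3 F) F0 F1 F2.
Qed.

Lemma gfield_ccb : gfield [:: 0; 1; 2] 0 w =
  gc 0 (gc 1 (gb (-1) w)) + gc 0 (gc (-1) (gb 1 w))
  + (gc (-1) (gc 1 (gb 0 w)) + gc (-1) (gc 0 (gb 1 w))) *+ 2
  + gc (-2) (gc 1 (gb 1 w)) *+ 3.
Proof.
rewrite (@gfield_cons _ _ 3) // => [|t t3]; last first.
  by rewrite add0r gfield_cb 3?bw ?gc0 ?addr0 //; lia.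
pose F (t : nat) := gc (- t%:Z) (gfield [:: 1; 2] t%:Z w) *+ t.+1.
transitivity (\sum_(t < 3) F t).
  apply: eq_bigr => t _; rewrite add0r -[gord 0]/1%N add1n binSn /F.
  by have -> : 1 - t.+1%:Z = - t%:Z by lia.
have F0 : F 0%N = gc 0 (gc 1 (gb (-1) w)) + gc 0 (gc (-1) (gb 1 w)).
  rewrite /F oppr0 gfield_cb sub0r add0r mulr1n (linD (gc_lin 0)).
  by rewrite (linD (gc_lin 0) (gc 1 _)) gc_sq addr0.
have F1 : F 1%N = (gc (-1) (gc 1 (gb 0 w)) + gc (-1) (gc 0 (gb 1 w))) *+ 2.
  rewrite /F gfield_cb subrr (bw (m := 1%:Z + 1)) // (gc0 _ (-1)) addr0.
  by rewrite (linD (gc_lin (-1))).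
have F2 : F 2%N = gc (-2) (gc 1 (gb 1 w)) *+ 3.
  rewrite /F gfield_cb (bw (m := 2%:Z)) // (bw (m := 2%:Z + 1)) // !gc0 !addr0.
  by have -> : 2%:Z - 1 = 1 by lia.
by rewrite (big_ord3 F) F0 F1 F2.
Qed.

End Brst.

Lemma gfield_ccb_clight x0 X1 x1 X2 x2 x3 :
  gfield [:: 0; 1; 2] 0 (clight x0 X1 x1 X2 x2 x3) =
  - clight 0 0 0 X1 (x1 *+ 2) 0.
Proof.
rewrite gfield_ccb; last 2 first.
- exact: cstate_clight.
- move=> m m2; exact: (b_cwords_ge2 (@gc_lin K M) (@gb_lin K M) (@gb_gcE K M)
    (@gb_vac K M) _ _ _ _ _ _ m2).
exact: (ghost_brst (@gvac_lin K M) (@gc_lin K M) (@gcC K M) (@gc_sq K M)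
  (@gb_lin K M) (@gb_gcE K M) (@gb_vac K M)).
Qed.

End GhostStates.

(** * Exact formulas for the operations on states of weight zero *)

Section LightOperations.
Variables (K : numFieldType) (U : lmodType K) (wt : nat -> set U) (T : voa wt).
Local Notation vm := (vmode T).
Local Notation clight := (cwords (@gvac K U) (@gc K U)).

Section Modes.
Variables y0 Y1 y1 Y2 y2 y3 : U.
Hypotheses (wy0 : wt 0 y0) (wY1 : wt 1 Y1) (wy1 : wt 0 y1) (wY2 : wt 1 Y2)
  (wy2 : wt 0 y2) (wy3 : wt 0 y3).
Local Notation y := (clight y0 Y1 y1 Y2 y2 y3).

Lemma dmap_vmode A k : dmap (vm A k) y =
  clight (vm A k y0) (vm A k Y1) (vm A k y1) (vm A k Y2) (vm A k y2) (vm A k y3).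
Proof. exact: (dmap_clight _ _ _ _ _ _ (vmode_lin T A k)). Qed.

Lemma dmap_wt0_0 a : wt 0 a -> dmap (vm a 0) y = clight 0 (vm a 0 Y1) 0 (vm a 0 Y2) 0 0.
Proof.
move=> wa; rewrite dmap_vmode.
by rewrite (mode00_ge0 T wa wy0 (lexx 0)) (mode00_ge0 T wa wy1 (lexx 0))
  (mode00_ge0 T wa wy2 (lexx 0)) (mode00_ge0 T wa wy3 (lexx 0)).
Qed.

Lemma dmap_wt0_gt0 a k : wt 0 a -> 0 < k -> dmap (vm a k) y = 0.
Proof.
move=> wa k0; have k0' := ltW k0; rewrite dmap_vmode.
rewrite (mode00_ge0 T wa wy0 k0') (mode00_ge0 T wa wy1 k0')
  (mode00_ge0 T wa wy2 k0') (mode00_ge0 T wa wy3 k0')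
  (mode01_gt0 T wa wY1 k0) (mode01_gt0 T wa wY2 k0).
exact: (cwords0 (@gvac_lin K U) (@gc_lin K U)).
Qed.

Lemma dmap_wt1_1 A : wt 1 A -> dmap (vm A 1) y = clight 0 (vm A 1 Y1) 0 (vm A 1 Y2) 0 0.
Proof.
move=> wA; rewrite dmap_vmode.
by rewrite (mode10_gt0 T wy0 wA ltr01) (mode10_gt0 T wy1 wA ltr01)
  (mode10_gt0 T wy2 wA ltr01) (mode10_gt0 T wy3 wA ltr01).
Qed.

Lemma dmap_wt1_gt1 A k : wt 1 A -> 1 < k -> dmap (vm A k) y = 0.
Proof.
move=> wA k1; have k0 : 0 < k by lia.
rewrite dmap_vmode (mode10_gt0 T wy0 wA k0) (mode10_gt0 T wy1 wA k0).
rewrite (mode10_gt0 T wy2 wA k0) (mode10_gt0 T wy3 wA k0)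
  (mode11_gt1 T wA wY1 k1) (mode11_gt1 T wA wY2 k1).
exact: (cwords0 (@gvac_lin K U) (@gc_lin K U)).
Qed.

(** The part of total mode $-1$ that can be nonzero: $A_k$ pairs with the ghost mode $-2-k$, and a
    state $A$ of weight at most 1 has $A_k=0$ on [y] for $k\ge2$, while ghost modes $\ge0$ vanish.
    [modes2] is the analogue for total mode 0. *)
Definition modes3 (s : seq int) A : fock U :=
  gfield s (-1) (dmap (vm A (-1)) y) + gfield s (-2) (dmap (vm A 0) y)
  + gfield s (-3) (dmap (vm A 1) y).

Definition modes2 (s : seq int) A : fock U :=
  gfield s (-1) (dmap (vm A 0) y) + gfield s (-2) (dmap (vm A 1) y).

Local Notation cs := (cstate_clight _ _ _ _ _ _).

Lemma modes3_nil a : modes3 [::] a = clight (vm a (-1) y0) (vm a (-1) Y1)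
  (vm a (-1) y1) (vm a (-1) Y2) (vm a (-1) y2) (vm a (-1) y3).
Proof.
by rewrite /modes3 3!gfield_nil addr0 addr0 dmap_vmode.
Qed.

Lemma modes3_1 A : wt 1 A -> modes3 [:: 1] A =
  gc 1 (clight (vm A (-1) y0) (vm A (-1) Y1) (vm A (-1) y1) (vm A (-1) Y2)
    (vm A (-1) y2) (vm A (-1) y3))
  + gc 0 (clight (vm A 0 y0) (vm A 0 Y1) (vm A 0 y1) (vm A 0 Y2)
    (vm A 0 y2) (vm A 0 y3))
  + gc (-1) (clight 0 (vm A 1 Y1) 0 (vm A 1 Y2) 0 0).
Proof.
move=> wA; rewrite /modes3 (dmap_wt1_1 wA) (dmap_vmode A (-1)) (dmap_vmode A 0).
by rewrite 3!(gfield_1 cs).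
Qed.

Lemma modes3_0 a : wt 0 a -> modes3 [:: 0] a =
  gc 0 (clight (vm a (-1) y0) (vm a (-1) Y1) (vm a (-1) y1) (vm a (-1) Y2)
    (vm a (-1) y2) (vm a (-1) y3))
  + gc (-1) (clight 0 (vm a 0 Y1) 0 (vm a 0 Y2) 0 0) *+ 2.
Proof.
move=> wa; rewrite /modes3 (dmap_wt0_gt0 wa ltr01) (dmap_wt0_0 wa).
by rewrite (dmap_vmode a (-1)) (gfield0 _ [:: 0] (-3)) addr0 2!(gfield_0 cs).
Qed.

Lemma modes3_01 A : wt 1 A -> modes3 [:: 0; 1] A =
  gc 0 (gc 1 (clight (vm A (-1) y0) (vm A (-1) Y1) (vm A (-1) y1) (vm A (-1) Y2)
    (vm A (-1) y2) (vm A (-1) y3)))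
  + gc (-1) (gc 1 (clight (vm A 0 y0) (vm A 0 Y1) (vm A 0 y1) (vm A 0 Y2)
    (vm A 0 y2) (vm A 0 y3))) *+ 2
  + (gc (-1) (gc 0 (clight 0 (vm A 1 Y1) 0 (vm A 1 Y2) 0 0))
     + gc (-2) (gc 1 (clight 0 (vm A 1 Y1) 0 (vm A 1 Y2) 0 0)) *+ 3).
Proof.
move=> wA; rewrite /modes3 (dmap_wt1_1 wA) (dmap_vmode A (-1)) (dmap_vmode A 0).
by rewrite 3!(gfield_01 cs).
Qed.

Lemma modes3_N11 a : wt 0 a -> modes3 [:: -1; 1] a =
  gc (-1) (gc 1 (clight (vm a (-1) y0) (vm a (-1) Y1) (vm a (-1) y1)
    (vm a (-1) Y2) (vm a (-1) y2) (vm a (-1) y3)))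
  + (gc (-1) (gc 0 (clight 0 (vm a 0 Y1) 0 (vm a 0 Y2) 0 0))
     + gc (-2) (gc 1 (clight 0 (vm a 0 Y1) 0 (vm a 0 Y2) 0 0)) *+ 3).
Proof.
move=> wa; rewrite /modes3 (dmap_wt0_gt0 wa ltr01) (dmap_wt0_0 wa).
by rewrite (dmap_vmode a (-1)) (gfield0 _ [:: -1; 1] (-3)) addr0 2!(gfield_N11 cs).
Qed.

Lemma modes3_N101 a : wt 0 a -> modes3 [:: -1; 0; 1] a =
  gc (-1) (gc 0 (gc 1 (clight (vm a (-1) y0) (vm a (-1) Y1) (vm a (-1) y1)
    (vm a (-1) Y2) (vm a (-1) y2) (vm a (-1) y3))))
  + gc (-2) (gc 0 (gc 1 (clight 0 (vm a 0 Y1) 0 (vm a 0 Y2) 0 0))) *+ 3.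
Proof.
move=> wa; rewrite /modes3 (dmap_wt0_gt0 wa ltr01) (dmap_wt0_0 wa).
by rewrite (dmap_vmode a (-1)) (gfield0 _ [:: -1; 0; 1] (-3)) addr0 2!(gfield_N101 cs).
Qed.

Lemma modes2_nil a : wt 0 a ->
  modes2 [::] a = clight 0 (vm a 0 Y1) 0 (vm a 0 Y2) 0 0.
Proof.
by move=> wa; rewrite /modes2 2!gfield_nil addr0 (dmap_wt0_0 wa).
Qed.

Lemma modes2_1 A : wt 1 A -> modes2 [:: 1] A =
  gc 1 (clight (vm A 0 y0) (vm A 0 Y1) (vm A 0 y1) (vm A 0 Y2)
    (vm A 0 y2) (vm A 0 y3))
  + gc 0 (clight 0 (vm A 1 Y1) 0 (vm A 1 Y2) 0 0).
Proof.
move=> wA; rewrite /modes2 (dmap_wt1_1 wA) (dmap_vmode A 0).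
by rewrite 2!(gfield_1 cs).
Qed.

Lemma modes2_0 a : wt 0 a -> modes2 [:: 0] a =
  gc 0 (clight 0 (vm a 0 Y1) 0 (vm a 0 Y2) 0 0).
Proof.
move=> wa; rewrite /modes2 (dmap_wt0_gt0 wa ltr01) (dmap_wt0_0 wa).
by rewrite (gfield0 _ [:: 0] (-2)) addr0 (gfield_0 cs).
Qed.

Lemma modes2_01 A : wt 1 A -> modes2 [:: 0; 1] A =
  gc 0 (gc 1 (clight (vm A 0 y0) (vm A 0 Y1) (vm A 0 y1) (vm A 0 Y2)
    (vm A 0 y2) (vm A 0 y3)))
  + gc (-1) (gc 1 (clight 0 (vm A 1 Y1) 0 (vm A 1 Y2) 0 0)) *+ 2.
Proof.
move=> wA; rewrite /modes2 (dmap_wt1_1 wA) (dmap_vmode A 0).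
by rewrite 2!(gfield_01 cs).
Qed.

Lemma modes2_N11 a : wt 0 a -> modes2 [:: -1; 1] a =
  gc (-1) (gc 1 (clight 0 (vm a 0 Y1) 0 (vm a 0 Y2) 0 0)).
Proof.
move=> wa; rewrite /modes2 (dmap_wt0_gt0 wa ltr01) (dmap_wt0_0 wa).
by rewrite (gfield0 _ [:: -1; 1] (-2)) addr0 (gfield_N11 cs).
Qed.

Lemma modes2_N101 a : wt 0 a -> modes2 [:: -1; 0; 1] a =
  gc (-1) (gc 0 (gc 1 (clight 0 (vm a 0 Y1) 0 (vm a 0 Y2) 0 0))).
Proof.
move=> wa; rewrite /modes2 (dmap_wt0_gt0 wa ltr01) (dmap_wt0_0 wa).
by rewrite (gfield0 _ [:: -1; 0; 1] (-2)) addr0 (gfield_N101 cs).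
Qed.

End Modes.
End LightOperations.

Lemma big_pair6 (I J : Type) (M : nmodType) (F : I -> J -> M) i1 i2 i3 i4 i5 i6
    j1 j2 j3 j4 j5 j6 :
  \sum_(p <- [:: (i1, j1); (i2, j2); (i3, j3); (i4, j4); (i5, j5); (i6, j6)])
    F p.1 p.2 =
  F i1 j1 + F i2 j2 + F i3 j3 + F i4 j4 + F i5 j5 + F i6 j6.
Proof. by rewrite !big_cons big_nil addr0 !addrA. Qed.

Lemma big_pair4 (I J : Type) (M : nmodType) (F : I -> J -> M) i1 i2 i3 i4
    j1 j2 j3 j4 :
  \sum_(p <- [:: (i1, j1); (i2, j2); (i3, j3); (i4, j4)]) F p.1 p.2 =
  F i1 j1 + F i2 j2 + F i3 j3 + F i4 j4.
Proof. by rewrite !big_cons big_nil addr0 !addrA. Qed.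

Lemma big_pair3 (I J : Type) (M : nmodType) (F : I -> J -> M) i1 i2 i3 j1 j2 j3 :
  \sum_(p <- [:: (i1, j1); (i2, j2); (i3, j3)]) F p.1 p.2 =
  F i1 j1 + F i2 j2 + F i3 j3.
Proof. by rewrite !big_cons big_nil addr0 !addrA. Qed.

Section LightOperations.
Variables (K : numFieldType) (U : lmodType K) (wt : nat -> set U) (T : voa wt).
Local Notation vm := (vmode T).
Local Notation clight := (cwords (@gvac K U) (@gc K U)).

Section Left.
Variables y0 Y1 y1 Y2 y2 y3 : U.
Hypotheses (wy0 : wt 0 y0) (wY1 : wt 1 Y1) (wy1 : wt 0 y1) (wY2 : wt 1 Y2)
  (wy2 : wt 0 y2) (wy3 : wt 0 y3).
Local Notation y := (clight y0 Y1 y1 Y2 y2 y3).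

Lemma dmap_vmode_gt1 A k : wt 0 A \/ wt 1 A -> 1 < k -> dmap (vm A k) y = 0.
Proof.
case=> wA k1; last exact: dmap_wt1_gt1.
by apply: dmap_wt0_gt0 => //; lia.
Qed.

Section Modes.
Variable r : seq (seq int * U).
Hypotheses (ur : uniq (unzip1 r)) (sr : all (fun p => sorted <%R p.1) r)
  (r1 : all (fun p => all (fun j => j <= 1) p.1) r)
  (wr : forall p, p \in r -> wt 0 p.2 \/ wt 1 p.2).

Lemma tmode_N1_modes3 : tmode T (\sum_(p <- r) estate p.1 p.2) (-1) y =
  \sum_(p <- r) modes3 T y0 Y1 y1 Y2 y2 y3 p.1 p.2.
Proof.
rewrite (@tmode_clight _ _ _ _ 3) //; last 2 first.
- exact: cstate_clight.
- by move=> p k pr k1; apply: dmap_vmode_gt1; [exact: wr|lia].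
apply: eq_bigr => p _.
exact: (big_ord3 (fun i => gfield p.1 (- 1 - i%:Z) (dmap (vm p.2 (- 1 + i%:Z)) y))).
Qed.

Lemma tmode_0_modes2 : tmode T (\sum_(p <- r) estate p.1 p.2) 0 y =
  \sum_(p <- r) modes2 T y0 Y1 y1 Y2 y2 y3 p.1 p.2.
Proof.
rewrite (@tmode_clight _ _ _ _ 2) //; last 2 first.
- exact: cstate_clight.
- by move=> p k pr k1; apply: dmap_vmode_gt1; [exact: wr|lia].
apply: eq_bigr => p _.
exact: (big_ord2 (fun i => gfield p.1 (- 1 - i%:Z) (dmap (vm p.2 (0 + i%:Z)) y))).
Qed.

Lemma tmode_1_modes1 : tmode T (\sum_(p <- r) estate p.1 p.2) 1 y =
  \sum_(p <- r) gfield p.1 (-1) (dmap (vm p.2 1) y).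
Proof.
rewrite (@tmode_clight _ _ _ _ 1) //; last 2 first.
- exact: cstate_clight.
- by move=> p k pr k1; apply: dmap_vmode_gt1; [exact: wr|lia].
by apply: eq_bigr => p _; rewrite big_ord1.
Qed.

Lemma tmode_gt1 n : 1 < n -> tmode T (\sum_(p <- r) estate p.1 p.2) n y = 0.
Proof.
move=> n1; rewrite (@tmode_clight _ _ _ _ 0) //; last 2 first.
- exact: cstate_clight.
- by move=> p k pr k1; apply: dmap_vmode_gt1; [exact: wr|lia].
by apply: big1 => p _; rewrite big_ord0.
Qed.

End Modes.

Section Right.
Variables x0 X1 x1 X2 x2 x3 : U.
Hypotheses (wx0 : wt 0 x0) (wX1 : wt 1 X1) (wx1 : wt 0 x1) (wX2 : wt 1 X2)
  (wx2 : wt 0 x2) (wx3 : wt 0 x3).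
Local Notation x := (clight x0 X1 x1 X2 x2 x3).

Let r : seq (seq int * U) := [:: ([::], x0); ([:: 1], X1); ([:: 0], x1); ([:: 0; 1], - X2);
                 ([:: -1; 1], - x2); ([:: -1; 0; 1], - x3)].

Let wNX2 : wt 1 (- X2). Proof. exact: (subspaceN (subspace_wt T 1)). Qed.
Let wNx2 : wt 0 (- x2). Proof. exact: (subspaceN (subspace_wt T 0)). Qed.
Let wNx3 : wt 0 (- x3). Proof. exact: (subspaceN (subspace_wt T 0)). Qed.

Let wr p : p \in r -> wt 0 p.2 \/ wt 1 p.2.
Proof.
rewrite !inE; do 5?[case/predU1P => [->|]; first by [left | right]].
by move/eqP->; left.
Qed.

Lemma tmode_N1_light : tmode T x (-1) y = clight
  (vm x0 (-1) y0)
  (vm x0 (-1) Y1 + vm X1 (-1) y0)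
  (vm x0 (-1) y1 + vm X1 0 y0 + vm x1 (-1) y0)
  (vm x0 (-1) Y2 + vm X1 (-1) y1 - vm X1 0 Y1 - vm x1 (-1) Y1 + vm X2 (-1) y0)
  (vm x0 (-1) y2 - vm X1 1 Y1 - vm x1 0 Y1 *+ 2 + vm X2 0 y0 *+ 2 + vm x2 (-1) y0)
  (vm x0 (-1) y3 - vm X1 0 y2 + vm X1 1 Y2 - vm x1 (-1) y2 + vm x1 0 Y2 *+ 2
   - vm X2 0 y1 *+ 2 + vm X2 1 Y1 - vm x2 (-1) y1 + vm x2 0 Y1 + vm x3 (-1) y0).
Proof.
rewrite (clight_estates x0) (tmode_N1_modes3 (r := r)) // {}/r big_pair6.
rewrite modes3_nil (modes3_1 T Y1 Y2 wy0 wy1 wy2 wy3 wX1).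
rewrite (modes3_0 T wy0 wY1 wy1 wY2 wy2 wy3 wx1).
rewrite (modes3_01 T Y1 Y2 wy0 wy1 wy2 wy3 wNX2).
rewrite (modes3_N11 T wy0 wY1 wy1 wY2 wy2 wy3 wNx2).
rewrite (modes3_N101 T wy0 wY1 wy1 wY2 wy2 wy3 wNx3).
rewrite (words_mode_N1 (@gvac_lin K U) (@gc_lin K U) (@gcC K U) (@gc_sq K U)).
by f_equal; rewrite ?vmodeNl; zmodule.
Qed.

(** The product has total weight $-1$. In the absence of [b] ghosts and of negative weights in $V$,
    only $c_1$ and $c_1c_0$ with coefficients of weight 0 have that weight. *)
Lemma tmode_0_light : tmode T x 0 y = clight 0
  (vm x0 0 Y1 + vm X1 0 y0) 0
  (vm x0 0 Y2 + vm X1 0 y1 - vm X1 1 Y1 - vm x1 0 Y1 + vm X2 0 y0) 0 0.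
Proof.
rewrite (clight_estates x0) (tmode_0_modes2 (r := r)) // {}/r big_pair6.
rewrite (modes2_nil T Y1 Y2 wy0 wy1 wy2 wy3 wx0).
rewrite (modes2_1 T Y1 Y2 wy0 wy1 wy2 wy3 wX1).
rewrite (modes2_0 T wy0 wY1 wy1 wY2 wy2 wy3 wx1).
rewrite (modes2_01 T Y1 Y2 wy0 wy1 wy2 wy3 wNX2).
rewrite (modes2_N11 T wy0 wY1 wy1 wY2 wy2 wy3 wNx2).
rewrite (modes2_N101 T wy0 wY1 wy1 wY2 wy2 wy3 wNx3).
rewrite (words_mode_0 (@gvac_lin K U) (@gc_lin K U) (@gcC K U) (@gc_sq K U)).
by f_equal; rewrite ?vmodeNl; zmodule.
Qed.

(** The total weight would be $-i-1\le-2$, below that of every product of [c] ghosts. In the proof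
    only $i=1$ leaves terms to cancel, and they contain $c_1$ twice. *)
Lemma tmode_ge1_light (i : nat) : (0 < i)%N -> tmode T x i%:Z y = 0.
Proof.
move=> i0; rewrite (clight_estates x0).
have [i1|i1] := ltnP 1 i; first by apply: (tmode_gt1 (r := r)) => //; lia.
have -> : i%:Z = 1 by lia.
have g0 := gfield0 U; have g1 w := gfield_1 (w := w).
have cs C D := @cstate_clight K U 0 C 0 D 0 0.
rewrite (tmode_1_modes1 (r := r)) // {}/r (big_pair6 (fun s A => gfield s (-1) (dmap (vm A 1) y))).
rewrite (dmap_wt0_gt0 T wy0 wY1 wy1 wY2 wy2 wy3 wx0 ltr01).
rewrite (dmap_wt0_gt0 T wy0 wY1 wy1 wY2 wy2 wy3 wx1 ltr01).
rewrite (dmap_wt0_gt0 T wy0 wY1 wy1 wY2 wy2 wy3 wNx2 ltr01).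
rewrite (dmap_wt0_gt0 T wy0 wY1 wy1 wY2 wy2 wy3 wNx3 ltr01).
rewrite (dmap_wt1_1 T Y1 Y2 wy0 wy1 wy2 wy3 wX1).
rewrite (dmap_wt1_1 T Y1 Y2 wy0 wy1 wy2 wy3 wNX2).
rewrite (gfield_1 (cs _ _)) (gfield_01 (cs _ _)).
rewrite (g0 [::]) (g0 [:: 0]) (g0 [:: -1; 1]) (g0 [:: -1; 0; 1]).
rewrite add0r addr0 addr0 addr0.
exact: (words_mode_1 (@gvac_lin K U) (@gc_lin K U) (@gcC K U) (@gc_sq K U)).
Qed.

End Right.
End Left.

Lemma tmode0r x n : tmode T x n 0 = 0.
Proof.
apply: fsbig1 => D _; apply: fsbig1 => k _.
by rewrite (gfield0 U (sort <=%R (enum_fset D))) (lin0 (dmap_lin (vmode_lin T (x D) k))).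
Qed.

Section Annihilated.
Variables X1 X2 x2 x3 p q : U.
Hypotheses (wX1 : wt 1 X1) (wX2 : wt 1 X2) (wx2 : wt 0 x2) (wx3 : wt 0 x3)
  (wp : wt 0 p) (wq : wt 0 q).
Local Notation y := (clight 0 p 0 q 0 0).

Let r : seq (seq int * U) :=
  [:: ([::], X1); ([:: 0], X2); ([:: -1], x2); ([:: -1; 0], - x3)].

Let wNx3 : wt 0 (- x3). Proof. exact: (subspaceN (subspace_wt T 0)). Qed.

Let dmap_y A k : dmap (vm A k) y = clight 0 (vm A k p) 0 (vm A k q) 0 0.
Proof. by rewrite dmap_vmode vmode0r. Qed.

Let dmap_y_wt0 a : wt 0 a -> dmap (vm a 0) y = 0.
Proof.
move=> wa; rewrite dmap_y (mode00_ge0 T wa wp (lexx 0)) (mode00_ge0 T wa wq (lexx 0)).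
exact: (cwords0 (@gvac_lin K U) (@gc_lin K U)).
Qed.

(** [y] has the shape of the values in [tmode_0_light]. Its coefficients have weight 0, so modes of
    index at least 1 of states of weight at most 1 kill it. *)
Lemma tmode_N1_annihilated x0 x1 :
  tmode T (gb (-1) (clight x0 X1 x1 X2 x2 x3)) (-1) y = clight 0
    (vm X1 (-1) p) 0 (vm X1 (-1) q - vm X2 (-1) p)
    (- (vm X2 0 p *+ 2) - vm x2 (-1) p)
    (vm X2 0 q *+ 2 + vm x2 (-1) q + vm x3 (-1) p).
Proof.
have cs C D := @cstate_clight K U 0 C 0 D 0 0.
pose F s A := gfield s (-1) (dmap (vm A (-1)) y) + gfield s (-2) (dmap (vm A 0) y).
rewrite gbN1_clight (@tmode_clight _ _ _ _ 2) //; last first.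
- move=> s k sr k1; have k0 : 0 < k by lia.
  rewrite dmap_y; have [w|w] : wt 0 s.2 \/ wt 1 s.2.
    move: sr; rewrite !inE; do 3?[case/predU1P => [->|]; first by [left | right]].
    by move/eqP->; left.
  + rewrite (mode00_ge0 T w wp (ltW k0)) (mode00_ge0 T w wq (ltW k0)).
    exact: (cwords0 (@gvac_lin K U) (@gc_lin K U)).
  rewrite (mode10_gt0 T wp w k0) (mode10_gt0 T wq w k0).
  exact: (cwords0 (@gvac_lin K U) (@gc_lin K U)).
transitivity (\sum_(s <- r) F s.1 s.2).
  apply: eq_bigr => s _.
  exact: (big_ord2 (fun i => gfield s.1 (- 1 - i%:Z) (dmap (vm s.2 (- 1 + i%:Z)) y))).
have F1 : F [::] X1 = clight 0 (vm X1 (-1) p) 0 (vm X1 (-1) q) 0 0.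
  by rewrite /F 2!gfield_nil addr0 dmap_y.
have F2 : F [:: 0] X2 = gc 0 (clight 0 (vm X2 (-1) p) 0 (vm X2 (-1) q) 0 0)
    + gc (-1) (clight 0 (vm X2 0 p) 0 (vm X2 0 q) 0 0) *+ 2.
  by rewrite /F 2!dmap_y 2!(gfield_0 (cs _ _)).
have F3 : F [:: -1] x2 = gc (-1) (clight 0 (vm x2 (-1) p) 0 (vm x2 (-1) q) 0 0).
  rewrite /F (dmap_y_wt0 wx2) (gfield0 U [:: -1] (-2)) addr0 dmap_y.
  by rewrite (gfield_N1 (cs _ _)).
have F4 : F [:: -1; 0] (- x3) = gc (-1) (gc 0 (clight 0 (vm (- x3) (-1) p) 0
    (vm (- x3) (-1) q) 0 0)).
  rewrite /F (dmap_y_wt0 wNx3) (gfield0 U [:: -1; 0] (-2)) addr0 dmap_y.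
  by rewrite (gfield_N10 (cs _ _)).
rewrite big_pair4 F1 F2 F3 F4.
rewrite (words_mode_bN1 (@gvac_lin K U) (@gc_lin K U) (@gcC K U) (@gc_sq K U)).
by f_equal; rewrite ?vmodeNl; zmodule.
Qed.

End Annihilated.

Section Lz.
Variables x0 X1 x1 X2 x2 x3 y0 Y1 y1 Y2 y2 y3 z0 Z1 z1 Z2 z2 z3 : U.
Hypotheses (wx0 : wt 0 x0) (wX1 : wt 1 X1) (wx1 : wt 0 x1) (wX2 : wt 1 X2)
  (wx2 : wt 0 x2) (wx3 : wt 0 x3).
Hypotheses (wy0 : wt 0 y0) (wY1 : wt 1 Y1) (wy1 : wt 0 y1) (wY2 : wt 1 Y2)
  (wy2 : wt 0 y2) (wy3 : wt 0 y3).
Hypotheses (wz0 : wt 0 z0) (wZ1 : wt 1 Z1) (wz1 : wt 0 z1) (wZ2 : wt 1 Z2)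
  (wz2 : wt 0 z2) (wz3 : wt 0 z3).

Let p := vm y0 0 Z1 + vm Y1 0 z0.
Let q := vm y0 0 Z2 + vm Y1 0 z1 - vm Y1 1 Z1 - vm y1 0 Z1 + vm Y2 0 z0.

(** Only [i = 0], with weight $1/(i+1)=1$, contributes, because the inner product vanishes for
    [i > 0] by [tmode_ge1_light]. *)
Lemma lz_n1_light :
  lz_n1 T (clight x0 X1 x1 X2 x2 x3) (clight y0 Y1 y1 Y2 y2 y3)
    (clight z0 Z1 z1 Z2 z2 z3) =
  clight 0 (vm X1 (-1) p) 0 (vm X1 (-1) q - vm X2 (-1) p)
    (- (vm X2 0 p *+ 2) - vm x2 (-1) p)
    (vm X2 0 q *+ 2 + vm x2 (-1) q + vm x3 (-1) p).
Proof.
have mw a b A B n := @vmode_wt_eq _ _ _ T 0 a b A B n.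
have wD := subspaceD (subspace_wt T 0); have wN := subspaceN (subspace_wt T 0).
have wp : wt 0 p by apply: (wD _ _); [exact: (mw 0 1)|exact: (mw 1 0)].
have wq : wt 0 q.
  apply: (wD _ _); last exact: (mw 1 0).
  apply: (wD _ _); last by apply: (wN _); exact: (mw 0 1).
  apply: (wD _ _); last by apply: (wN _); exact: (mw 1 1).
  by apply: (wD _ _); [exact: (mw 0 1)|exact: (mw 1 0)].
rewrite /lz_n1 (@fsum_nat _ 1) => [|i i0].
  rewrite big_ord1 invr1 scale1r (tmode_0_light wz0 wZ1 wz1 wZ2 wz2 wz3) //.
  exact: tmode_N1_annihilated.
rewrite (tmode_ge1_light wz0 wZ1 wz1 wZ2 wz2 wz3) // tmode0r.
exact: scaler0.
Qed.

End Lz.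

Lemma dgcE (w : fock U) :
  ((dgc 0 w = gc 1 w) * (dgc 1 w = gc 0 w) * (dgc 2 w = gc (-1) w *+ 2))%type.
Proof.
rewrite /dgc -!scaler_nat subr0 subrr (_ : 1 - 2%:Z = -1) //.
by split; first split; rewrite ?scale1r.
Qed.

Lemma brst_currentE : brst_current T =
  \sum_(p <- [:: ([:: 1], vconf T); ([:: 0; 1; 2], - vvac T);
                 ([:: -1], vvac T *+ 3)]) estate p.1 p.2.
Proof.
rewrite big_pair3 /brst_current !dgcE.
(* $e_D$ lists $c_0$ before $c_1$, whence the sign. *)
have -> : estate [:: 0; 1; 2] (- vvac T) = gc 1 (gc 0 (gb (-2) (gvac (vvac T)))).
  rewrite /estate /= (linN (@gvac_lin K U)) [RHS]gcC.
  rewrite -(linN (gc_lin 0)) -(linN (gc_lin 1)) -(linN (gb_lin (-2))).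
  by [].
have -> : estate [:: -1] (vvac T *+ 3) = gc (-1) (gvac (vvac T)) *+ 3.
  by rewrite -(linMn (gc_lin (-1))) -(linMn (@gvac_lin K U)).
(* The state of $\partial^2c$ is $2c_{-1}\mathbf 1$, which turns $3/2$ into 3. *)
have -> : (3%:R / 2%:R : K) *: (gc (-1) (gvac (vvac T)) *+ 2) =
    gc (-1) (gvac (vvac T)) *+ 3.
  by rewrite -!scaler_nat scalerA divfK ?pnatr_eq0.
by [].
Qed.

Section BrstLight.
Variables x0 X1 x1 X2 x2 x3 : U.
Hypotheses (wx0 : wt 0 x0) (wX1 : wt 1 X1) (wx1 : wt 0 x1) (wX2 : wt 1 X2)
  (wx2 : wt 0 x2) (wx3 : wt 0 x3).
Local Notation x := (clight x0 X1 x1 X2 x2 x3).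

(** As $L_0X_1=X_1$, the matter current puts $-X_1$ in the word $c_1c_0$; the ghost current cancels
    it and adds $2x_1$ to $c_1c_{-1}$. *)
Lemma brst_light : brst T x = clight 0 (virasoro T (-1) x0) 0
  (virasoro T (-1) x1) (x1 *+ 2 - virasoro T 1 X1) (virasoro T 1 X2).
Proof.
pose F s A := \sum_(k \in [set: int]) dmap (vm A k) (gfield s (0 - k - 1) x).
have e0 : 0 - -1 - 1 = 0 :> int by [].
have cx : cstate x by exact: cstate_clight.
have c0 := cwords0 (@gvac_lin K U) (@gc_lin K U).
have om p A (k : int) : wt p A -> 2 + p%:Z <= k -> vm (vconf T) k A = 0.
  by move=> wA pk; apply: (vmode_wt_lt T (vconf_wt T) wA); lia.
have L0x a : wt 0 a -> vm (vconf T) 1 a = 0.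
  by move=> wa; rewrite (vweight T wa) scale0r.
have L0X A : wt 1 A -> vm (vconf T) 1 A = A.
  by move=> wA; rewrite (vweight T wA) scale1r.
have F1 : F [:: 1] (vconf T) = clight 0 (virasoro T (-1) x0) 0
    (virasoro T (-1) x1 - X1) (- virasoro T 1 X1) (virasoro T 1 X2).
  rewrite /F (@field_sum _ _ _ _ 3) // => [|k k3]; last first.
    have k2 : 2 + 0%:Z <= k by lia.
    rewrite dmap_vmode (om _ _ _ wx0 k2) (om _ _ _ wx1 k2) (om _ _ _ wx2 k2).
    by rewrite (om _ _ _ wx3 k2) (om _ _ _ wX1 k3) (om _ _ _ wX2 k3).
  transitivity (gfield [:: 1] (-1) (dmap (vm (vconf T) 0) x)
      + gfield [:: 1] (-2) (dmap (vm (vconf T) 1) x)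
      + gfield [:: 1] (-3) (dmap (vm (vconf T) 2) x)).
    exact: (big_ord3 (fun i => gfield [:: 1] (- 1 - i%:Z)
      (dmap (vm (vconf T) (0 + i%:Z)) x))).
  rewrite 3!dmap_vmode 3!(gfield_1 (cstate_clight _ _ _ _ _ _)).
  rewrite (L0x _ wx0) (L0x _ wx1) (L0x _ wx2) (L0x _ wx3) (L0X _ wX1) (L0X _ wX2).
  rewrite (om _ _ 2 wx0) // (om _ _ 2 wx1) // (om _ _ 2 wx2) // (om _ _ 2 wx3) //.
  exact: (words_conf (@gvac_lin K U) (@gc_lin K U) (@gcC K U) (@gc_sq K U)).
have vacE k B : vm (vvac T *+ 3) k B = vm (vvac T) k B *+ 3.
  by rewrite -!scaler_nat vmodeZl.
have F2 : F [:: 0; 1; 2] (- vvac T) = clight 0 0 0 X1 (x1 *+ 2) 0.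
  rewrite /F (@fsum_seq _ _ [:: -1] _ isT) => [|k].
    rewrite big_seq1 e0 gfield_ccb_clight.
    move: (clight _ _ _ _ _ _) => w; apply: dsumP => D.
    rewrite (dmapE _ _ (vmode0r T (- vvac T) (-1))) vmodeNl vvacl eqxx dsumN.
    by rewrite opprK.
  rewrite inE => k1; apply: dsumP => D.
  by rewrite (dmapE _ _ (vmode0r T (- vvac T) k)) vmodeNl vvacl (negbTE k1) oppr0.
(* The residue of the total derivative $\partial^2c$. *)
have F3 : F [:: -1] (vvac T *+ 3) = 0.
  apply: fsbig1 => k _; have [->|k1] := eqVneq k (-1).
    rewrite e0 (gfield_ge0 (isT : [:: -1] != [::]) isT cx (lexx 0)).
    exact: (lin0 (dmap_lin (vmode_lin T _ _))).
  apply: dsumP => D; rewrite (dmapE _ _ (vmode0r T (vvac T *+ 3) k)).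
  by rewrite vacE vvacl (negbTE k1) mul0rn.
rewrite /brst brst_currentE tmode_estates; [|by []|by []].
rewrite (big_pair3 F) F1 F2 F3 addr0.
rewrite (cwordsD (@gvac_lin K U) (@gc_lin K U)).
by f_equal; zmodule.
Qed.

End BrstLight.

End LightOperations.

(** * The Courant algebroid of leading coefficients *)

Section SubspaceType.
Variables (K : fieldType) (V : lmodType K) (S : set V) (hS : subspace S).

(** The proof is an argument of the predicate so that the closure instance, which depends on it, can
    be inferred. *)
Definition in_subspace of subspace S : {pred V} := fun v => `[< S v >].

Lemma in_subspace_submod : submod_closed (in_subspace hS).
Proof.
split; first exact/asboolP/(subspace0 hS).
by move=> a u v /asboolP Su /asboolP Sv; apply/asboolP; exact: hS.2.
Qed.

HB.instance Definition _ :=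
  GRing.isSubmodClosed.Build K V (in_subspace hS) in_subspace_submod.

Record subspace_type :=
  SubspaceType { subspace_val :> V; _ : subspace_val \in in_subspace hS }.

HB.instance Definition _ := [isSub for subspace_val].
HB.instance Definition _ := [Choice of subspace_type by <:].
HB.instance Definition _ := [SubChoice_isSubLmodule of subspace_type by <:].

Definition to_subspace v (Sv : S v) : subspace_type :=
  SubspaceType (introT (asboolP _) Sv).

Lemma subspace_valP (u : subspace_type) : S (subspace_val u).
Proof. exact/asboolP/(valP u). Qed.

End SubspaceType.

Section Symbols.
Variables (K : numFieldType) (V : lmodType K) (Vgr : nat -> set V).
Variables (grV : is_graded Vgr).
Variables (T : voa (fun n => laurent_in (Vgr n))) (fpT : formal_parameter T).
Implicit Types u v A B C : V.

Local Notation vm := (vmode T).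
Local Notation H := (hmono 0).
Local Notation sp := (symbol T).
Local Notation Lm1 := (virasoro T (-1)).
Local Notation L1 := (virasoro T 1).

Lemma Vgr_subspace p : subspace (Vgr p).
Proof. by case: grV. Qed.

Lemma laurent_in_hmono p k u : Vgr p u -> laurent_in (Vgr p) (hmono k u).
Proof.
by move=> pu i; rewrite hmonoE; case: eqP => // _; exact: subspace0 (Vgr_subspace p).
Qed.

Lemma symbol_bilin n : bilin (sp n).
Proof.
by split=> a x y z; rewrite /symbol hmono_linear ?vlinl ?vlinr dsumD dsumZ.
Qed.

Lemma symbol_Lm1_lin : lin (symbol_Lm1 T).
Proof.
by move=> a x y; rewrite /symbol_Lm1 hmono_linear /virasoro vlinr dsumD dsumZ.
Qed.

Lemma symbol_L1_lin : lin (symbol_L1 T).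
Proof.
by move=> a x y; rewrite /symbol_L1 hmono_linear /virasoro vlinr dsumD dsumZ.
Qed.

Lemma symbol_wt p q r n u v : Vgr p u -> Vgr q v ->
  p%:Z + q%:Z - n - 1 = r%:Z -> Vgr r (sp n u v).
Proof.
move=> pu qv e.
exact: (vmode_wt_eq T (laurent_in_hmono 0 pu) (laurent_in_hmono 0 qv) e
  (mode_order n)).
Qed.

Lemma symbol_Lm1_wt u : Vgr 0 u -> Vgr 1 (symbol_Lm1 T u).
Proof. by move=> wu; exact: (wt_Lm1 T (laurent_in_hmono 0 wu) 0). Qed.

Lemma symbol_L1_wt A : Vgr 1 A -> Vgr 0 (symbol_L1 T A).
Proof. by move=> wA; exact: (wt_L1 T (laurent_in_hmono 0 wA) 1). Qed.

(** [x] may be 0: a term of higher order leads to 0, and [leads_weaken] discards corrections in this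
    way. *)
Definition leads (a : int) (X : laurent V) (x : V) := orderge a X /\ X a = x.

Lemma leads_uniq a X x x' : leads a X x -> leads a X x' -> x = x'.
Proof. by move=> [_ <-] [_ <-]. Qed.

Lemma leads_hmono k u : leads k (hmono k u) u.
Proof. by split; [exact: orderge_mono|rewrite hmonoE eqxx]. Qed.

Lemma leads0 a : leads a 0 0.
Proof. by []. Qed.

Lemma leadsD a X Y x y : leads a X x -> leads a Y y -> leads a (X + Y) (x + y).
Proof.
by move=> [aX <-] [aY <-]; split=> // k ka; rewrite dsumD aX // aY // addr0.
Qed.

Lemma leadsN a X x : leads a X x -> leads a (- X) (- x).
Proof. by move=> [aX <-]; split=> // k ka; rewrite dsumN aX // oppr0. Qed.

Lemma leads_weaken b a X x : leads b X x -> a < b -> leads a X 0.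
Proof. by move=> [bX _] ab; split=> [k ka|]; apply: bX => //; lia. Qed.

Lemma leads_modeN1 a b X Y x y : leads a X x -> leads b Y y ->
  leads (a + b) (vm X (-1) Y) (sp (-1) x y).
Proof.
by move=> [aX <-] [bY <-]; have := leading_mode fpT (-1) aX bY; rewrite addr0.
Qed.

Lemma leads_mode a b n X Y x y : 0 <= n -> leads a X x -> leads b Y y ->
  leads (a + b + 1) (vm X n Y) (sp n x y).
Proof.
move=> n0 [aX <-] [bY <-]; have := leading_mode fpT n aX bY.
by rewrite /mode_order n0.
Qed.

Lemma leads_Lm1 a X x : leads a X x -> leads a (Lm1 X) (symbol_Lm1 T x).
Proof. by move=> [aX <-]; exact: leading_Lm1. Qed.

Lemma leads_L1 a X x : laurent_in (Vgr 1) X -> leads a X x ->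
  leads (a + 1) (L1 X) (symbol_L1 T x).
Proof. by move=> lX [aX <-]; exact: leading_L1. Qed.

Let hH u : leads 0 (H u) u := leads_hmono 0 u.
Let m0 a b X Y x y := @leads_mode a b 0 X Y x y isT.
Let m1 a b X Y x y := @leads_mode a b 1 X Y x y isT.

Section Identities.
Variables u v A B C : V.
Hypotheses (wu : Vgr 0 u) (wv : Vgr 0 v) (wA : Vgr 1 A) (wB : Vgr 1 B) (wC : Vgr 1 C).
Let lu := laurent_in_hmono 0 wu.
Let lv := laurent_in_hmono 0 wv.
Let lA := laurent_in_hmono 0 wA.
Let lB := laurent_in_hmono 0 wB.

Lemma symbol_mulC : sp (-1) u v = sp (-1) v u.
Proof. by rewrite /symbol (mode00_comm T lu lv). Qed.

Let symbol_assoc x : (forall n, 0 < n -> vm (H u) n (H x) = 0) ->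
  (forall n, 0 < n -> vm (H v) n (H x) = 0) ->
  sp (-1) u (sp (-1) v x) = sp (-1) (sp (-1) u v) x.
Proof.
move=> ux vx; apply: (leads_uniq (a := 0)).
  exact: (leads_modeN1 (hH u) (leads_modeN1 (hH v) (hH x))).
(* The mode 0 gains a factor $h$ and the mode $-2$ does not lose it. *)
have small w w' : leads 0 (vm (H w) (-2) (vm (H w') 0 (H x))) 0.
  have [o1 _] := m0 (hH w') (hH x).
  have o2 := leading_mode fpT (-2) (hH w).1 o1.
  exact: (leads_weaken o2).
have -> : vm (H u) (-1) (vm (H v) (-1) (H x)) =
    vm (vm (H u) (-1) (H v)) (-1) (H x) - vm (H v) (-2) (vm (H u) 0 (H x))
    - vm (H u) (-2) (vm (H v) 0 (H x)).
  by rewrite (vassociativityN1 ux vx) -!addrA; zmodule.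
have := leadsD (leadsD (leads_modeN1 (leads_modeN1 (hH u) (hH v)) (hH x))
  (leadsN (small v u))) (leadsN (small u v)).
by rewrite oppr0 !addr0.
Qed.

Lemma symbol_mulA w : Vgr 0 w ->
  sp (-1) u (sp (-1) v w) = sp (-1) (sp (-1) u v) w.
Proof.
move=> ww; have lw := laurent_in_hmono 0 ww.
by apply: symbol_assoc => n /ltW n0; [exact: (mode00_ge0 T lu lw)|exact: (mode00_ge0 T lv lw)].
Qed.

Lemma symbol_actA : sp (-1) u (sp (-1) v A) = sp (-1) (sp (-1) u v) A.
Proof.
by apply: symbol_assoc => n n0; [exact: (mode01_gt0 T lu lA)|exact: (mode01_gt0 T lv lA)].
Qed.

Lemma symbol_derM : symbol_Lm1 T (sp (-1) u v) =
  sp (-1) u (symbol_Lm1 T v) + sp (-1) v (symbol_Lm1 T u).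
Proof.
apply: (leads_uniq (a := 0)).
  exact: (leads_Lm1 (leads_modeN1 (hH u) (hH v))).
rewrite Lm1_vmode (mode10_skew T lv (wt_Lm1 T lu)) Lm1_mode0.
rewrite /virasoro vmode0r addr0 addrC; apply: leadsD.
  exact: (leads_modeN1 (hH u) (leads_Lm1 (hH v))).
exact: (leads_modeN1 (hH v) (leads_Lm1 (hH u))).
Qed.

(** The two sides differ by the leading part of $L_{-1}(A_0u)$, which has order 1 in $h$. *)
Lemma symbol_actr : sp (-1) A u = sp (-1) u A.
Proof.
apply: (leads_uniq (a := 0)); first exact: (leads_modeN1 (hH A) (hH u)).
rewrite (mode10_skew T lu lA) -[sp _ _ _]addr0; apply: leadsD.
  exact: (leads_modeN1 (hH u) (hH A)).
exact: (leads_weaken (leads_Lm1 (m0 (hH A) (hH u)))).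
Qed.

Lemma symbol_ancM : sp 0 A (sp (-1) u v) =
  sp (-1) u (sp 0 A v) + sp (-1) (sp 0 A u) v.
Proof.
apply: (leads_uniq (a := 1)); first exact: (m0 (hH A) (leads_modeN1 (hH u) (hH v))).
rewrite mode0_deriv addrC; apply: leadsD.
  exact: (leads_modeN1 (hH u) (m0 (hH A) (hH v))).
exact: (leads_modeN1 (m0 (hH A) (hH u)) (hH v)).
Qed.

(** Skew-symmetry rewrites $(uA)_0v$ as $-v_0(u_{-1}A)$, and $v_0$ is a derivation with $v_0u=0$.
    This avoids the associativity formula for $(uA)_0$. *)
Lemma symbol_anc_act : sp 0 (sp (-1) u A) v = sp (-1) u (sp 0 A v).
Proof.
apply: (leads_uniq (a := 1)); first exact: (m0 (leads_modeN1 (hH u) (hH A)) (hH v)).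
have luA : laurent_in (Vgr 1) (vm (H u) (-1) (H A)) by exact: (vmode_wt_eq T lu lA).
have := mode01_skew0 T lv luA => /(congr1 -%R); rewrite opprK => <-.
rewrite mode0_deriv (mode00_ge0 T lv lu (lexx 0)) vmode0l add0r.
rewrite (mode01_skew0 T lv lA) vmodeNr opprK.
exact: (leads_modeN1 (hH u) (m0 (hH A) (hH v))).
Qed.

Lemma symbol_pr_sym : sp 1 A B = sp 1 B A.
Proof. by rewrite /symbol (mode11_comm1 T lA lB). Qed.

(** The extra term $(A_0u)_0B$ contains two nonnegative modes, hence $h^2$. *)
Lemma symbol_pr_actr : sp 1 A (sp (-1) u B) = sp (-1) u (sp 1 A B).
Proof.
apply: (leads_uniq (a := 1)); first exact: (m1 (hH A) (leads_modeN1 (hH u) (hH B))).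
rewrite mode1_deriv (mode10_gt0 T lu lA ltr01) vmode0l addr0 addNr.
rewrite -[sp _ _ _]add0r; apply: leadsD.
  exact: (leads_weaken (m0 (m0 (hH A) (hH u)) (hH B))).
exact: (leads_modeN1 (hH u) (m1 (hH A) (hH B))).
Qed.

Lemma symbol_br_skew : sp 0 A B = - sp 0 B A + symbol_Lm1 T (sp 1 A B).
Proof.
apply: (leads_uniq (a := 1)); first exact: (m0 (hH A) (hH B)).
have -> : vm (H A) 0 (H B) = - vm (H B) 0 (H A) + Lm1 (vm (H A) 1 (H B)).
  by rewrite -(mode11_skew0 T lA lB); zmodule.
apply: leadsD; first exact: (leadsN (m0 (hH B) (hH A))).
exact: (leads_Lm1 (m1 (hH A) (hH B))).
Qed.

Lemma symbol_br_actr : sp 0 A (sp (-1) u B) =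
  sp (-1) (sp 0 A u) B + sp (-1) u (sp 0 A B).
Proof.
apply: (leads_uniq (a := 1)); first exact: (m0 (hH A) (leads_modeN1 (hH u) (hH B))).
rewrite mode0_deriv; apply: leadsD.
  exact: (leads_modeN1 (m0 (hH A) (hH u)) (hH B)).
exact: (leads_modeN1 (hH u) (m0 (hH A) (hH B))).
Qed.

Lemma symbol_pr_der : sp 1 A (symbol_Lm1 T u) = sp 0 A u.
Proof.
apply: (leads_uniq (a := 1)); first exact: (m1 (hH A) (leads_Lm1 (hH u))).
by rewrite (Lm1_mode1r T lu lA); exact: (m0 (hH A) (hH u)).
Qed.

Lemma symbol_der_mode0 x : sp 0 (symbol_Lm1 T u) x = 0.
Proof.
apply: (leads_uniq (a := 1)); first exact: (m0 (leads_Lm1 (hH u)) (hH x)).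
by rewrite Lm1_mode0; exact: leads0.
Qed.

Lemma symbol_br_derr : sp 0 A (symbol_Lm1 T u) = symbol_Lm1 T (sp 0 A u).
Proof.
apply: (leads_uniq (a := 1)); first exact: (m0 (hH A) (leads_Lm1 (hH u))).
have <- : Lm1 (vm (H A) 0 (H u)) = vm (H A) 0 (Lm1 (H u)).
  by rewrite Lm1_vmode Lm1_mode0 add0r.
exact: (leads_Lm1 (m0 (hH A) (hH u))).
Qed.

Lemma symbol_anc_pr : sp 0 A (sp 1 B C) =
  sp 1 (sp 0 A B) C + sp 1 B (sp 0 A C).
Proof.
apply: (leads_uniq (a := 2)); first exact: (m0 (hH A) (m1 (hH B) (hH C))).
rewrite mode0_deriv; apply: leadsD.
  exact: (m1 (m0 (hH A) (hH B)) (hH C)).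
exact: (m1 (hH B) (m0 (hH A) (hH C))).
Qed.

Let L0_u : virasoro T 0 (H u) = 0.
Proof. by rewrite (L0_wt T lu) scale0r. Qed.

Let L0_A : virasoro T 0 (H A) = H A.
Proof. by rewrite (L0_wt T lA) scale1r. Qed.

Let L1_u : L1 (H u) = 0.
Proof. by apply: (vmode_wt_lt T (vconf_wt T) lu). Qed.

Lemma symbol_div_act : symbol_L1 T (sp (-1) u A) =
  sp (-1) u (symbol_L1 T A) + sp 0 A u.
Proof.
have luA : laurent_in (Vgr 1) (vm (H u) (-1) (H A)) by exact: (vmode_wt_eq T lu lA).
apply: (leads_uniq (a := 1)).
  exact: (leads_L1 luA (leads_modeN1 (hH u) (hH A))).
rewrite L1_vmode L0_u L1_u !vmode0l mul0rn !addr0.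
have -> : -1 + 2 = 1 :> int by [].
rewrite (Lm1_mode1 T lu lA); apply: leadsD.
  exact: (leads_modeN1 (hH u) (leads_L1 lA (hH A))).
exact: (m0 (hH A) (hH u)).
Qed.

(** In [L1_vmode] the term $(L_{-1}A)_2B=-2A_1B$ cancels twice $(L_0A)_1B$, and
    $(L_1A)_0B=-B_0(L_1A)$ by skew-symmetry. *)
Lemma symbol_div_br : symbol_L1 T (sp 0 A B) =
  sp 0 A (symbol_L1 T B) - sp 0 B (symbol_L1 T A).
Proof.
have lAB : laurent_in (Vgr 1) (vm (H A) 0 (H B)) by exact: (vmode_wt_eq T lA lB).
apply: (leads_uniq (a := 2)); first exact: (leads_L1 lAB (m0 (hH A) (hH B))).
rewrite L1_vmode L0_A vmode_Lm1 (mode01_skew0 T (wt_L1 T lA) lB).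
have -> : (- (0 + 2))%:~R *: vm (H A) (0 + 2 - 1) (H B) = - (vm (H A) (0 + 1) (H B) *+ 2).
  by rewrite intrN scaleNr -[(0 + 2)%:~R]/(2%:R) scaler_nat.
rewrite addrNK; apply: leadsD.
  exact: (m0 (hH A) (leads_L1 lB (hH B))).
exact: (leadsN (m0 (hH B) (leads_L1 lA (hH A)))).
Qed.

(** $[L_1,L_{-1}]=2L_0$, whose central term vanishes, and both $L_1$ and $L_0$ kill weight 0. *)
Lemma symbol_div_der : symbol_L1 T (symbol_Lm1 T u) = 0.
Proof.
apply: (leads_uniq (a := 1)).
  exact: (leads_L1 (wt_Lm1 T lu) (leads_Lm1 (hH u))).
have := vvirasoro T 1 (-1) (H u); rewrite -/(virasoro T (-1) _) -/(virasoro T 1 _).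
have -> : vmode T (vconf T) (-1 + 1) (vmode T (vconf T) (1 + 1) (H u)) = Lm1 (L1 (H u)) by [].
rewrite L1_u [Lm1 0]vmode0r subr0 => ->.
rewrite subrr eqxx mul0r mul0r scale0r addr0 add0r.
rewrite (vweight T lu) scale0r scaler0; exact: leads0.
Qed.

End Identities.

Local Notation V0 := (subspace_type (Vgr_subspace 0)).
Local Notation V1 := (subspace_type (Vgr_subspace 1)).

Definition mul0 (u v : V0) : V0 := to_subspace (Vgr_subspace 0)
  (symbol_wt (n := -1) (r := 0) (subspace_valP u) (subspace_valP v) erefl).
Definition act0 (u : V0) (A : V1) : V1 := to_subspace (Vgr_subspace 1)
  (symbol_wt (n := -1) (r := 1) (subspace_valP u) (subspace_valP A) erefl).
Definition der0 (u : V0) : V1 :=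
  to_subspace (Vgr_subspace 1) (symbol_Lm1_wt (subspace_valP u)).
Definition anc0 (A : V1) (u : V0) : V0 := to_subspace (Vgr_subspace 0)
  (symbol_wt (n := 0) (r := 0) (subspace_valP A) (subspace_valP u) erefl).
Definition br0 (A B : V1) : V1 := to_subspace (Vgr_subspace 1)
  (symbol_wt (n := 0) (r := 1) (subspace_valP A) (subspace_valP B) erefl).
Definition pr0 (A B : V1) : V0 := to_subspace (Vgr_subspace 0)
  (symbol_wt (n := 1) (r := 0) (subspace_valP A) (subspace_valP B) erefl).
Definition div0 (A : V1) : V0 :=
  to_subspace (Vgr_subspace 0) (symbol_L1_wt (subspace_valP A)).

Let val_bilin p q r (n : int) (f : subspace_type (Vgr_subspace p) ->
    subspace_type (Vgr_subspace q) -> subspace_type (Vgr_subspace r)) :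
  (forall x y, subspace_val (f x y) = sp n (subspace_val x) (subspace_val y)) ->
  bilin f.
Proof.
move=> fE; split=> a x y z; apply: val_inj; rewrite linearP /= !fE.
  exact: (symbol_bilin n).1.
exact: (symbol_bilin n).2.
Qed.

Definition symbol_courant : courant V0 V1.
Proof.
pose P (p : nat) (u : subspace_type (Vgr_subspace p)) := subspace_valP u.
refine (@Courant K V0 V1 mul0 act0 der0 anc0 br0 pr0 div0
  _ _ _ _ _ _ _ _ _ _ _ _ _ _ _ _ _ _ _ _ _ _ _ _ _).
- exact: (@val_bilin 0 0 0 (-1)).
- exact: (@val_bilin 0 1 1 (-1)).
- by move=> a x y; apply: val_inj; rewrite linearP /=; exact: symbol_Lm1_lin.
- exact: (@val_bilin 1 0 0 0).
- exact: (@val_bilin 1 1 1 0).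
- exact: (@val_bilin 1 1 0 1).
- by move=> a x y; apply: val_inj; rewrite linearP /=; exact: symbol_L1_lin.
- by move=> u v; apply: val_inj; exact: (symbol_mulC (P _ u) (P _ v)).
- by move=> u v w; apply: val_inj; exact: (symbol_mulA (P _ u) (P _ v) (P _ w)).
- by move=> u v A; apply: val_inj; exact: (symbol_actA (P _ u) (P _ v) (P _ A)).
- by move=> u v; apply: val_inj; exact: (symbol_derM (P _ u) (P _ v)).
- by move=> A u v; apply: val_inj; exact: symbol_ancM.
- move=> u A v; apply: val_inj; exact: (symbol_anc_act (P _ u) (P _ v) (P _ A)).
- by move=> A B; apply: val_inj; exact: (symbol_pr_sym (P _ A) (P _ B)).
- move=> u A B; apply: val_inj; rewrite /= symbol_pr_sym; try exact: P.
    rewrite symbol_pr_actr; try exact: P.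
    by rewrite (symbol_pr_sym (P _ B) (P _ A)).
  by exact: (P _ (act0 u A)).
- by move=> A B; apply: val_inj; exact: (symbol_br_skew (P _ A) (P _ B)).
- by move=> u A B; apply: val_inj; exact: symbol_br_actr.
- by move=> A u; apply: val_inj; exact: (symbol_pr_der (P _ u) (P _ A)).
- by move=> u A; apply: val_inj; exact: symbol_der_mode0.
- by move=> A u; apply: val_inj; exact: symbol_br_derr.
- by move=> u v; apply: val_inj; exact: symbol_der_mode0.
- by move=> A B C; apply: val_inj; exact: symbol_anc_pr.
- by move=> u A; apply: val_inj; exact: (symbol_div_act (P _ u) (P _ A)).
- by move=> A B; apply: val_inj; exact: (symbol_div_br (P _ A) (P _ B)).
by move=> u; apply: val_inj; exact: (symbol_div_der (P _ u)).
Defined.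

End Symbols.

Lemma sum_bool2 (W : nmodType) (f : bool -> bool -> W) :
  \sum_p \sum_q f p q = f false false + f false true + (f true false + f true true).
Proof. by rewrite !big_bool addrC [f false _ + _]addrC [f true _ + _]addrC. Qed.

(** * Leading coefficients of the Lian-Zuckerman operations *)

Section LightAlgebra.
Variables (K : numFieldType) (V : lmodType K) (Vgr : nat -> set V).
Variables (grV : is_graded Vgr).
Variables (T : voa (fun n => laurent_in (Vgr n))) (fpT : formal_parameter T).

Local Notation U := (laurent V).
Local Notation W := (fock U).
Local Notation vm := (vmode T).
Local Notation sub p := (subspace_type (Vgr_subspace grV p)).
Local Notation V0 := (sub 0).
Local Notation V1 := (sub 1).
Local Notation S := (symbol_courant grV fpT).
Local Notation clight := (cwords (@gvac K U) (@gc K U)).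
Local Notation L6 := (sixtuple U U).
Local Notation P6 := (sixtuple V0 V1).
Local Notation gl := (@gvac_lin K U).
Local Notation cl := (@gc_lin K U).

Definition states (m : L6) : W :=
  let: (x0, (X1, x1), (X2, x2), x3) := m in clight x0 X1 x1 X2 x2 x3.

Definition hlift (p : P6) : L6 :=
  let: (x0, (X1, x1), (X2, x2), x3) := p in
  (hmono 0 (subspace_val x0),
   (hmono 0 (subspace_val X1), hmono 1 (subspace_val x1)),
   (hmono 1 (subspace_val X2), hmono 1 (subspace_val x2)),
   hmono 2 (subspace_val x3)).

Lemma states_lin : lin states.
Proof.
move=> a [[[x0 [X1 x1]] [X2 x2]] x3] [[[y0 [Y1 y1]] [Y2 y2]] y3].
by rewrite sixtupleZ sixtupleD /states (cwordsZ gl cl) (cwordsD gl cl).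
Qed.

Lemma hlift_lin : lin hlift.
Proof.
move=> a [[[x0 [X1 x1]] [X2 x2]] x3] [[[y0 [Y1 y1]] [Y2 y2]] y3].
have e k (p : nat) (u u' : sub p) :
    hmono k (subspace_val (a *: u + u')) =
    a *: hmono k (subspace_val u) + hmono k (subspace_val u').
  by rewrite -hmono_linear.
rewrite [LHS]/hlift [a *: _]sixtupleZ sixtupleD /hlift.
rewrite [in RHS]sixtupleZ [in RHS]sixtupleD -!e; reflexivity.
Qed.

Lemma adeg_hlift i p : adeg i p -> adeg i (hlift p).
Proof.
move: p => [[[x0 [X1 x1]] [X2 x2]] x3] [h0 h1 h2 h3].
have e k : hmono k (0 : V) = 0 by exact: hmono0.
split=> h.
- by rewrite h0.
- by have [-> ->] := h1 h.
- by have [-> ->] := h2 h.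
by rewrite h3.
Qed.

Lemma states_deg0 (x : U) : states (x, (0, 0), (0, 0), 0) = gvac x.
Proof. exact: (cwords_deg0 gl cl). Qed.
Lemma states_deg1 (X x : U) :
  states (0, (X, x), (0, 0), 0) = gc 1 (gvac X) + gc 0 (gvac x).
Proof. exact: (cwords_deg1 gl cl). Qed.
Lemma states_deg2 (X x : U) :
  states (0, (0, 0), (X, x), 0) = gc 1 (gc 0 (gvac X)) + gc 1 (gc (-1) (gvac x)).
Proof. exact: (cwords_deg2 gl cl). Qed.
Lemma states_deg3 (x : U) :
  states (0, (0, 0), (0, 0), x) = gc 1 (gc 0 (gc (-1) (gvac x))).
Proof. exact: (cwords_deg3 gl cl). Qed.

Let half (p : nat) (u : sub p) : (2^-1 *: u) *+ 2 = u.
Proof. by rewrite -scaler_nat scalerA divff ?pnatr_eq0 // scale1r. Qed.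

Lemma hmonoMn k (u : V) n : hmono k (u *+ n) = hmono k u *+ n.
Proof. exact: (linMn (@hmono_linear K V k)). Qed.

(** The sextuple uses $c_{-1}$ where [light] uses $\partial^2c=2c_{-1}$; hence the doubling in one
    direction and the division by 2 in the other. *)
Lemma light_states i y :
  light Vgr i y <-> exists2 p : P6, adeg i p & y = states (hlift p).
Proof.
have gMn u : gc (-1) (gvac (u *+ 2)) = gc (-1) (gvac u) *+ 2 :> W.
  by rewrite (linMn gl) (linMn (cl (-1))).
have val2 (p : nat) (u : sub p) :
    subspace_val (u *+ 2) = subspace_val u *+ 2 by [].
have mk2 k u : Vgr 0 u -> exists2 u' : V0, subspace_val u' = u *+ 2
    & hmono k (subspace_val u') = hmono k u *+ 2.
  move=> wu; exists (to_subspace (Vgr_subspace grV 0) wu *+ 2); rewrite ?val2 //.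
  exact: hmonoMn.
have h0 k : hmono k (0 : V) = 0 := hmono0 V k.
case: i => [[|[|[|[|n]]]]|n] /=.
- split=> [[u wu ->]|[[[[x0 [X1 x1]] [X2 x2]] x3] [_ h1 h2 h3] ->]].
    exists (to_subspace (Vgr_subspace grV 0) wu, (0, 0), (0, 0), 0) => //.
    rewrite /hlift !h0 states_deg0; reflexivity.
  have [-> ->] := h1 isT; have [-> ->] := h2 isT; rewrite h3 //.
  exists (subspace_val x0); first exact: subspace_valP.
  rewrite /hlift !h0 states_deg0; reflexivity.
- split=> [[A [u [wA wu ->]]]|[[[[x0 [X1 x1]] [X2 x2]] x3] [h1 _ h2 h3] ->]].
    exists (0, (to_subspace (Vgr_subspace grV 1) wA, to_subspace (Vgr_subspace grV 0) wu),
      (0, 0), 0) => //.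
    rewrite /hlift !h0 states_deg1 !dgcE; reflexivity.
  have [-> ->] := h2 isT; rewrite h1 // h3 //.
  exists (subspace_val X1), (subspace_val x1); split; try exact: subspace_valP.
  rewrite /hlift !h0 states_deg1 !dgcE; reflexivity.
- split=> [[A [u [wA wu ->]]]|[[[[x0 [X1 x1]] [X2 x2]] x3] [h1 h2 _ h3] ->]].
    have [u' _ hu'] := mk2 1 u wu.
    exists (0, (0, 0), (to_subspace (Vgr_subspace grV 1) wA, u'), 0) => //.
    rewrite /hlift !h0 states_deg2 !dgcE hu' gMn; reflexivity.
  have [-> ->] := h2 isT; rewrite h1 // h3 //.
  exists (subspace_val X2), (subspace_val (2^-1 *: x2)).
  split; try exact: subspace_valP.
  rewrite /hlift !h0 states_deg2 !dgcE -gMn -hmonoMn -val2 half; reflexivity.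
- split=> [[u wu ->]|[[[[x0 [X1 x1]] [X2 x2]] x3] [h1 h2 h3 _] ->]].
    have [u' _ hu'] := mk2 2 u wu.
    exists (0, (0, 0), (0, 0), u') => //.
    rewrite /hlift !h0 states_deg3 !dgcE hu' gMn; reflexivity.
  have [-> ->] := h2 isT; have [-> ->] := h3 isT; rewrite h1 //.
  exists (subspace_val (2^-1 *: x3)); first exact: subspace_valP.
  rewrite /hlift !h0 states_deg3 !dgcE -gMn -hmonoMn -val2 half; reflexivity.
- split=> [->|[[[[x0 [X1 x1]] [X2 x2]] x3] [h0' h1 h2 h3] ->]].
    by exists 0; [exact: (@adeg_subspace _ _ _ _).1|rewrite (lin0 hlift_lin) (lin0 states_lin)].
  have [-> ->] := h1 isT; have [-> ->] := h2 isT; rewrite h0' // h3 //.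
  by rewrite -[X in hlift X]/(0 : P6) (lin0 hlift_lin) (lin0 states_lin).
split=> [->|[[[[x0 [X1 x1]] [X2 x2]] x3] [h0' h1 h2 h3] ->]].
  by exists 0; [exact: (@adeg_subspace _ _ _ _).1|rewrite (lin0 hlift_lin) (lin0 states_lin)].
have [-> ->] := h1 isT; have [-> ->] := h2 isT; rewrite h0' // h3 //.
by rewrite -[X in hlift X]/(0 : P6) (lin0 hlift_lin) (lin0 states_lin).
Qed.

(* The number of factors c_0 and c_(-1) in e_D, which is the power of h
   attached to e_D in [light]. *)
Definition hdeg (D : {fset int}) : int :=
  ((0 \in D) : nat)%:Z + ((-1 \in D) : nat)%:Z.

Definition homogeneous (k : int) (w : W) : Prop :=
  forall D i, i != hdeg D + k -> w D i = 0.

Lemma homogeneousD k w w' : homogeneous k w -> homogeneous k w' ->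
  homogeneous k (w + w').
Proof. by move=> hw hw' D i ik; rewrite !dsumD hw // hw' // addr0. Qed.

Lemma homogeneous_gvac k v : homogeneous k (gvac (hmono k v)).
Proof.
move=> D i ik; rewrite gvacE; case: eqP => // D0.
by rewrite hmonoE; case: eqP => // ki; move: ik; rewrite D0 ki /hdeg !inE add0r eqxx.
Qed.

Lemma homogeneous_gc m k w : m <= 1 ->
  homogeneous k w -> homogeneous (k - ((m == 0) || (m == -1) : nat)%:Z) (gc m w).
Proof.
move=> m1 hw D i ik; rewrite gcE m1; case: eqP => [mD|_]; last by rewrite scale0r.
rewrite dsumZ hw ?scaler0 //; apply: contraNneq ik => ->.
rewrite /hdeg !mem_toggle.
have [m0|m0] := eqVneq m 0; first by rewrite {}m0 in mD *; rewrite mD addbF /=; lia.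
rewrite addbF.
have [mN|mN] := eqVneq m (-1); first by rewrite {}mN in mD *; rewrite mD /=; lia.
by rewrite addbF /=; lia.
Qed.

Lemma homogeneous_hlift p : homogeneous 0 (states (hlift p)).
Proof.
case: p => [[[x0 [X1 x1]] [X2 x2]] x3].
have v k (u : V) := @homogeneous_gvac k u; have g := homogeneous_gc.
have g1 k w := g 1 k w isT; have g0 k w := g 0 k w isT; have gN k w := g (-1) k w isT.
have v0 : homogeneous 0 (gvac (hmono 0 (subspace_val x0))) := v 0 _.
have v1 : homogeneous 0 (gc 1 (gvac (hmono 0 (subspace_val X1)))) := g1 _ _ (v 0 _).
have v2 : homogeneous 0 (gc 0 (gvac (hmono 1 (subspace_val x1)))) := g0 _ _ (v 1 _).
have v3 : homogeneous 0 (gc 1 (gc 0 (gvac (hmono 1 (subspace_val X2))))) :=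
  g1 _ _ (g0 _ _ (v 1 _)).
have v4 : homogeneous 0 (gc 1 (gc (-1) (gvac (hmono 1 (subspace_val x2))))) :=
  g1 _ _ (gN _ _ (v 1 _)).
have v5 : homogeneous 0 (gc 1 (gc 0 (gc (-1) (gvac (hmono 2 (subspace_val x3)))))) :=
  g1 _ _ (g0 _ _ (gN _ _ (v 2 _))).
exact: (homogeneousD (homogeneousD (homogeneousD (homogeneousD (homogeneousD v0 v1) v2) v3) v4) v5).
Qed.

Lemma light_homogeneous i y : light Vgr i y -> homogeneous 0 y.
Proof. by move=> /light_states[p _ ->]; exact: homogeneous_hlift. Qed.

Lemma light_total_homogeneous y : light_total Vgr y -> homogeneous 0 y.
Proof.
move=> [f fl ->] D i Di; rewrite !dsum_sum big1 // => j _.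
exact: (light_homogeneous (fl j)).
Qed.

Lemma light0 i : light Vgr i (0 : W).
Proof.
apply/light_states; exists 0; first exact: (@adeg_subspace _ _ _ _).1.
by rewrite (lin0 hlift_lin) (lin0 states_lin).
Qed.

Lemma light_total_light i y : light Vgr i y -> light_total Vgr y.
Proof.
move=> ly; exists (fun j : nat => if j%:Z == i then y else 0) => [j|].
  by case: eqP => [->//|_]; exact: light0.
have zero k : (forall j : nat, (j < 4)%N -> j%:Z != k) -> light Vgr k y -> y = 0.
  by case: k => [[|[|[|[|k]]]]|k] h //=; move: (h 0%N isT) (h 1%N isT) (h 2%N isT) (h 3%N isT).
case: i ly => [i|i] ly; last first.
  by rewrite (zero (Negz i)) // big1 // => j _; rewrite if_same.
have [i4|i4] := ltnP i 4.
  rewrite (bigD1 (Ordinal i4)) //= eqxx big1 ?addr0 // => j ji.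
  by case: eqP => // -[e]; case/eqP: ji; apply: val_inj.
rewrite (zero (Posz i)) //; last first.
  by move=> j j4; apply/eqP => -[e]; move: i4; rewrite -e leqNgt j4.
by rewrite big1 // => j _; rewrite if_same.
Qed.

Lemma leading_homogeneous (A : set W) x y D : A `<=` homogeneous 0 ->
  leading A x y -> y D (hdeg D) = x D (hdeg D).
Proof.
move=> hA [Ay [N [f fA ->]]]; rewrite !dsumD !dsum_sum big1 ?addr0 // => j _.
rewrite dmapE ?hshift0 // hshiftE (hA _ (fA j)) //.
by rewrite addr0 -subr_eq0; lia.
Qed.

(** A candidate in $\mathcal F$ is concentrated, at the word $e_D$, in the power [hdeg D] of $h$,
    and the remaining terms of [x] lie in higher powers there. So [x] determines every candidate. *)
Lemma lead_uniq i x y : leading (light Vgr i) x y -> lead Vgr x = y.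
Proof.
move=> [ly [N [f fl xE]]]; apply: xget_unique => /= [|y'].
  split; first exact: light_total_light ly.
  by exists N, f => // j; exact: light_total_light (fl j).
move=> ly'; have /light_total_homogeneous hy' := ly'.1.
have hy := light_homogeneous ly.
apply: dsumP => D; apply: dsumP => k.
have [->|kD] := eqVneq k (hdeg D); last by rewrite hy ?hy' ?addr0.
rewrite (leading_homogeneous _ light_total_homogeneous ly').
symmetry; apply: (@leading_homogeneous (light Vgr i)); first exact: light_homogeneous.
by split=> //; exists N, f.
Qed.

(** Valid for all large [M], so that the six components can share one bound. *)
Lemma leads_split a (X : U) (x : V) : leads a X x -> exists N, forall M, (N <= M)%N ->
  X = hmono a x + \sum_(j < M) hmono (a + j.+1%:Z) (X (a + j.+1%:Z)).
Proof.
move=> [aX <-]; have [N hN] := orderge_sum aX.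
exists N => M NM; rewrite [LHS](hN M.+1 (leqW NM)) big_ord_recl.
by rewrite /= !addr0.
Qed.

Definition leads_in (p : nat) (a : int) (X : U) (x : sub p) : Prop :=
  laurent_in (Vgr p) X /\ leads a X (subspace_val x).

Lemma leads_in0 p a : leads_in (p := p) a 0 0.
Proof. by split; [move=> k; exact: subspace0 (Vgr_subspace grV p)|exact: leads0]. Qed.

Lemma leads_inD p a X Y (x y : sub p) : leads_in a X x -> leads_in a Y y ->
  leads_in a (X + Y) (x + y).
Proof.
move=> [lX hX] [lY hY]; split; last exact: leadsD.
by move=> k; rewrite dsumD; exact: subspaceD (Vgr_subspace grV p) _ _ (lX k) (lY k).
Qed.

Lemma leads_inN p a X (x : sub p) : leads_in a X x -> leads_in a (- X) (- x).
Proof.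
move=> [lX hX]; split; last exact: leadsN.
by move=> k; rewrite dsumN; exact: subspaceN (Vgr_subspace grV p) _ (lX k).
Qed.

Lemma leads_inMn p a X (x : sub p) n : leads_in a X x -> leads_in a (X *+ n) (x *+ n).
Proof.
move=> h; elim: n => [|n ih]; first exact: leads_in0.
by rewrite !mulrS; exact: leads_inD.
Qed.

Lemma leads_in_weaken p b a X (x : sub p) : leads_in b X x -> a < b -> leads_in (p := p) a X 0.
Proof. by move=> [lX hX] ab; split=> //; exact: leads_weaken hX ab. Qed.

Lemma leads_in_eq p a X (x y : sub p) : leads_in a X x -> x = y -> leads_in a X y.
Proof. by move=> h <-. Qed.

Section Modes.
Variables (a b : int) (X Y x y : U) (A B : V1) (u v : V0).
Hypotheses (hx : leads_in a x u) (hX : leads_in a X A)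
  (hy : leads_in b y v) (hY : leads_in b Y B).

Lemma leads_mul : leads_in (a + b) (vm x (-1) y) (amul S u v).
Proof.
split; first exact: (vmode_wt_eq T hx.1 hy.1).
exact: (leads_modeN1 fpT hx.2 hy.2).
Qed.

Lemma leads_act : leads_in (a + b) (vm x (-1) Y) (aact S u B).
Proof.
split; first exact: (vmode_wt_eq T hx.1 hY.1).
exact: (leads_modeN1 fpT hx.2 hY.2).
Qed.

Lemma leads_actr : leads_in (a + b) (vm X (-1) y) (aact S v A).
Proof.
split; first exact: (vmode_wt_eq T hX.1 hy.1).
rewrite /= -(symbol_actr grV fpT (subspace_valP v) (subspace_valP A)).
exact: (leads_modeN1 fpT hX.2 hy.2).
Qed.

Lemma leads_anc : leads_in (a + b + 1) (vm X 0 y) (aanc S A v).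
Proof.
split; first exact: (vmode_wt_eq T hX.1 hy.1).
exact: (leads_mode (n := 0) fpT isT hX.2 hy.2).
Qed.

Lemma leads_ancl : leads_in (a + b + 1) (vm x 0 Y) (- aanc S B u).
Proof.
rewrite (mode01_skew0 T hx.1 hY.1); apply: leads_inN.
split; first exact: (vmode_wt_eq T hY.1 hx.1).
by rewrite [a + b]addrC; exact: (leads_mode (n := 0) fpT isT hY.2 hx.2).
Qed.

Lemma leads_br : leads_in (a + b + 1) (vm X 0 Y) (abr S A B).
Proof.
split; first exact: (vmode_wt_eq T hX.1 hY.1).
exact: (leads_mode (n := 0) fpT isT hX.2 hY.2).
Qed.

Lemma leads_pr : leads_in (a + b + 1) (vm X 1 Y) (apr S A B).
Proof.
split; first exact: (vmode_wt_eq T hX.1 hY.1).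
exact: (leads_mode (n := 1) fpT isT hX.2 hY.2).
Qed.

End Modes.

Definition lead6 (m : L6) (p : P6) : Prop :=
  let: (m0, (M1, m1), (M2, m2), m3) := m in
  let: (x0, (X1, x1), (X2, x2), x3) := p in
  [/\ leads_in 0 m0 x0, leads_in 0 M1 X1 /\ leads_in 1 m1 x1,
      leads_in 1 M2 X2 /\ leads_in 1 m2 x2 & leads_in 2 m3 x3].

Lemma lead6_hlift p : lead6 (hlift p) p.
Proof.
case: p => [[[x0 [X1 x1]] [X2 x2]] x3].
have h (q : nat) k (x : sub q) : leads_in k (hmono k (subspace_val x)) x.
  by split; [exact: (laurent_in_hmono grV k (subspace_valP x))|exact: leads_hmono].
by split; [exact: h|split; exact: h|split; exact: h|exact: h].
Qed.

Lemma lead6D m m' p p' : lead6 m p -> lead6 m' p' -> lead6 (m + m') (p + p').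
Proof.
case: m p m' p' => [[[m0 [M1 m1]] [M2 m2]] m3] [[[x0 [X1 x1]] [X2 x2]] x3].
move=> [[[n0 [N1 n1]] [N2 n2]] n3] [[[y0 [Y1 y1]] [Y2 y2]] y3].
move=> [hx0 [hX1 hx1] [hX2 hx2] hx3] [hy0 [hY1 hy1] [hY2 hy2] hy3].
by split; [exact: leads_inD|split; exact: leads_inD|split; exact: leads_inD|exact: leads_inD].
Qed.

Lemma lead6N m p : lead6 m p -> lead6 (- m) (- p).
Proof.
case: m p => [[[m0 [M1 m1]] [M2 m2]] m3] [[[x0 [X1 x1]] [X2 x2]] x3].
move=> [hx0 [hX1 hx1] [hX2 hx2] hx3].
by split; [exact: leads_inN|split; exact: leads_inN|split; exact: leads_inN|exact: leads_inN].
Qed.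

Definition mu_modes (x y : L6) : L6 :=
  let: (x0, (X1, x1), (X2, x2), x3) := x in
  let: (y0, (Y1, y1), (Y2, y2), y3) := y in
  (vm x0 (-1) y0,
   (vm x0 (-1) Y1 + vm X1 (-1) y0,
    vm x0 (-1) y1 + vm X1 0 y0 + vm x1 (-1) y0),
   (vm x0 (-1) Y2 + vm X1 (-1) y1 - vm X1 0 Y1 - vm x1 (-1) Y1 + vm X2 (-1) y0,
    vm x0 (-1) y2 - vm X1 1 Y1 - vm x1 0 Y1 *+ 2 + vm X2 0 y0 *+ 2 + vm x2 (-1) y0),
   vm x0 (-1) y3 - vm X1 0 y2 + vm X1 1 Y2 - vm x1 (-1) y2 + vm x1 0 Y2 *+ 2
   - vm X2 0 y1 *+ 2 + vm X2 1 Y1 - vm x2 (-1) y1 + vm x2 0 Y1 + vm x3 (-1) y0).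

Definition n1_modes (x y z : L6) : L6 :=
  let: (x0, (X1, x1), (X2, x2), x3) := x in
  let: (y0, (Y1, y1), (Y2, y2), y3) := y in
  let: (z0, (Z1, z1), (Z2, z2), z3) := z in
  let p := vm y0 0 Z1 + vm Y1 0 z0 in
  let q := vm y0 0 Z2 + vm Y1 0 z1 - vm Y1 1 Z1 - vm y1 0 Z1 + vm Y2 0 z0 in
  (0, (vm X1 (-1) p, 0),
   (vm X1 (-1) q - vm X2 (-1) p, - (vm X2 0 p *+ 2) - vm x2 (-1) p),
   vm X2 0 q *+ 2 + vm x2 (-1) q + vm x3 (-1) p).

(** What survives of [n1_modes]: [p] contributes above the leading orders only, and [q] has leading
    coefficient $-\langle Y_1,Z_1\rangle$. *)
Definition an1 (x y z : P6) : P6 :=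
  let: (x0, (X1, x1), (X2, x2), x3) := x in
  let: (y0, (Y1, y1), (Y2, y2), y3) := y in
  let: (z0, (Z1, z1), (Z2, z2), z3) := z in
  (0, (0, 0), (- aact S (apr S Y1 Z1) X1, 0), - amul S x2 (apr S Y1 Z1)).

Lemma lead6_mu m m' p p' : lead6 m p -> lead6 m' p' ->
  lead6 (mu_modes m m') (amu S p p').
Proof.
case: m p m' p' => [[[m0 [M1 m1]] [M2 m2]] m3] [[[x0 [X1 x1]] [X2 x2]] x3].
move=> [[[n0 [N1 n1]] [N2 n2]] n3] [[[y0 [Y1 y1]] [Y2 y2]] y3].
move=> [hx0 [hX1 hx1] [hX2 hx2] hx3] [hy0 [hY1 hy1] [hY2 hy2] hy3].
have w := leads_in_weaken.
split; last 1 first.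
- have := leads_inD (leads_inD (leads_inD (leads_inD (leads_inD (leads_inD (leads_inD
    (leads_inD (leads_inD (leads_mul hx0 hy3) (leads_inN (leads_anc hX1 hy2)))
    (leads_pr hX1 hY2)) (leads_inN (leads_mul hx1 hy2)))
    (leads_inMn 2 (w _ _ 2 _ _ (leads_ancl hx1 hY2) isT)))
    (leads_inN (leads_inMn 2 (w _ _ 2 _ _ (leads_anc hX2 hy1) isT))))
    (leads_pr hX2 hY1)) (leads_inN (leads_mul hx2 hy1))) (leads_ancl hx2 hY1))
    (leads_mul hx3 hy0).
  by move/leads_in_eq; apply; zmodule.
- exact: (leads_mul hx0 hy0).
- split; first exact: (leads_inD (leads_act hx0 hY1) (leads_actr hX1 hy0)).
  exact: (leads_inD (leads_inD (leads_mul hx0 hy1) (leads_anc hX1 hy0)) (leads_mul hx1 hy0)).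
split.
- have := leads_inD (leads_inD (leads_inD (leads_inD (leads_act hx0 hY2)
    (leads_actr hX1 hy1)) (leads_inN (leads_br hX1 hY1)))
    (leads_inN (leads_act hx1 hY1))) (leads_actr hX2 hy0).
  by move/leads_in_eq; apply; zmodule.
have := leads_inD (leads_inD (leads_inD (leads_inD (leads_mul hx0 hy2)
  (leads_inN (leads_pr hX1 hY1)))
  (leads_inN (leads_inMn 2 (w _ _ 1 _ _ (leads_ancl hx1 hY1) isT))))
  (leads_inMn 2 (w _ _ 1 _ _ (leads_anc hX2 hy0) isT))) (leads_mul hx2 hy0).
by move/leads_in_eq; apply; zmodule.
Qed.

Lemma lead6_n1 m m' m'' x y z : lead6 m x -> lead6 m' y -> lead6 m'' z ->
  lead6 (n1_modes m m' m'') (an1 x y z).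
Proof.
case: m x m' y m'' z => [[[m0 [M1 m1]] [M2 m2]] m3] [[[x0 [X1 x1]] [X2 x2]] x3].
move=> [[[n0 [N1 n1]] [N2 n2]] n3] [[[y0 [Y1 y1]] [Y2 y2]] y3].
move=> [[[o0 [O1 o1]] [O2 o2]] o3] [[[z0 [Z1 z1]] [Z2 z2]] z3].
move=> [_ [hX1 _] [hX2 hx2] hx3] [hy0 [hY1 hy1] [hY2 hy2] hy3].
move=> [hz0 [hZ1 hz1] [hZ2 hz2] hz3].
rewrite /n1_modes /an1.
set p := vm n0 0 O1 + vm N1 0 o0.
set q := _ + vm N2 0 o0.
have w := leads_in_weaken.
(* All terms with [p] land above the order of their component, so it is enough that [p] has order at
   least 1. *)
have [p' hp] : exists p' : V0, leads_in 1 p p'.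
  by exists (- aanc S Z1 y0 + aanc S Y1 z0);
    exact: (leads_inD (leads_ancl hy0 hZ1) (leads_anc hY1 hz0)).
have hq : leads_in 1 q (- apr S Y1 Z1).
  have := leads_inD (leads_inD (leads_inD (leads_inD
    (w _ _ 1 _ _ (leads_ancl hy0 hZ2) isT) (w _ _ 1 _ _ (leads_anc hY1 hz1) isT))
    (leads_inN (leads_pr hY1 hZ1))) (leads_inN (w _ _ 1 _ _ (leads_ancl hy1 hZ1) isT)))
    (w _ _ 1 _ _ (leads_anc hY2 hz0) isT).
  by move/leads_in_eq; apply; zmodule.
split; last 1 first.
- have := leads_inD (leads_inD (leads_inMn 2 (w _ _ 2 _ _ (leads_anc hX2 hq) isT))
    (leads_mul hx2 hq)) (w _ _ 2 _ _ (leads_mul hx3 hp) isT).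
  move/leads_in_eq; apply; rewrite (bilinNr (amul_bilin S)); zmodule.
- exact: leads_in0.
- split; last exact: leads_in0.
  exact: (w _ _ 0 _ _ (leads_actr hX1 hp) isT).
split.
- have := leads_inD (leads_actr hX1 hq) (leads_inN (w _ _ 1 _ _ (leads_actr hX2 hp) isT)).
  by move/leads_in_eq; apply; rewrite (bilinNl (aact_bilin S)); zmodule.
have := leads_inD (leads_inN (leads_inMn 2 (w _ _ 1 _ _ (leads_anc hX2 hp) isT)))
  (leads_inN (w _ _ 1 _ _ (leads_mul hx2 hp) isT)).
by move/leads_in_eq; apply; zmodule.
Qed.

Definition supported (i a : int) (X : U) : Prop := i != a -> X = 0.

Lemma supported0 i a : supported i a 0.
Proof. by []. Qed.

Lemma supportedD i a X Y : supported i a X -> supported i a Y -> supported i a (X + Y).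
Proof. by move=> hX hY ia; rewrite hX ?hY ?addr0. Qed.

Lemma supportedN i a X : supported i a X -> supported i a (- X).
Proof. by move=> hX ia; rewrite hX ?oppr0. Qed.

Lemma supported_vmode i j a b n X Y : supported i a X -> supported j b Y ->
  supported (i + j) (a + b) (vm X n Y).
Proof.
move=> hX hY; have vb : bilin (fun X Y => vm X n Y).
  by split=> *; [exact: vlinl|exact: vlinr].
exact: (bilin_deg vb hX hY).
Qed.

(** Accounts for the degree $-1$ of $n$: because of $b_{-1}$, each component collects products whose
    factors have one degree more in total. *)
Lemma supported_pred i a X : supported i (a + 1) X -> supported (i - 1) a X.
Proof. by move=> hX ia; apply: hX; apply: contraNneq ia; lia. Qed.

Lemma adegE i x0 X1 x1 X2 x2 x3 :
  adeg i ((x0, (X1, x1), (X2, x2), x3) : L6) <->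
  [/\ supported i 0 x0, supported i 1 X1 /\ supported i 1 x1,
     supported i 2 X2 /\ supported i 2 x2 & supported i 3 x3].
Proof.
split=> -[h0 h1 h2 h3]; split=> //; last 2 first.
- by move=> h; split; [exact: h1.1|exact: h1.2].
- by move=> h; split; [exact: h2.1|exact: h2.2].
- by split=> h; [exact: (h1 h).1|exact: (h1 h).2].
- by split=> h; [exact: (h2 h).1|exact: (h2 h).2].
Qed.

Lemma mu_modes_deg i j x y : adeg i x -> adeg j y -> adeg (i + j) (mu_modes x y).
Proof.
move: x y => [[[x0 [X1 x1]] [X2 x2]] x3] [[[y0 [Y1 y1]] [Y2 y2]] y3].
move=> /adegE[hx0 [hX1 hx1] [hX2 hx2] hx3] /adegE[hy0 [hY1 hy1] [hY2 hy2] hy3].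
have v a b n X Y := @supported_vmode i j a b n X Y.
apply/adegE; split; [|split|split|].
all: repeat first [apply: supportedD|apply: supportedN].
all: first [exact: (v 0 0)|exact: (v 0 1)|exact: (v 1 0)|exact: (v 0 2)|exact: (v 1 1)
  |exact: (v 2 0)|exact: (v 0 3)|exact: (v 1 2)|exact: (v 2 1)|exact: (v 3 0)].
Qed.

Lemma n1_modes_deg i j k x y z : adeg i x -> adeg j y -> adeg k z ->
  adeg (i + j + k - 1) (n1_modes x y z).
Proof.
move: x y z => [[[x0 [X1 x1]] [X2 x2]] x3] [[[y0 [Y1 y1]] [Y2 y2]] y3].
move=> [[[z0 [Z1 z1]] [Z2 z2]] z3].
move=> /adegE[_ [hX1 _] [hX2 hx2] hx3] /adegE[hy0 [hY1 hy1] [hY2 hy2] _].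
move=> /adegE[hz0 [hZ1 hz1] [hZ2 hz2] _].
have v a b n X Y := @supported_vmode j k a b n X Y.
rewrite /n1_modes; set p := vm y0 0 Z1 + vm Y1 0 z0; set q := _ + vm Y2 0 z0.
have hp : supported (j + k) 1 p.
  by apply: supportedD; [exact: (v 0 1)|exact: (v 1 0)].
have hq : supported (j + k) 2 q.
  repeat first [apply: supportedD|apply: supportedN].
  - exact: (v 0 2).
  - exact: (v 1 1).
  - exact: (v 1 1).
  - exact: (v 1 1).
  exact: (v 2 0).
rewrite -(addrA i j k); have {}v a b n X Y := @supported_vmode i (j + k) a b n X Y.
apply/adegE; split; [|split|split|].
all: apply: supported_pred.
all: repeat first [exact: supported0|apply: supportedD|apply: supportedN].
all: first [exact: (v 1 1)|exact: (v 1 2)|exact: (v 2 1)|exact: (v 2 2)|exact: (v 3 1)].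
Qed.

Definition parity_part (A0 A1 : lmodType K) (p : bool) (x : sixtuple A0 A1) : sixtuple A0 A1 :=
  let: (x0, (X1, x1), (X2, x2), x3) := x in
  if p then (0, (X1, x1), (0, 0), x3) else (x0, (0, 0), (X2, x2), 0).

Lemma par_states p m : par p (states m) = states (parity_part p m).
Proof.
case: m => [[[m0 [M1 m1]] [M2 m2]] m3].
by rewrite /states par_clight; case: p.
Qed.

Lemma parity_part_deg A0 A1 p i (x : sixtuple A0 A1) : adeg i x -> adeg i (parity_part p x).
Proof.
by case: x => [[[x0 [X1 x1]] [X2 x2]] x3] [h0 h1 h2 h3]; case: p; split.
Qed.

Lemma parity_part_lead p m x : lead6 m x -> lead6 (parity_part p m) (parity_part p x).
Proof.
case: m x => [[[m0 [M1 m1]] [M2 m2]] m3] [[[x0 [X1 x1]] [X2 x2]] x3].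
move=> [hx0 [hX1 hx1] [hX2 hx2] hx3]; have h0 q a := @leads_in0 q a.
by case: p; split=> //; try split; try exact: h0.
Qed.

Definition n_modes (x y z : L6) : L6 :=
  n1_modes x y z
  + (n1_modes (parity_part false y) (parity_part false x) z
     + n1_modes (parity_part true y) (parity_part false x) z
     + (n1_modes (parity_part false y) (parity_part true x) z
        - n1_modes (parity_part true y) (parity_part true x) z)).

Lemma n_modes_deg i j k x y z : adeg i x -> adeg j y -> adeg k z ->
  adeg (i + j + k - 1) (n_modes x y z).
Proof.
move=> dx dy dz; have sub := @adeg_subspace K U U (i + j + k - 1).
have h p q : adeg (i + j + k - 1) (n1_modes (parity_part q y) (parity_part p x) z).
  by rewrite [i + j]addrC; apply: n1_modes_deg => //; exact: parity_part_deg.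
apply: (subspaceD sub); first exact: n1_modes_deg.
exact: (subspaceD sub (subspaceD sub (h _ _) (h _ _))
  (subspaceD sub (h _ _) (subspaceN sub (h _ _)))).
Qed.

Lemma lead6_n m m' m'' x y z : lead6 m x -> lead6 m' y -> lead6 m'' z ->
  lead6 (n_modes m m' m'') (an S x y z).
Proof.
move=> hx hy hz.
have h p q := lead6_n1 (parity_part_lead q hy) (parity_part_lead p hx) hz.
have := lead6D (lead6_n1 hx hy hz) (lead6D (lead6D (h false false) (h false true))
  (lead6D (h true false) (lead6N (h true true)))).
congr lead6; move: x y z {hx hy hz h} => [[[x0 [X1 x1]] [X2 x2]] x3].
move=> [[[y0 [Y1 y1]] [Y2 y2]] y3] [[[z0 [Z1 z1]] [Z2 z2]] z3].
rewrite /an1 /an /parity_part !(sixtupleN, sixtupleD).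
rewrite !(bvops S); congr (_, (_, _), (_, _), _) => /=; zmodule.
Qed.

Definition coefficient (q : nat) a (X : U) (lX : laurent_in (Vgr q) X) : sub q :=
  to_subspace (Vgr_subspace grV q) (lX a).

Lemma coefficient_leading k m p : lead6 m p -> adeg k m ->
  leading (light Vgr k) (states m) (states (hlift p)).
Proof.
case: m p => [[[m0 [M1 m1]] [M2 m2]] m3] [[[x0 [X1 x1]] [X2 x2]] x3].
move=> [[l0 hx0] [[L1 hX1] [l1 hx1]] [[L2 hX2] [l2 hx2]] [l3 hx3]] [d0 d1 d2 d3].
(* The $h$-expansion relative to $\mathcal F$: each component is read [j + 1] powers above its own
   leading power. *)
pose c j : P6 := (coefficient (0 + j.+1%:Z) l0,
  (coefficient (0 + j.+1%:Z) L1, coefficient (1 + j.+1%:Z) l1),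
  (coefficient (1 + j.+1%:Z) L2, coefficient (1 + j.+1%:Z) l2),
  coefficient (2 + j.+1%:Z) l3).
have c0 q a X (lX : laurent_in (Vgr q) X) : X = 0 -> coefficient a lX = 0.
  by move=> X0; apply: val_inj; rewrite /= X0.
have x0' q a X (x : sub q) : leads a X (subspace_val x) -> X = 0 -> x = 0.
  by move=> [_ e] X0; apply: val_inj; rewrite /= -e X0.
have [N0 s0] := leads_split hx0; have [N1 s1] := leads_split hX1.
have [N2 s2] := leads_split hx1; have [N3 s3] := leads_split hX2.
have [N4 s4] := leads_split hx2; have [N5 s5] := leads_split hx3.
split.
  apply/light_states; exists (x0, (X1, x1), (X2, x2), x3) => //.
  split=> h; [exact: x0' hx0 (d0 h)| | |exact: x0' hx3 (d3 h)].
    by have [e e'] := d1 h; split; [exact: x0' hX1 e|exact: x0' hx1 e'].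
  by have [e e'] := d2 h; split; [exact: x0' hX2 e|exact: x0' hx2 e'].
exists (N0 + N1 + N2 + N3 + N4 + N5)%N, (fun j => states (hlift (c j))) => [j|].
  apply/light_states; exists (c j) => //.
  split=> h; [exact: c0 (d0 h)| | |exact: c0 (d3 h)].
    by have [e e'] := d1 h; split; exact: c0.
  by have [e e'] := d2 h; split; exact: c0.
pose f a (X : U) j := hmono (a + j.+1%:Z) (X (a + j.+1%:Z)).
have E j : hact j.+1%:Z (states (hlift (c j))) =
    clight (f 0 m0 j) (f 0 M1 j) (f 1 m1 j) (f 1 M2 j) (f 1 m2 j) (f 2 m3 j).
  rewrite /hact /states /hlift /c dmap_clight; last exact: hshift_linear.
  by rewrite !hshift_mono ![j.+1%:Z + _]addrC.
rewrite (eq_bigr _ (fun (j : 'I__) _ => E j)).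
rewrite (cwords_sum gl cl _ (f 0 m0) (f 0 M1) (f 1 m1) (f 1 M2) (f 1 m2) (f 2 m3)).
rewrite /states /hlift (cwordsD gl cl).
f_equal; [apply: s0|apply: s1|apply: s2|apply: s3|apply: s4|apply: s5]; lia.
Qed.

Lemma lz_mu_states m m' x y : lead6 m x -> lead6 m' y ->
  lz_mu T (states m) (states m') = states (mu_modes m m').
Proof.
case: m x m' y => [[[m0 [M1 m1]] [M2 m2]] m3] [[[x0 [X1 x1]] [X2 x2]] x3].
move=> [[[n0 [N1 n1]] [N2 n2]] n3] [[[y0 [Y1 y1]] [Y2 y2]] y3].
move=> [[hx0 _] [[hX1 _] [hx1 _]] [[hX2 _] [hx2 _]] [hx3 _]].
move=> [[hy0 _] [[hY1 _] [hy1 _]] [[hY2 _] [hy2 _]] [hy3 _]].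
exact: tmode_N1_light.
Qed.

Lemma lz_n1_states m m' m'' x y z : lead6 m x -> lead6 m' y -> lead6 m'' z ->
  lz_n1 T (states m) (states m') (states m'') = states (n1_modes m m' m'').
Proof.
case: m x m' y => [[[m0 [M1 m1]] [M2 m2]] m3] [[[x0 [X1 x1]] [X2 x2]] x3].
move=> [[[n0 [N1 n1]] [N2 n2]] n3] [[[y0 [Y1 y1]] [Y2 y2]] y3].
case: m'' z => [[[o0 [O1 o1]] [O2 o2]] o3] [[[z0 [Z1 z1]] [Z2 z2]] z3].
move=> [[hx0 _] [[hX1 _] [hx1 _]] [[hX2 _] [hx2 _]] [hx3 _]].
move=> [[hy0 _] [[hY1 _] [hy1 _]] [[hY2 _] [hy2 _]] [hy3 _]].
move=> [[hz0 _] [[hZ1 _] [hz1 _]] [[hZ2 _] [hz2 _]] [hz3 _]].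
exact: lz_n1_light.
Qed.

Lemma lz_n_parity w w' w'' (n : bool -> bool -> W) :
  (forall p q, lz_n1 T (par q w') (par p w) w'' = n p q) ->
  lz_n T w w' w'' = lz_n1 T w w' w''
    + (n false false + n false true + (n true false - n true true)).
Proof.
move=> e; transitivity (lz_n1 T w w' w'' + \sum_p \sum_q (-1) ^+ (p && q) *: n p q).
  by congr (_ + _); apply: eq_bigr => p _; apply: eq_bigr => q _; rewrite e.
rewrite (sum_bool2 (fun p q => (-1) ^+ (p && q) *: n p q)).
by rewrite expr1 expr0 scaleN1r 3!scale1r.
Qed.

Lemma lz_n_states m m' m'' x y z : lead6 m x -> lead6 m' y -> lead6 m'' z ->
  lz_n T (states m) (states m') (states m'') = states (n_modes m m' m'').
Proof.
move=> hx hy hz; have sl := states_lin.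
have h p q := lz_n1_states (parity_part_lead q hy) (parity_part_lead p hx) hz.
have e p q : lz_n1 T (par q (states m')) (par p (states m)) (states m'') =
    states (n1_modes (parity_part q m') (parity_part p m) m'').
  rewrite (par_states q m') (par_states p m); exact: h.
rewrite (lz_n_parity e) (lz_n1_states hx hy hz).
have sD (a b : L6) : states (a + b) = states a + states b := linD sl a b.
have sN (a : L6) : states (- a) = - states a := linN sl a.
by rewrite /n_modes 4!sD sN.
Qed.

Lemma hmono_Lm1 k u : virasoro T (-1) (hmono k u) = hmono k (symbol_Lm1 T u).
Proof.
have -> : hmono k u = hshift k (hmono 0 u) by rewrite hshift_mono addr0.
rewrite /virasoro (fp_comm fpT) -/(virasoro T (-1) _).
have c : constL (virasoro T (-1) (hmono 0 u)).
  by apply: (fp_Lm1 fpT) => j j0; rewrite hmonoE (negbTE j0).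
have -> : virasoro T (-1) (hmono 0 u) = hmono 0 (symbol_Lm1 T u).
  by apply: dsumP => j; rewrite hmonoE; case: eqP => [->//|/eqP/c].
by rewrite hshift_mono addr0.
Qed.

Lemma hmono_L1 k u : Vgr 1 u -> virasoro T 1 (hmono k u) = hmono (k + 1) (symbol_L1 T u).
Proof.
move=> wu.
have -> : hmono k u = hshift k (hmono 0 u) by rewrite hshift_mono addr0.
rewrite /virasoro (fp_comm fpT) -/(virasoro T 1 _).
have -> : virasoro T 1 (hmono 0 u) = hmono 1 (symbol_L1 T u).
  by apply: dsumP => j; rewrite hmonoE; case: eqP => [->//|/eqP/(fp_L1 fpT wu)].
by rewrite hshift_mono.
Qed.

(** An exact equality: by [hmono_Lm1] and [hmono_L1] a monomial in $h$ goes to a monomial, and its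
    power is the one that [hlift] prescribes for the target component. *)
Lemma brst_hlift p : brst T (states (hlift p)) = states (hlift (aQ S p)).
Proof.
case: p => [[[x0 [X1 x1]] [X2 x2]] x3].
have w (q : nat) k (u : sub q) := laurent_in_hmono grV k (subspace_valP u).
rewrite /states /hlift (brst_light T (w _ _ _) (w _ _ _) (w _ _ _) (w _ _ _) (w _ _ _) (w _ _ _)).
rewrite 2!hmono_Lm1 (hmono_L1 _ (subspace_valP X1)) (hmono_L1 _ (subspace_valP X2)).
rewrite /aQ; cbv beta iota.
have h0 k : 0 = hmono k 0 :> U := esym (hmono0 V k).
f_equal; try exact: h0.
by rewrite -hmonoMn -(linN (@hmono_linear K V 1)) -hmonoD.
Qed.

Lemma leading_mu i j p q : adeg i p -> adeg j q ->
  leading (light Vgr (i + j)) (lz_mu T (states (hlift p)) (states (hlift q)))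
    (states (hlift (amu S p q))).
Proof.
move=> dp dq; have hp := lead6_hlift p; have hq := lead6_hlift q.
rewrite (lz_mu_states hp hq); apply: (coefficient_leading (lead6_mu hp hq)).
exact: mu_modes_deg (adeg_hlift dp) (adeg_hlift dq).
Qed.

Lemma leading_n i j k p q r : adeg i p -> adeg j q -> adeg k r ->
  leading (light Vgr (i + j + k - 1))
    (lz_n T (states (hlift p)) (states (hlift q)) (states (hlift r)))
    (states (hlift (an S p q r))).
Proof.
move=> dp dq dr; have hp := lead6_hlift p; have hq := lead6_hlift q.
have hr := lead6_hlift r.
rewrite (lz_n_states hp hq hr); apply: (coefficient_leading (lead6_n hp hq hr)).
exact: n_modes_deg (adeg_hlift dp) (adeg_hlift dq) (adeg_hlift dr).
Qed.

Lemma lz_mu0_states i j p q : adeg i p -> adeg j q ->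
  lz_mu0 T (states (hlift p)) (states (hlift q)) = states (hlift (amu S p q)).
Proof. by move=> dp dq; exact: lead_uniq (leading_mu dp dq). Qed.

Lemma lz_n0_states i j k p q r : adeg i p -> adeg j q -> adeg k r ->
  lz_n0 T (states (hlift p)) (states (hlift q)) (states (hlift r)) =
  states (hlift (an S p q r)).
Proof. by move=> dp dq dr; exact: lead_uniq (leading_n dp dq dr). Qed.

(** The first two clauses guarantee that [lz_mu0] and [lz_n0] are genuine leading coefficients on
    $\mathcal F$ and not the default value of [lead]. *)
Lemma leading_operations_A3 :
  [/\ forall (i j : int) a1 a2, light Vgr i a1 -> light Vgr j a2 ->
        leading (light Vgr (i + j)) (lz_mu T a1 a2) (lz_mu0 T a1 a2),
      forall (i j k : int) a1 a2 a3,
        light Vgr i a1 -> light Vgr j a2 -> light Vgr k a3 ->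
        leading (light Vgr (i + j + k - 1))
          (lz_n T a1 a2 a3) (lz_n0 T a1 a2 a3) &
      A3_algebra (light Vgr) (brst T) (lz_mu0 T) (lz_n0 T)].
Proof.
split.
- move=> i j a1 a2 /light_states[p dp ->] /light_states[q dq ->].
  by rewrite (lz_mu0_states dp dq); exact: leading_mu.
- move=> i j k a1 a2 a3 /light_states[p dp ->] /light_states[q dq ->].
  move=> /light_states[r dr ->].
  by rewrite (lz_n0_states dp dq dr); exact: leading_n.
apply: (A3_algebra_image (phi := fun p => states (hlift p)) _ _ _ _ _ (courant_A3 S)).
- by move=> a p q; rewrite hlift_lin; exact: states_lin.
- by move=> i y; exact: light_states.
- by move=> i p _; exact: brst_hlift.
- by move=> i j p q; exact: lz_mu0_states.
by move=> i j k p q r; exact: lz_n0_states.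
Qed.

End LightAlgebra.

Theorem theorem3p2 (R : realType) (V : lmodType R[i]) (Vgr : nat -> set V)
    (gradedV : is_graded Vgr) (T : voa (fun n => laurent_in (Vgr n)))
    (formalT : formal_parameter T) :
  [/\ forall (i j : int) a1 a2, light Vgr i a1 -> light Vgr j a2 ->
        leading (light Vgr (i + j)) (lz_mu T a1 a2) (lz_mu0 T a1 a2),
      forall (i j k : int) a1 a2 a3,
        light Vgr i a1 -> light Vgr j a2 -> light Vgr k a3 ->
        leading (light Vgr (i + j + k - 1))
          (lz_n T a1 a2 a3) (lz_n0 T a1 a2 a3) &
      A3_algebra (light Vgr) (brst T) (lz_mu0 T) (lz_n0 T)].
Proof. exact: (@leading_operations_A3 R[i] V Vgr gradedV T formalT). Qed.
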